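(* Let $u(z)$ be an entire solution in $\mathbf{C}^n$ to the partial differential equation $$(\rho_1u_{z_1}+\rho_2u_{z_2}+\cdots+\rho_nu_{z_n})^\ell=p(u),$$ where $\ell\,(\geq 1)$ is an integer, $\rho_1,\rho_2,\ldots,\rho_n$ are constants, and $p(w)$ is a (generic) meromorphic function in $\mathbf{C}$. Then $p(w)$ must be a polynomial, say of degree $\hbar$, in $\mathbf{C}$, and one of the following holds: Case 1. $u(z)=\sqrt[\ell]{c_0}\,(\sigma_1z_1+\sigma_2z_2+\cdots+\sigma_nz_n)+\Phi(z)$ with $\hbar=0$ and $p(w)=c_0$; Case 2. $u(z)=\Bigl(\frac{\ell-\hbar}{\ell}\sqrt[\ell]{c_0}\,(\sigma_1z_1+\sigma_2z_2+\cdots+\sigma_nz_n)+\Phi(z)\Bigr)^{\frac{\ell}{\ell-\hbar}}+a_1$ with $\hbar<\ell$, $\frac{\ell}{\ell-\hbar}$ being an integer, and $p(w)=c_0(w-a_1)^\hbar$; Case 3. $u(z)=\Phi(z)e^{\sqrt[\ell]{c_0}\,(\sigma_1z_1+\sigma_2z_2+\cdots+\sigma_nz_n)}+a_1$ with $\hbar=\ell$ and $p(w)=c_0(w-a_1)^\ell$; Case 4. $u(z)=\frac{a_1-a_2}{2}\cosh\bigl(\sqrt[\ell]{c_0}\,(\sigma_1z_1+\sigma_2z_2+\cdots+\sigma_nz_n)+\Phi(z)\bigr)+\frac{a_1+a_2}{2}$ with $\hbar=\ell$ even and $p(w)=c_0(w-a_1)^{\frac{\ell}{2}}(w-a_2)^{\frac{\ell}{2}}$.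 Here $a_1\neq a_2$, $c_0$, $\sigma_1,\sigma_2,\ldots,\sigma_n$ are constants and $\Phi(z)$ is an entire function in $\mathbf{C}^n$ such that $\rho_1\sigma_1+\rho_2\sigma_2+\cdots+\rho_n\sigma_n=1$ and $\rho_1\Phi_{z_1}+\rho_2\Phi_{z_2}+\cdots+\rho_n\Phi_{z_n}=0$.
   Context: All constants are complex. $u_{z_j}$ and $\Phi_{z_j}$ denote the partial derivatives with respect to $z_j$, and $\sqrt[\ell]{c_0}$ denotes an $\ell$-th root of $c_0$. An entire function in $\mathbf{C}^n$ is a holomorphic function $\mathbf{C}^n\to\mathbf{C}$.
   Formalization: The formal theorem assumes that ρ_1,…,ρ_n are not all zero (otherwise no σ with Σρ_jσ_j=1 exists) and that u is nonconstant (the constant u=0 solves the equation for p=sin, which is not a polynomial). *)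

(* Defs.v *)
From HB Require Import structures.
From mathcomp Require Import all_boot all_order all_algebra.
From mathcomp Require Import all_classical all_reals all_analysis.
From mathcomp Require Import complex.

Set Implicit Arguments.
Unset Strict Implicit.
Unset Printing Implicit Defensive.

Import Order.TTheory GRing.Theory Num.Theory numFieldNormedType.Exports.

Local Open Scope classical_set_scope.
Local Open Scope ring_scope.
Local Open Scope complex_scope.

(* MathComp-Analysis puts the norm topology on the alias R[i]^o only. *)
HB.instance Definition _ (R : rcfType) := GRing.ComAlgebra.copy R[i] R[i]^o.
HB.instance Definition _ (R : rcfType) := Vector.copy R[i] R[i]^o.
HB.instance Definition _ (R : rcfType) := NormedModule.copy R[i] R[i]^o.

(* Points of C^n are row vectors.  The scalars of both normed modules are R[i],
   so [differentiable] is complex Frechet differentiability, and ['D_v]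
   is the complex directional derivative. *)
Definition entire (R : realType) (n : nat) (u : 'rV[R[i]]_n -> R[i]) : Prop :=
  forall z, differentiable u z.

Definition partial (R : realType) (n : nat) (u : 'rV[R[i]]_n -> R[i])
    (j : 'I_n) (z : 'rV[R[i]]_n) : R[i] :=
  'D_(delta_mx 0 j) u z.

Definition finite_part (R : realType) (p : R[i] -> option R[i]) : R[i] -> R[i] :=
  fun w => odflt 0 (p w).

(* A meromorphic function in C is a map into the Riemann sphere, [None] being
   the point at infinity: it is holomorphic near every point with a finite
   value, and [None] is taken exactly at the poles, i.e. at isolated
   singularities where the modulus tends to infinity. *)
Definition meromorphic (R : realType) (p : R[i] -> option R[i]) : Prop :=
  forall a : R[i],
    if p a is Some _ then
      \forall w \near a, p w /\ derivable (finite_part p) w 1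
    else
      (\forall w \near a^', p w) /\
      `|finite_part p w| @[w --> a^'] --> +oo.

Definition cexp (R : realType) (z : R[i]) : R[i] :=
  (expR (complex.Re z))%:C * (cos (complex.Im z) +i* sin (complex.Im z)).

Definition ccosh (R : realType) (z : R[i]) : R[i] :=
  (cexp z + cexp (- z)) / 2%:R.

(* Main.v *)
(* Along a line [t |-> z + t rho] the equation becomes [f'^l = p(f)] for an entire
   function [f] of one variable.  If [f s = f t] and [f' s <> 0], then for some l-th
   root of unity [om] both [x |-> f (s + x)] and [x |-> f (t + om x)] solve the same
   initial value problem, so they coincide: the generic fibres of [f] are orbits of
   the group of affine maps [x |-> om x + b] preserving [f].  Its translations form a
   discrete group, of rank at most 1 by Liouville.  According to the rank and to the
   presence of a reflection, [f] therefore has the same fibres as [(x - b)^m],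
   [exp (k x)] or [cosh (k x + d)], and two applications of Liouville's theorem show
   that it is an affine function of this model (of its inverse, possibly, for [exp]).
   Reading [p] off such an [f] gives the polynomial, without Picard or Nevanlinna theory.

   On the whole of C^n the parameters of the lines are pinned down by identities
   between entire functions: finite differences in the direction [rho] for powers,
   [v (z + t rho) = v z exp (k t)] and the d'Alembert equation in the other cases,
   where [k] ranges over finitely many roots.  Then [Phi z] depends only on the
   projection of [z] along [rho]; in the cosh case it is an entire logarithm.

   Cauchy's formula is obtained from Goursat's argument applied to the homothety
   contracting a circle to an interior point. *)

Require Import Defs.
From HB Require Import structures.
From mathcomp Require Import all_boot all_order all_algebra.
From mathcomp Require Import all_classical all_reals all_analysis.
From mathcomp Require Import complex.
From mathcomp Require Import ring lra zify.

Set Implicit Arguments.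
Unset Strict Implicit.
Unset Printing Implicit Defensive.

Import Order.TTheory GRing.Theory Num.Theory numFieldNormedType.Exports.
Local Open Scope classical_set_scope.
Local Open Scope ring_scope.
Local Open Scope complex_scope.

(** * Derivatives of functions of a real or complex variable *)

Section Modulus.
Variable R : realType.
Implicit Types (x y z w : R[i]) (r : R).

(** The class of a line and its parameters are known only pointwise in the base point, and a priori
    they may jump from one line to the next. What ties the lines together is [p]: read off a single
    nonconstant line, it fixes the class of all nonconstant lines and determines their parameters up
    to an [l]-th root, hence up to a finite choice. A finite choice is removed by multiplying the
    candidate identities: the product vanishes identically, and so does one factor on each complex
    line. Phases do not range over a finite set, so they have to be eliminated before this argument
    applies.

    Lines on which [u] is constant sit at zeros of [p] and must be excluded or absorbed in each
    case. If all lines are constant, [p] is known to vanish on the range of [u] only, and the zero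
    has to be continued to the whole plane.

    On the analytic side, functions vanishing to infinite order take the place of power series, and
    increments of antiderivatives that of contour integrals. *)

Definition md z : R := Normc.normc z.

Lemma normE z : `|z| = (md z)%:C.
Proof. by []. Qed.

Lemma mdM z w : md (z * w) = md z * md w.
Proof. by rewrite /md Normc.normcM. Qed.

Lemma mdV z : md z^-1 = (md z)^-1.
Proof. by rewrite /md Normc.normcV. Qed.

Lemma mdN z : md (- z) = md z.
Proof. by case: z => a b; rewrite /md /= !sqrrN. Qed.

Lemma md0 : md 0 = 0.
Proof. exact: Normc.normc0. Qed.

Lemma md1 : md 1 = 1.
Proof. exact: Normc.normc1. Qed.

Lemma md_ge0 z : 0 <= md z.
Proof. by case: z => a b; exact: sqrtr_ge0. Qed.

Lemma md_eq0 z : (md z == 0) = (z == 0).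
Proof.
by apply/eqP/eqP => [/(@Normc.eq0_normc R)//|->]; exact: md0.
Qed.

Lemma md_gt0 z : (0 < md z) = (z != 0).
Proof. by rewrite lt_neqAle md_ge0 andbT eq_sym md_eq0. Qed.

Lemma mdD z w : md (z + w) <= md z + md w.
Proof. by rewrite -lecR rmorphD -!normE ler_normD. Qed.

Lemma mdB z w : md (z - w) <= md z + md w.
Proof. by rewrite -(mdN w) mdD. Qed.

Lemma mdBC z w : md (z - w) = md (w - z).
Proof. by rewrite -mdN opprB. Qed.

Lemma md_real r : md r%:C = `|r|.
Proof. by rewrite /md /= expr0n /= addr0 sqrtr_sqr. Qed.

Lemma mdX z n : md (z ^+ n) = md z ^+ n.
Proof. by elim: n => [|n IH]; rewrite ?expr0 ?md1// !exprS mdM IH. Qed.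

Lemma md_Re z : `|complex.Re z| <= md z.
Proof.
case: z => a b /=; rewrite /md /= -sqrtr_sqr ler_wsqrtr// lerDl sqr_ge0 //.
Qed.

Lemma md_Im z : `|complex.Im z| <= md z.
Proof.
case: z => a b /=; rewrite /md /= -sqrtr_sqr ler_wsqrtr// lerDr sqr_ge0 //.
Qed.

Lemma md_le z : md z <= `|complex.Re z| + `|complex.Im z|.
Proof.
rewrite {1}[z]complexE.
apply: le_trans (mdD _ _) _; rewrite mdM !md_real.
by rewrite {1}/md /= expr0n expr1n /= add0r sqrtr1 mul1r.
Qed.

Lemma mdBD z w : md z - md w <= md (z - w).
Proof. by rewrite lerBlDr -{1}(subrK w z) mdD. Qed.

Lemma md_sqr z : (md z ^+ 2)%:C = z^*%C * z.
Proof. by rewrite rmorphXn /= -normE sqr_normc mulrC. Qed.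

End Modulus.

Section Der.
Variable R : realType.
Implicit Types (z w : R[i]).

(* [T] is the domain, sent into the plane by [i]: the identity for functions of
   a complex variable, [real_complex] for functions of a real one. *)
Definition cont (T : Type) (i : T -> R[i]) (f : T -> R[i]) (t : T) : Prop :=
  forall e : R, 0 < e -> exists2 d : R, 0 < d &
    forall s, md (i s - i t) < d -> md (f s - f t) < e.

(** Carathéodory's form of the derivative: the difference quotient is a factor [h] continuous at
    [t]. Product and chain rules become algebra on these factors. *)
Definition slope (T : Type) (i : T -> R[i]) (f : T -> R[i]) (t : T) (d : R[i]) :=
  exists h, [/\ h t = d, cont i h t & forall s, f s = f t + h s * (i s - i t)].

Section Cont.
Variables (T : Type) (i : T -> R[i]).
Implicit Types (f g : T -> R[i]) (t : T).

Lemma cont_cst c t : cont i (fun=> c) t.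
Proof. by move=> e e0; exists 1 => // s _; rewrite subrr md0. Qed.

Lemma cont_i t : cont i i t.
Proof. by move=> e e0; exists e. Qed.

Lemma cont_bnd f t : cont i f t -> exists2 d : R, 0 < d &
  forall s, md (i s - i t) < d -> md (f s) <= md (f t) + 1.
Proof.
move=> /(_ 1 ltr01) [d d0 H]; exists d => // s /H.
have := mdBD (f s) (f t); lra.
Qed.

Lemma contD f g t : cont i f t -> cont i g t -> cont i (fun s => f s + g s) t.
Proof.
move=> cf cg e e0.
have [|d1 d10 H1] := cf (e / 2); first lra.
have [|d2 d20 H2] := cg (e / 2); first lra.
exists (Num.min d1 d2); first by rewrite lt_min d10.
move=> s; rewrite lt_min => /andP[/H1 h1 /H2 h2].
have -> : f s + g s - (f t + g t) = (f s - f t) + (g s - g t) by ring.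
apply: le_lt_trans (mdD _ _) _; lra.
Qed.

Lemma contM f g t : cont i f t -> cont i g t -> cont i (fun s => f s * g s) t.
Proof.
move=> cf cg e e0.
have A0 : 0 < md (f t) + 1 by have := md_ge0 (f t); lra.
have B0 : 0 < md (g t) + 1 by have := md_ge0 (g t); lra.
have [|d1 d10 H1] := cf (e / 2 / (md (g t) + 1)); first by rewrite !divr_gt0.
have [|d2 d20 H2] := cg (e / 2 / (md (f t) + 1)); first by rewrite !divr_gt0.
have [d3 d30 H3] := cont_bnd cg.
exists (Num.min d1 (Num.min d2 d3)); first by rewrite !lt_min d10 d20.
move=> s; rewrite !lt_min => /and3P[/H1 h1 /H2 h2 /H3 h3].
have -> : f s * g s - f t * g t = (f s - f t) * g s + f t * (g s - g t) by ring.
apply: le_lt_trans (mdD _ _) _; rewrite !mdM.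
rewrite ltr_pdivlMr// in h1; rewrite ltr_pdivlMr// in h2.
have e1 : md (f s - f t) * md (g s) <= md (f s - f t) * (md (g t) + 1).
  by rewrite ler_wpM2l ?md_ge0.
have e2 : md (f t) * md (g s - g t) <= md (g s - g t) * (md (f t) + 1).
  by rewrite mulrC ler_wpM2l ?md_ge0// lerDl.
lra.
Qed.

Lemma contV f t : f t != 0 -> cont i f t -> cont i (fun s => (f s)^-1) t.
Proof.
rewrite -md_gt0 => f0 cf e e0.
have [|d1 d10 H1] := cf (md (f t) / 2); first by lra.
have [|d2 d20 H2] := cf (e * (md (f t) * (md (f t) / 2))); first by rewrite !mulr_gt0// divr_gt0.
exists (Num.min d1 d2); first by rewrite lt_min d10.
move=> s; rewrite !lt_min => /andP[/H1 h1 /H2 h2].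
have fs : md (f t) / 2 < md (f s).
  by have := mdBD (f t) (f s); rewrite mdBC; lra.
have fs0 : 0 < md (f s) by lra.
have -> : (f s)^-1 - (f t)^-1 = (f t - f s) * ((f t)^-1 * (f s)^-1).
  by field; rewrite -!md_gt0 fs0 f0.
rewrite mdM mdBC mdM !mdV.
apply: (lt_le_trans (y := e * (md (f t) * (md (f t) / 2)) * ((md (f t))^-1 / md (f s)))).
  by rewrite ltr_pM2r// divr_gt0// invr_gt0.
have -> : e * (md (f t) * (md (f t) / 2)) * ((md (f t))^-1 / md (f s))
  = e * ((md (f t) / 2) / md (f s)) by field; rewrite !gt_eqF.
by rewrite ler_piMr ?(ltW e0)// ler_pdivrMr// mul1r ltW.
Qed.

Lemma cont_comp f F t : cont i f t -> cont id F (f t) -> cont i (fun s => F (f s)) t.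
Proof.
move=> cf cF e /cF[d1 /cf[d2 d20 H2] H1]; exists d2 => // s /H2; exact: H1.
Qed.

Lemma contN f t : cont i f t -> cont i (fun s => - f s) t.
Proof.
move=> cf e /cf[d d0 H]; exists d => // s /H; by rewrite -opprD mdN.
Qed.

Lemma contX f n t : cont i f t -> cont i (fun s => f s ^+ n) t.
Proof.
move=> cf; elim: n => [|n IH].
  have -> : (fun s => f s ^+ 0) = (fun=> 1) by apply/funext => s; rewrite expr0.
  exact: cont_cst.
have -> : (fun s => f s ^+ n.+1) = (fun s => f s * f s ^+ n).
  by apply/funext => s; rewrite exprS.
exact: contM.
Qed.

Lemma slope_cont f t d : slope i f t d -> cont i f t.
Proof.
move=> [h [_ ch fE]].
have -> : f = (fun s => f t + h s * (i s + - i t)) by apply/funext => s; exact: fE.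
apply: contD; first exact: cont_cst.
apply: contM => //; apply: contD; [exact: cont_i | exact: cont_cst].
Qed.

Lemma slope_cst c t : slope i (fun=> c) t 0.
Proof.
exists (fun=> 0); split => //; first exact: cont_cst.
by move=> s; rewrite mul0r addr0.
Qed.

Lemma slope_i t : slope i i t 1.
Proof.
exists (fun=> 1); split => //; first exact: cont_cst.
by move=> s; rewrite mul1r; ring.
Qed.

Lemma slopeD f g t a b : slope i f t a -> slope i g t b ->
  slope i (fun s => f s + g s) t (a + b).
Proof.
move=> [h [ht ch hE]] [k [kt ck kE]]; exists (fun s => h s + k s); split.
- by rewrite ht kt.
- exact: contD.
- by move=> s; rewrite hE kE; ring.
Qed.

Lemma slopeM f g t a b : slope i f t a -> slope i g t b ->
  slope i (fun s => f s * g s) t (a * g t + f t * b).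
Proof.
move=> sf sg; case: (sf) (sg) => [h [ht ch hE]] [k [kt ck kE]].
exists (fun s => h s * g s + f t * k s); split.
- by rewrite ht kt.
- apply: contD; apply: contM => //; [exact: slope_cont sg | exact: cont_cst].
- move=> s; have hs : h s * (i s - i t) = f s - f t by rewrite hE; ring.
  have ks : k s * (i s - i t) = g s - g t by rewrite kE; ring.
  have -> : (h s * g s + f t * k s) * (i s - i t) =
    h s * (i s - i t) * g s + f t * (k s * (i s - i t)) by ring.
  by rewrite hs ks; ring.
Qed.

Lemma slopeZ c f t a : slope i f t a -> slope i (fun s => c * f s) t (c * a).
Proof. by move=> /(slopeM (slope_cst c t)); rewrite mul0r add0r. Qed.

Lemma slopeN f t a : slope i f t a -> slope i (fun s => - f s) t (- a).
Proof.
move=> /(slopeZ (-1)); rewrite mulN1r; congr (slope i _ t _).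
by apply/funext => s; rewrite mulN1r.
Qed.

Lemma slopeB f g t a b : slope i f t a -> slope i g t b ->
  slope i (fun s => f s - g s) t (a - b).
Proof. by move=> sf /slopeN; exact: slopeD. Qed.

Lemma slope_comp f F t a b : slope i f t a -> slope id F (f t) b ->
  slope i (fun s => F (f s)) t (b * a).
Proof.
move=> sf; case: (sf) => [h [ht ch hE]] [k [kt ck kE]].
exists (fun s => k (f s) * h s); split.
- by rewrite ht kt.
- by apply: contM => //; apply: cont_comp => //; exact: slope_cont sf.
- move=> s; rewrite kE; have -> : id (f s) - id (f t) = h s * (i s - i t).
    by rewrite /= hE; ring.
  by rewrite mulrA.
Qed.

Lemma slopeX f t a n : slope i f t a ->
  slope i (fun s => f s ^+ n) t (n%:R * f t ^+ n.-1 * a).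
Proof.
move=> sf; elim: n => [|n IH].
  have -> : (fun s => f s ^+ 0) = (fun=> 1) by apply/funext => s; rewrite expr0.
  by rewrite !mul0r; exact: slope_cst.
have -> : (fun s => f s ^+ n.+1) = (fun s => f s * f s ^+ n).
  by apply/funext => s; rewrite exprS.
have -> : n.+1%:R * f t ^+ n.+1.-1 * a = a * f t ^+ n + f t * (n%:R * f t ^+ n.-1 * a).
  by case: n {IH} => [|n] /=; rewrite -?natr1 ?exprS; ring.
exact: slopeM.
Qed.

End Cont.

Lemma slope_restrict (T : Type) (i : T -> R[i]) f t d :
  slope id f (i t) d -> slope i (fun s => f (i s)) t d.
Proof. by move=> /(slope_comp (slope_i i t)); rewrite mulr1. Qed.

Lemma slopeV (T : Type) (i : T -> R[i]) f t a : f t != 0 -> slope i f t a ->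
  slope i (fun s => (f s)^-1) t (- a / f t ^+ 2).
Proof.
move=> f0 sf; case: (sf) => [h [ht ch hE]].
have cV := contV f0 (slope_cont sf).
(* [f] may vanish away from [t], where [h] must be the plain quotient *)
exists (fun s => if f s == 0 then (0 - (f t)^-1) / (i s - i t)
                 else - h s * ((f t)^-1 * (f s)^-1)); split.
- by rewrite (negbTE f0) ht; field.
- move=> e e0.
  have [|d1 d10 H1] := slope_cont sf (e := md (f t)); first by rewrite md_gt0.
  have [|d2 d20 H2] := contM (contN ch) (contM (cont_cst i (f t)^-1 t) cV) (e := e) => //.
  exists (Num.min d1 d2); first by rewrite lt_min d10.
  move=> s; rewrite lt_min => /andP[/H1 h1 /H2 h2].
  rewrite (negbTE f0); case: eqP h1 => [->|_ _ //].
  by rewrite sub0r mdN ltxx.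
- move=> s; case: eqP => [fs0|/eqP fs0].
    rewrite fs0 invr0; case: (eqVneq (i s) (i t)) => [ist|ist].
      by move: fs0; rewrite hE ist subrr mulr0 addr0 => /eqP; rewrite (negbTE f0).
    by rewrite divfK ?subr_eq0//; ring.
  have e : h s * (i s - i t) = f s - f t by rewrite hE; ring.
  have -> : - h s * ((f t)^-1 / f s) * (i s - i t) = - (h s * (i s - i t)) * ((f t)^-1 / f s) by ring.
  by rewrite e; field; rewrite f0 fs0.
Qed.

(* unlike [slope], this form only looks at points near [t] *)
Lemma slopeP (T : Type) (i : T -> R[i]) f t d : injective i -> slope i f t d <->
  forall e : R, 0 < e -> exists2 r : R, 0 < r & forall s, md (i s - i t) < r ->
    md (f s - f t - d * (i s - i t)) <= e * md (i s - i t).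
Proof.
move=> inj; split.
  move=> [h [ht ch hE]] e /ch[r r0 H]; exists r => // s /H /ltW.
  rewrite ht hE => hs.
  have -> : f t + h s * (i s - i t) - f t - d * (i s - i t) = (h s - d) * (i s - i t) by ring.
  by rewrite mdM ler_wpM2r ?md_ge0.
move=> H; exists (fun s => if i s == i t then d else (f s - f t) / (i s - i t)); split.
- by rewrite eqxx.
- move=> e e0; have [|r r0 {}H] := H (e / 2); first lra.
  exists r => // s /H; rewrite eqxx; case: eqP => [_ _|/eqP ist]; first by rewrite subrr md0.
  rewrite -subr_eq0 in ist.
  have -> : f s - f t - d * (i s - i t) = ((f s - f t) / (i s - i t) - d) * (i s - i t).
    by field.
  rewrite mdM ler_pM2r ?md_gt0//; lra.
- move=> s; case: eqP => [/inj ->|/eqP ist]; first by rewrite subrr mulr0 addr0.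
  by rewrite divfK ?subr_eq0//; ring.
Qed.

Lemma slope_local (T : Type) (i : T -> R[i]) f g t a (d : R) : injective i -> 0 < d ->
  (forall s, md (i s - i t) < d -> f s = g s) -> slope i f t a -> slope i g t a.
Proof.
move=> inj d0 fg /(slopeP _ _ _ inj) H; apply/slopeP => // e /H[r r0 {}H].
exists (Num.min d r); first by rewrite lt_min d0.
by move=> s; rewrite lt_min => /andP[h1 /H]; rewrite !fg// subrr md0.
Qed.

Lemma slope_uniq (T : Type) (i : T -> R[i]) f t a b : injective i ->
  (forall r : R, 0 < r -> exists2 s, i s != i t & md (i s - i t) < r) ->
  slope i f t a -> slope i f t b -> a = b.
Proof.
move=> inj acc /(slopeP _ _ _ inj) Ha /(slopeP _ _ _ inj) Hb.
apply/eqP; rewrite -subr_eq0 -md_eq0 eq_le md_ge0 andbT leNgt; apply/negP => ab.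
have [|r1 r10 H1] := Ha (md (a - b) / 4); first lra.
have [|r2 r20 H2] := Hb (md (a - b) / 4); first lra.
have [|s] := acc (Num.min r1 r2); first by rewrite lt_min r10.
rewrite -subr_eq0 -md_gt0 lt_min => s0 /andP[/H1 h1 /H2 h2].
have : md ((a - b) * (i s - i t)) <= md (a - b) / 2 * md (i s - i t).
  have -> : (a - b) * (i s - i t) = (f s - f t - b * (i s - i t)) - (f s - f t - a * (i s - i t)) by ring.
  apply: le_trans (mdB _ _) _; lra.
rewrite mdM ler_pM2r//; lra.
Qed.

Notation cder := (slope id).
Notation rder := (slope (real_complex R)).

Lemma cder_uniq f z a b : cder f z a -> cder f z b -> a = b.
Proof.
apply: slope_uniq => // r r0; exists (z + (r / 2)%:C).
  have -> : (id (z + (r / 2)%:C) != id z) = ((r / 2)%:C != 0 :> R[i]).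
    by rewrite -subr_eq0 /=; congr (_ != _); ring.
  by rewrite -md_eq0 md_real gt_eqF// normr_gt0 gt_eqF// divr_gt0.
have -> : id (z + (r / 2)%:C) - id z = (r / 2)%:C by rewrite /=; ring.
by rewrite md_real gtr0_norm; lra.
Qed.

End Der.

Notation cder := (slope id).
Notation rder := (slope (real_complex _)).

(** * Mean value inequalities *)

Section MeanValue.
Variable R : realType.

Lemma is_derive_slope (f k : R -> R) (x d : R) :
  (forall e : R, 0 < e -> exists2 r : R, 0 < r & forall y, `|y - x| < r -> `|k y - d| < e) ->
  (forall y, f y = f x + k y * (y - x)) -> is_derive x 1 f d.
Proof.
move=> ck fE.
have H : (fun h => h^-1 *: (f (h *: 1 + x) - f x)) @ 0^' --> d.
  apply/cvgrPdist_lt => e e0; have [r r0 {}ck] := ck _ e0.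
  near=> h.
  have h0 : h != 0 by near: h; exact: nbhs_dnbhs_neq.
  rewrite fE [_ + x]addrC.
  have -> : h^-1 *: (f x + k (x + h *: 1) * (x + h *: 1 - x) - f x) = k (x + h).
    by rewrite /GRing.scale /= mulr1; field.
  rewrite distrC; apply: ck; rewrite addrC addKr.
  near: h; apply: dnbhs0_lt; exact: r0.
apply: DeriveDef; first by apply/cvg_ex; exists d.
exact: cvg_lim H.
Unshelve. all: by end_near. Qed.

Lemma rder_Re (G : R -> R[i]) x g c : rder G x g ->
  is_derive x 1 (fun y => complex.Re (c * G y)) (complex.Re (c * g)).
Proof.
move=> [h [ht ch GE]].
apply: (@is_derive_slope _ (fun y => complex.Re (c * h y))).
  move=> e e0; have [r r0 H] := contM (cont_cst (real_complex R) c x) ch e0.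
  exists r => // y; rewrite -(md_real (y - x)) rmorphB => /H.
  rewrite -ht => {}H; apply: le_lt_trans H; apply: le_trans (md_Re _).
  by rewrite le_eqVlt; apply/orP; left; apply/eqP; case: (c * h y) (c * h x) => [? ?] [? ?].
move=> y; rewrite GE -rmorphB; case: c (h y) (G x) => [? ?] [? ?] [? ?] /=; ring.
Qed.

(** The mean value equality fails for complex values. The real theorem is applied to the component
    of [G] along the total increment [v], namely the real part of [v^* G], whose own increment is
    the square of the modulus of [v]. *)
Lemma rmvt (G g : R -> R[i]) (a b M : R) : a <= b ->
  (forall x, a <= x <= b -> rder G x (g x)) ->
  (forall x, a <= x <= b -> md (g x) <= M) ->
  md (G b - G a) <= M * (b - a).
Proof.
move=> ab dG gM; set v := G b - G a.
pose F y := complex.Re (v^*%C * G y).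
have dF x : x \in `]a, b[ -> is_derive x 1 F (complex.Re (v^*%C * g x)).
  by rewrite in_itv /= => /andP[/ltW ax /ltW xb]; apply: rder_Re; apply: dG; rewrite ax.
have dF' x : a <= x <= b -> is_derive x 1 F (complex.Re (v^*%C * g x)).
  by move=> xab; apply: rder_Re; apply: dG.
have [|c cab Fab] := @MVT_segment R F _ a b ab dF.
  apply: derivable_within_continuous => x; rewrite in_itv /= => xab.
  by have [] := dF' x xab.
have vv : F b - F a = md v ^+ 2.
  have -> : F b - F a = complex.Re (v^*%C * v).
    by rewrite /F /v; case: (G b) (G a) => [? ?] [? ?] /=; ring.
  by rewrite -md_sqr.
have : md v ^+ 2 <= md v * (M * (b - a)).
  rewrite -vv Fab mulrA ler_wpM2r ?subr_ge0//.
  apply: le_trans (ler_norm _) _; apply: le_trans (md_Re _) _.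
  rewrite mdM; have -> : md v^*%C = md v by case: (v) => p q; rewrite /md /= sqrrN.
  by rewrite ler_wpM2l ?md_ge0// gM// -in_itv.
case: (eqVneq (md v) 0) => [->|v0].
  by move=> _; apply: mulr_ge0; [apply: le_trans (md_ge0 (g a)) _; apply: gM; rewrite lexx | rewrite subr_ge0].
by rewrite expr2 ler_pM2l// lt_neqAle eq_sym v0 md_ge0.
Qed.

Lemma slope_affine (z v : R[i]) (t : R) : rder (fun s => z + s%:C * v) t v.
Proof.
have := slopeD (slope_cst (real_complex R) z t) (slopeM (slope_i (real_complex R) t) (slope_cst (real_complex R) v t)).
by congr (rder _ t _); ring.
Qed.

Lemma cmvt (f df : R[i] -> R[i]) (z w : R[i]) (M : R) :
  (forall t : R, 0 <= t <= 1 -> cder f (z + t%:C * (w - z)) (df (z + t%:C * (w - z)))) ->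
  (forall t : R, 0 <= t <= 1 -> md (df (z + t%:C * (w - z))) <= M) ->
  md (f w - f z) <= M * md (w - z).
Proof.
move=> dfd dfM.
have := @rmvt (fun t => f (z + t%:C * (w - z))) (fun t => df (z + t%:C * (w - z)) * (w - z)) 0 1 (M * md (w - z)) ler01.
rewrite subr0 mulr1 mul1r mul0r addr0 addrCA subrr addr0; apply.
- by move=> t t01; apply: slope_comp (slope_affine _ _ _) (dfd _ t01).
- by move=> t t01; rewrite mdM ler_wpM2r ?md_ge0 ?dfM.
Qed.

End MeanValue.

(** * Goursat's theorem *)

Section Goursat.
Variable R : realType.

(** The boundary integral of [q(w) dw] over the image of a rectangle, written with primitives:
    [a^~ t] along horizontal sides and [b s] along vertical ones. *)
Definition circ (a b : R -> R -> R[i]) (s s' t t' : R) : R[i] :=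
  (a s' t - a s t) + (b s' t' - b s' t) - (a s' t' - a s t') - (b s t' - b s t).

Variables (q : R[i] -> R[i]) (w ws wt a b : R -> R -> R[i]) (s0 s1 t0 t1 K : R).
Hypotheses (s01 : s0 <= s1) (t01 : t0 <= t1).
Let box s t := s0 <= s <= s1 /\ t0 <= t <= t1.
Hypothesis dws : forall s t, box s t -> rder (w^~ t) s (ws s t).
Hypothesis dwt : forall s t, box s t -> rder (w s) t (wt s t).
Hypothesis wsK : forall s t, box s t -> md (ws s t) <= K.
Hypothesis wtK : forall s t, box s t -> md (wt s t) <= K.
Hypothesis dq : forall s t, box s t -> exists d, cder q (w s t) d.
Hypothesis da : forall s t, box s t -> rder (a^~ t) s (q (w s t) * ws s t).
Hypothesis db : forall s t, box s t -> rder (b s) t (q (w s t) * wt s t).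

Let S := s1 - s0.
Let T := t1 - t0.

Let K0 : 0 <= K.
Proof. by apply: le_trans (md_ge0 _) (wsK (s := s0) (t := t0) _); rewrite /box !lexx. Qed.

Let w_dist s t s' t' : box s t -> box s' t' -> s <= s' -> t <= t' ->
  md (w s' t - w s t) <= K * (s' - s) /\ md (w s t' - w s t) <= K * (t' - t).
Proof.
move=> [/andP[? ?] /andP[? ?]] [/andP[? ?] /andP[? ?]] ss tt; split.
  apply: (rmvt (G := w^~ t) (g := ws^~ t)) => // x /andP[? ?];
    [apply: dws | apply: wsK]; rewrite /box; lra.
apply: (rmvt (G := w s) (g := wt s)) => // x /andP[? ?];
  [apply: dwt | apply: wtK]; rewrite /box; lra.
Qed.

Let w_lip s t s' t' : box s t -> box s' t' ->
  md (w s t - w s' t') <= K * (`|s - s'| + `|t - t'|).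
Proof.
move=> b1 b2.
have -> : w s t - w s' t' = (w s t - w s' t) + (w s' t - w s' t') by ring.
apply: le_trans (mdD _ _) _; rewrite mulrDr.
have b3 : box s' t by case: b1 b2 => [? ?] [? ?].
apply: lerD.
  case: (lerP s s') => ss; last by apply: (proj1 (w_dist b3 b1 (ltW ss) (lexx t))).
  rewrite mdBC; exact: (proj1 (w_dist b1 b3 ss (lexx t))).
case: (lerP t t') => tt; last by apply: (proj2 (w_dist b2 b3 (lexx s') (ltW tt))).
rewrite mdBC; exact: (proj2 (w_dist b3 b2 (lexx s') tt)).
Qed.

(* the affine part of [q] at [(ss, tt)] has the primitive [F], which
   contributes nothing around a closed rectangle *)
Let local_bound ss tt (e : R) : box ss tt -> 0 < e ->
  exists2 r : R, 0 < r & forall s s' t t', box s t -> box s' t' ->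
    s <= ss <= s' -> t <= tt <= t' -> K * ((s' - s) + (t' - t)) < r ->
    md (circ a b s s' t t') <= 2 * e * K ^+ 2 * ((s' - s) + (t' - t)) ^+ 2.
Proof.
move=> bst e0; have [d /(slopeP _ _ _ (@inj_id R[i])) /(_ e e0) [r r0 H]] := dq bst.
exists r => // s s' t t' [/andP[h1 h2] /andP[h3 h4]] [/andP[h5 h6] /andP[h7 h8]] /andP[h9 h10] /andP[h11 h12] small.
set w0 := w ss tt.
pose F x := q w0 * (x - w0) + d / 2 * (x - w0) ^+ 2.
have dF x : cder F x (q w0 + d * (x - w0)).
  have H1 : cder (fun x => x - w0) x 1.
    by have := slopeB (slope_i id x) (slope_cst id w0 x); rewrite subr0.
  have -> : q w0 + d * (x - w0) = q w0 * 1 + d / 2 * (2%:R * (x - w0) ^+ 2.-1 * 1).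
    by rewrite /= expr1; field.
  exact: slopeD (slopeZ (q w0) H1) (slopeZ (d / 2) (slopeX 2 H1)).
have -> : circ a b s s' t t' =
    circ (fun x y => a x y - F (w x y)) (fun x y => b x y - F (w x y)) s s' t t'.
  by rewrite /circ; ring.
set D := (s' - s) + (t' - t).
have wd x y : s <= x <= s' -> t <= y <= t' -> md (w x y - w0) <= K * D.
  move=> /andP[? ?] /andP[? ?]; apply: le_trans (w_lip _ bst) _; first by rewrite /box; lra.
  rewrite ler_wpM2l// /D; apply: lerD; rewrite ler_norml; lra.
have qd x y : s <= x <= s' -> t <= y <= t' ->
    md (q (w x y) - (q w0 + d * (w x y - w0))) <= e * (K * D).
  move=> xs yt; rewrite opprD addrA; have wx := wd _ _ xs yt.
  apply: le_trans (H (w x y) _) _; first exact: le_lt_trans wx small.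
  by rewrite ler_wpM2l// ltW.
have sD : s' - s <= D by rewrite /D; lra.
have tD : t' - t <= D by rewrite /D; lra.
have D0 : 0 <= D by rewrite /D; lra.
have eKD0 : 0 <= e * (K * D) * K by rewrite !mulr_ge0// ltW.
have Ha y : t <= y <= t' ->
    md (a s' y - F (w s' y) - (a s y - F (w s y))) <= e * (K * D) * K * (s' - s).
  move=> yt.
  apply: (rmvt (G := fun x => a x y - F (w x y))
    (g := fun x => (q (w x y) - (q w0 + d * (w x y - w0))) * ws x y)).
  - lra.
  - move=> x xs; have bxy : box x y by rewrite /box; lra.
    rewrite mulrBl; apply: slopeB; first exact: da.
    exact: slope_comp (dws bxy) (dF _).
  - move=> x xs; rewrite mdM; apply: ler_pM; rewrite ?md_ge0//; first exact: qd.
    by apply: wsK; rewrite /box; lra.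
have Hb x : s <= x <= s' ->
    md (b x t' - F (w x t') - (b x t - F (w x t))) <= e * (K * D) * K * (t' - t).
  move=> xs.
  apply: (rmvt (G := fun y => b x y - F (w x y))
    (g := fun y => (q (w x y) - (q w0 + d * (w x y - w0))) * wt x y)).
  - lra.
  - move=> y yt; have bxy : box x y by rewrite /box; lra.
    rewrite mulrBl; apply: slopeB; first exact: db.
    exact: slope_comp (dwt bxy) (dF _).
  - move=> y yt; rewrite mdM; apply: ler_pM; rewrite ?md_ge0//; first exact: qd.
    by apply: wtK; rewrite /box; lra.
rewrite /circ; apply: le_trans (mdB _ _) _.
have {}Ha1 := Ha t; have {}Ha2 := Ha t'; have {}Hb1 := Hb s; have {}Hb2 := Hb s'.
have I1 : t <= t <= t' by lra.
have I2 : t <= t' <= t' by lra.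
have I3 : s <= s <= s' by lra.
have I4 : s <= s' <= s' by lra.
move: (Ha1 I1) (Ha2 I2) (Hb1 I3) (Hb2 I4) => A1 A2 B1 B2.
apply: (le_trans (lerD (le_trans (mdB _ _) (lerD (mdD _ _) (lexx _))) (lexx _))).
have -> : 2 * e * K ^+ 2 * D ^+ 2 = 2 * (e * (K * D) * K * D) by ring.
have DE : e * (K * D) * K * D = e * (K * D) * K * (s' - s) + e * (K * D) * K * (t' - t).
  by rewrite -mulrDr.
lra.
Qed.

Let half (s t : R) (n : nat) := circ a b s (s + S / 2 ^+ n) t (t + T / 2 ^+ n).

Let half_split s t n : half s t n =
  (half s t n.+1 + half (s + S / 2 ^+ n.+1) t n.+1) +
  (half s (t + T / 2 ^+ n.+1) n.+1 + half (s + S / 2 ^+ n.+1) (t + T / 2 ^+ n.+1) n.+1).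
Proof.
rewrite /half /circ.
have e (U : R) : U / 2 ^+ n = U / 2 ^+ n.+1 + U / 2 ^+ n.+1.
  by rewrite exprS; field; rewrite expf_neq0// pnatr_eq0.
rewrite !(e S) !(e T) !addrA; ring.
Qed.

(** Bisection: if the integral has modulus [eta > 0], some nested rectangles of the [n]-th
    generation keep at least [eta / 4 ^+ n]. At their common point [local_bound] gives an
    arbitrarily small multiple of [1 / 4 ^+ n]. *)
Lemma goursat : circ a b s0 s1 t0 t1 = 0.
Proof.
apply/eqP; rewrite -md_eq0 eq_le md_ge0 andbT leNgt; apply/negP; set eta := md _ => eta0.
have S0 : 0 <= S by rewrite subr_ge0.
have T0 : 0 <= T by rewrite subr_ge0.
have p0 n : 0 < 2 ^+ n :> R by rewrite exprn_gt0.
pose good n (st : R * R) := [/\ s0 <= st.1, st.1 + S / 2 ^+ n <= s1,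
  t0 <= st.2, st.2 + T / 2 ^+ n <= t1 & eta / 4 ^+ n <= md (half st.1 st.2 n)].
have good0 : good 0 (s0, t0).
  rewrite /good /= /half !expr0 !divr1 /S /T !(addrC _ (_ - _)) !subrK.
  by split.
(* The hypothesis [good n st] stands under the existential so that [next] is total and the sequence
   is defined by plain recursion. *)
have step n st : exists st', good n st -> [/\ good n.+1 st',
    st.1 <= st'.1, st'.1 + S / 2 ^+ n.+1 <= st.1 + S / 2 ^+ n,
    st.2 <= st'.2 & st'.2 + T / 2 ^+ n.+1 <= st.2 + T / 2 ^+ n].
  have [|/asboolP ng] := boolP `[< good n st >]; last by exists st.
  move=> /asboolP; case: st => s t [/= g1 g2 g3 g4 g5].
  have eS : S / 2 ^+ n = S / 2 ^+ n.+1 + S / 2 ^+ n.+1.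
    by rewrite exprS; field; rewrite expf_neq0// pnatr_eq0.
  have eT : T / 2 ^+ n = T / 2 ^+ n.+1 + T / 2 ^+ n.+1.
    by rewrite exprS; field; rewrite expf_neq0// pnatr_eq0.
  have pS : 0 <= S / 2 ^+ n.+1 by rewrite divr_ge0// ltW.
  have pT : 0 <= T / 2 ^+ n.+1 by rewrite divr_ge0// ltW.
  have e4 : eta / 4 ^+ n = 4 * (eta / 4 ^+ n.+1).
    by rewrite exprS; field; rewrite expf_neq0// pnatr_eq0.
  rewrite half_split in g5; rewrite eS in g2; rewrite eT in g4.
  have [h1|h1] := leP (eta / 4 ^+ n.+1) (md (half s t n.+1)).
    by exists (s, t) => _; rewrite /good /= eS eT; split; [split|..]; lra.
  have [h2|h2] := leP (eta / 4 ^+ n.+1) (md (half (s + S / 2 ^+ n.+1) t n.+1)).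
    by exists (s + S / 2 ^+ n.+1, t) => _; rewrite /good /= eS eT; split; [split|..]; lra.
  have [h3|h3] := leP (eta / 4 ^+ n.+1) (md (half s (t + T / 2 ^+ n.+1) n.+1)).
    by exists (s, t + T / 2 ^+ n.+1) => _; rewrite /good /= eS eT; split; [split|..]; lra.
  have [h4|h4] := leP (eta / 4 ^+ n.+1) (md (half (s + S / 2 ^+ n.+1) (t + T / 2 ^+ n.+1) n.+1)).
    by exists (s + S / 2 ^+ n.+1, t + T / 2 ^+ n.+1) => _; rewrite /good /= eS eT; split; [split|..]; lra.
  exfalso; move: g5; apply/negP; rewrite -ltNge e4.
  apply: le_lt_trans (mdD _ _) _; apply: le_lt_trans (lerD (mdD _ _) (mdD _ _)) _; lra.
pose next n st := sval (cid (step n st)).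
pose u := fix u n := if n is m.+1 then next m (u m) else (s0, t0).
have ug n : good n (u n).
  elim: n => [|n IH] //=; rewrite /next; case: cid => st' /= /(_ IH) [] //.
have us n : [/\ (u n).1 <= (u n.+1).1, (u n.+1).1 + S / 2 ^+ n.+1 <= (u n).1 + S / 2 ^+ n,
    (u n).2 <= (u n.+1).2 & (u n.+1).2 + T / 2 ^+ n.+1 <= (u n).2 + T / 2 ^+ n].
  rewrite /= /next; case: cid => st' /= /(_ (ug n)) [] //.
have uD n k : [/\ (u n).1 <= (u (n + k)%N).1, (u (n + k)%N).1 + S / 2 ^+ (n + k) <= (u n).1 + S / 2 ^+ n,
    (u n).2 <= (u (n + k)%N).2 & (u (n + k)%N).2 + T / 2 ^+ (n + k) <= (u n).2 + T / 2 ^+ n].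
  elim: k => [|k [i1 i2 i3 i4]]; first by rewrite addn0.
  by rewrite addnS; have [j1 j2 j3 j4] := us (n + k)%N; split; lra.
have lim1 : exists ss, forall n, (u n).1 <= ss <= (u n).1 + S / 2 ^+ n.
  exists (sup (range (fun n => (u n).1))) => n.
  have ub m : (u m).1 <= (u n).1 + S / 2 ^+ n.
    have pS k : 0 <= S / 2 ^+ k by rewrite divr_ge0// ltW.
    case: (leqP n m) => nm.
      by have [_ h _ _] := uD n (m - n)%N; rewrite subnKC// in h; have := pS m; lra.
    have [h _ _ _] := uD m (n - m)%N; rewrite subnKC 1?ltnW// in h; have := pS n; lra.
  apply/andP; split.
    by apply: ub_le_sup; [exists ((u n).1 + S / 2 ^+ n) => _ [m _ <-]; exact: ub | exists n].
  by apply: ge_sup; [exists (u 0%N).1; exists 0%N | move=> _ [m _ <-]; exact: ub].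
have lim2 : exists tt, forall n, (u n).2 <= tt <= (u n).2 + T / 2 ^+ n.
  exists (sup (range (fun n => (u n).2))) => n.
  have ub m : (u m).2 <= (u n).2 + T / 2 ^+ n.
    have pT k : 0 <= T / 2 ^+ k by rewrite divr_ge0// ltW.
    case: (leqP n m) => nm.
      by have [_ _ _ h] := uD n (m - n)%N; rewrite subnKC// in h; have := pT m; lra.
    have [_ _ h _] := uD m (n - m)%N; rewrite subnKC 1?ltnW// in h; have := pT n; lra.
  apply/andP; split.
    by apply: ub_le_sup; [exists ((u n).2 + T / 2 ^+ n) => _ [m _ <-]; exact: ub | exists n].
  by apply: ge_sup; [exists (u 0%N).2; exists 0%N | move=> _ [m _ <-]; exact: ub].
have [ss hs] := lim1; have [tt ht] := lim2.
have bst : box ss tt.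
  have := hs 0%N; have := ht 0%N; rewrite /= !expr0 !divr1 /S /T !(addrC _ (_ - _)) !subrK.
  by rewrite /box.
(* With the tolerance [eta / (L + 1) / 2] the local bound is less than [eta / 4 ^+ n]; the [+ 1]
   keeps the denominator positive when [L] is 0. *)
set L := 2 * K ^+ 2 * (S + T) ^+ 2.
have L0 : 0 <= L by rewrite /L !mulr_ge0// ?exprn_ge0// addr_ge0.
have [|r r0 loc] := @local_bound ss tt (eta / (L + 1) / 2) bst.
  by rewrite !divr_gt0//; lra.
have [n hn] : exists n, K * (S + T) / 2 ^+ n < r.
  have KST : 0 <= K * (S + T) by rewrite mulr_ge0// addr_ge0.
  exists (Num.truncn (K * (S + T) / r)).+1.
  rewrite ltr_pdivrMr// [r * _]mulrC -ltr_pdivrMr//.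
  apply: lt_le_trans (truncnS_gt _) _.
  by rewrite -natrX ler_nat ltnW// ltn_expl.
have [g1 g2 g3 g4 g5] := ug n.
have pS : 0 <= S / 2 ^+ n by rewrite divr_ge0// ltW.
have pT : 0 <= T / 2 ^+ n by rewrite divr_ge0// ltW.
have := loc (u n).1 ((u n).1 + S / 2 ^+ n) (u n).2 ((u n).2 + T / 2 ^+ n) _ _ (hs n) (ht n).
have e1 (x y : R) : x + y - x = y by ring.
rewrite !e1 -mulrDl mulrA => /(_ _ _ hn); rewrite /box.
have b1 : box (u n).1 (u n).2 by rewrite /box; lra.
have b2 : box ((u n).1 + S / 2 ^+ n) ((u n).2 + T / 2 ^+ n) by rewrite /box; lra.
move=> /(_ b1 b2) /(le_trans g5).
have -> : 2 * (eta / (L + 1) / 2) * K ^+ 2 * ((S + T) / 2 ^+ n) ^+ 2 =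
   eta * (L / (L + 1) / 2) / 4 ^+ n.
  have -> : 4 ^+ n = 2 ^+ n ^+ 2 :> R by rewrite -exprM mulnC exprM; congr (_ ^+ _); ring.
  by rewrite /L; field; rewrite expf_neq0 ?pnatr_eq0//= -/L gt_eqF//; lra.
rewrite ler_pM2r ?invr_gt0 ?exprn_gt0// => h.
have : L / (L + 1) <= 1 by rewrite ler_pdivrMr; lra.
nra.
Qed.

End Goursat.

(** * The complex exponential *)

Section Cexp.
Variable R : realType.
Implicit Types (z w : R[i]) (x y : R).

Lemma cexpD z w : cexp (z + w) = cexp z * cexp w.
Proof.
case: z w => [a b] [c d]; rewrite /cexp /= expRD cosD sinD.
by apply/eqP; rewrite eq_complex /=; apply/andP; split; apply/eqP; ring.
Qed.

Lemma cexp0 : cexp 0 = 1 :> R[i].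
Proof. by rewrite /cexp /= expR0 cos0 sin0 mulr1. Qed.

Lemma cexp_neq0 z : cexp z != 0.
Proof.
apply/eqP => e; have := cexpD z (- z); rewrite subrr cexp0 e mul0r => /eqP.
by rewrite oner_eq0.
Qed.

Lemma cexpN z : cexp (- z) = (cexp z)^-1.
Proof.
apply: (mulfI (cexp_neq0 z)); by rewrite -cexpD subrr cexp0 divff// cexp_neq0.
Qed.

Lemma cexpB z w : cexp (z - w) = cexp z / cexp w.
Proof. by rewrite cexpD cexpN. Qed.

Lemma cexpMn z n : cexp (n%:R * z) = cexp z ^+ n.
Proof.
elim: n => [|n IH]; first by rewrite mul0r cexp0 expr0.
by rewrite -natr1 mulrDl mul1r cexpD IH exprSr.
Qed.

Lemma md_cexp z : md (cexp z) = expR (complex.Re z).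
Proof.
rewrite /cexp mdM md_real gtr0_norm ?expR_gt0//.
by rewrite {1}/md /= cos2Dsin2 sqrtr1 mulr1.
Qed.

Lemma is_derive_eps (f : R -> R) x (d e : R) : is_derive x 1 f d -> 0 < e ->
  exists2 r : R, 0 < r & forall h, `|h| < r -> `|f (x + h) - f x - d * h| <= e * `|h|.
Proof.
move=> [df fd] e0; move: (df) => /cvg_ex [l fl].
have dl : d = l by rewrite -fd; exact: cvg_lim fl.
move/cvgrPdist_lt : fl => /(_ e e0).
move=> /nbhs_ballP[r /= r0 H]; exists r => // h hr.
have [->|h0] := eqVneq h 0; first by rewrite addr0 subrr mulr0 subrr normr0 mulr0.
have := H h; rewrite /ball /= sub0r normrN => /(_ hr h0).
rewrite -dl /GRing.scale /= mulr1 [h + x]addrC => /ltW.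
have -> : f (x + h) - f x - d * h = - (d - h^-1 * (f (x + h) - f x)) * h by field.
by rewrite normrM normrN => H1; rewrite ler_wpM2r.
Qed.

Lemma slope_cexp0 : cder (@cexp R) 0 1.
Proof.
(* The error terms below add up to [7 * (e1 * m)], which a tenth of [e] absorbs; [e1 <= 1 / 10] also
   bounds the real exponential by 2. *)
apply/slopeP => //= e e0; set e1 := Num.min 1 e / 10.
have e10 : 0 < e1 by rewrite divr_gt0// lt_min ltr01.
have e1e : e1 <= e / 10 by rewrite ler_pM2r// ge_min lexx orbT.
have e11 : e1 <= 1 / 10 by rewrite ler_pM2r// ge_min lexx.
have [r1 r10 H1] := is_derive_eps (is_derive_expR 0) e10.
have [r2 r20 H2] := is_derive_eps (is_derive_sin 0) e10.
have [r3 r30 H3] := is_derive_eps (is_derive_cos 0) e10.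
exists (Num.min (Num.min r1 r2) (Num.min r3 e1)).
  by rewrite !lt_min r10 r20 r30.
move=> z; rewrite cexp0 subr0 mul1r !lt_min => /andP[/andP[h1 h2] /andP[h3 h4]].
case: z h1 h2 h3 h4 => x y; set m := md _ => h1 h2 h3 h4.
have xm : `|x| <= m := md_Re (x +i* y).
have ym : `|y| <= m := md_Im (x +i* y).
have m0 : 0 <= m := md_ge0 _.
clearbody m e1.
have He := H1 x (le_lt_trans xm h1); have Hs := H2 y (le_lt_trans ym h2).
have H := H3 y (le_lt_trans ym h3).
apply: le_trans (md_le _) _.
have -> : complex.Re (cexp (x +i* y) - 1 - (x +i* y)) =
   expR x * (cos y - 1) + (expR x - 1 - x) by rewrite /cexp /=; ring.
have -> : complex.Im (cexp (x +i* y) - 1 - (x +i* y)) =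
   expR x * (sin y - y) + (expR x - 1) * y by rewrite /cexp /=; ring.
move: H Hs He; rewrite !add0r expR0 sin0 cos0 oppr0 !mul0r !mul1r !subr0 !addr0.
move: (expR x) (sin y) (cos y) => E s c H Hs He.
have xe : e1 * `|x| <= e1 * m by rewrite ler_pM2l.
have ye : e1 * `|y| <= e1 * m by rewrite ler_pM2l.
have e1m : e1 * m <= m by rewrite ler_piMl//; lra.
have Em : `|E - 1| <= 2 * m.
  have -> : E - 1 = (E - 1 - x) + x by ring.
  apply: le_trans (ler_normD _ _) _; lra.
have E2 : `|E| <= 2.
  have -> : E = (E - 1) + 1 by ring.
  apply: le_trans (ler_normD _ _) _; rewrite normr1; lra.
have A1 : `|E * (c - 1)| <= 2 * (e1 * m).
  by rewrite normrM; apply: ler_pM => //; lra.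
have A2 : `|E * (s - y)| <= 2 * (e1 * m).
  by rewrite normrM; apply: ler_pM => //; lra.
have A3 : `|(E - 1) * y| <= 2 * m * m by rewrite normrM; apply: ler_pM.
have A4 : 2 * m * m <= 2 * (e1 * m) by rewrite -mulrA ler_pM2l// ler_wpM2r// ltW.
apply: le_trans (lerD (ler_normD _ _) (ler_normD _ _)) _.
have : 0 <= e * m by rewrite mulr_ge0// ltW.
have : e1 * m <= e / 10 * m by rewrite ler_wpM2r.
lra.
Qed.

Lemma slope_cexp z : cder (@cexp R) z (cexp z).
Proof.
have H : cder (fun w => w - z) z 1.
  by have := slopeB (slope_i id z) (slope_cst id z z); rewrite subr0.
have := slope_cexp0; rewrite -(subrr z) => H0.
have := slopeZ (cexp z) (slope_comp H H0); rewrite !mulr1.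
have -> // : (fun s => cexp z * cexp (s - z)) = @cexp R.
by apply/funext => s; rewrite -cexpD addrC subrK.
Qed.

Definition tpi : R[i] := 0 +i* (pi *+ 2).

Lemma tpi_neq0 : tpi != 0.
Proof.
rewrite eq_complex /= negb_and orbC; apply/orP; left.
by rewrite mulrn_eq0 /= gt_eqF// pi_gt0.
Qed.

Lemma cexp_tpi : cexp tpi = 1.
Proof. by rewrite /cexp /= expR0 cos2pi sin2pi mul1r. Qed.

Lemma cexp_int (k : int) : cexp (k%:~R * tpi) = 1.
Proof.
case: k => n; first by rewrite -pmulrn cexpMn cexp_tpi expr1n.
by rewrite NegzE mulrNz mulNr cexpN -pmulrn cexpMn cexp_tpi expr1n invr1.
Qed.

Lemma cexp_eq1 z : cexp z = 1 -> exists k : int, z = k%:~R * tpi.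
Proof.
move=> ez; have := congr1 (@md R) ez; rewrite md_cexp md1 -expR0.
move=> /expR_inj x0; pose k := Num.floor (complex.Im z / (pi *+ 2)).
have p0 : 0 < (pi *+ 2 : R) by rewrite mulrn_wgt0 // pi_gt0.
exists k; set w := k%:~R * tpi.
have wE : w = 0 +i* (k%:~R * (pi *+ 2)).
  rewrite /w -(rmorph_int (real_complex R)); apply/eqP; rewrite eq_complex /=.
  by apply/andP; split; apply/eqP; ring.
have : cexp (z - w) = 1 by rewrite cexpB ez cexp_int divr1.
have : 0 <= complex.Im (z - w) < pi *+ 2.
  have /andP[] := mem_rg1_floor (complex.Im z / (pi *+ 2)); rewrite -/k.
  rewrite wE; case: (z) => a b /=; rewrite ler_pdivlMr// ltr_pdivrMr//; lra.
have : complex.Re (z - w) = 0 by rewrite wE; case: (z) x0 => a b /= ->; rewrite subr0.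
case: (z - w) (subrK w z) => a b; rewrite /= => <- ->.
rewrite /cexp /= expR0 mul1r => /andP[b0 b2] /eqP; rewrite eq_complex /= => /andP[/eqP c1 /eqP s0].
suff -> : b = 0 by rewrite -[0 +i* 0]/(0 : R[i]) add0r.
have pi0 := pi_gt0 R.
(* [cos] is injective on [[0, pi]] only; the other half of the period is reflected onto it. *)
case: (leP b pi) => bp.
  by apply: (@cos_inj R); rewrite ?in_itv /= ?cos0 ?b0 ?lexx ?(ltW pi0).
have : pi *+ 2 - b = 0.
  apply: (@cos_inj R); rewrite ?in_itv /= ?lexx ?(ltW pi0)//; first lra.
  by rewrite cos0 -cosN opprB -(cosD2pi (b - _)) subrK.
lra.
Qed.

Lemma cexp_surj z : z != 0 -> exists w, cexp w = z.
Proof.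
move=> z0; have m0 : 0 < md z by rewrite md_gt0.
set m := md z in m0 *.
have : (complex.Re z / m) ^+ 2 + (complex.Im z / m) ^+ 2 = 1.
  have : m ^+ 2 = complex.Re z ^+ 2 + complex.Im z ^+ 2.
    by rewrite /m; case: (z) => a b /=; rewrite /md /= sqr_sqrtr// addr_ge0 ?sqr_ge0.
  by rewrite !expr_div_n -mulrDl => <-; rewrite divff// expf_neq0// gt_eqF.
set a := _ / m; set b := _ / m => ab.
have zE : z = m%:C * (a +i* b).
  apply/eqP; rewrite eq_complex /= !mul0r subr0 addr0 /a /b.
  by apply/andP; split; apply/eqP; field; rewrite gt_eqF.
have a1 : -1 <= a <= 1.
  have b2 := sqr_ge0 b; apply/andP; split; nra.
have sb : sin (acos a) = `|b|.
  by rewrite sin_acos// -ab [_ + b ^+ 2]addrC addrK sqrtr_sqr.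
pose t := if 0 <= b then acos a else - acos a.
exists (ln m +i* t); rewrite /cexp /= lnK ?posrE// [RHS]zE; congr (_ * _).
rewrite /t; case: (lerP 0 b) sb => b0 sb.
  by rewrite sb ger0_norm// acosK// in_itv /= a1.
by rewrite sinN cosN sb ltr0_norm// opprK acosK// in_itv /= a1.
Qed.

End Cexp.

(** * Cauchy's formula *)

Section Antiderivative.
Variable R : realType.
Implicit Types (g : R -> R[i]) (a b : R).

Lemma real_antider (f : R -> R) a b :
  (forall x, {for x, continuous f}) -> a <= b ->
  exists F : R -> R, forall x, a <= x <= b -> is_derive x 1 F (f x).
Proof.
move=> cf ab.
(* Starting at [a - 1] and allowing room up to [b + 1] makes both ends of [[a, b]] interior
   points. *)
exists (fun x => (\int[lebesgue_measure]_(t in [set` `[a - 1, x]]) f t)%R) => x /andP[ax xb].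
have [||||dF F'] := @continuous_FTC1_closed R f (a - 1) x (b + 1).
- lra.
- apply: continuous_compact_integrable; first exact: segment_compact.
  by apply: continuous_subspaceT => y; exact: cf.
- lra.
- exact: cf.
apply: DeriveDef; first exact: dF.
by rewrite -derive1E.
Qed.

Lemma cont_continuous (T : R[i] -> R) g x : (forall z w, `|T z - T w| <= md (z - w)) ->
  cont (real_complex R) g x -> {for x, continuous (fun y => T (g y))}.
Proof.
move=> Tl cg; apply/cvgrPdist_lt => e /cg[d d0 H]; near=> y.
rewrite distrC; apply: le_lt_trans (Tl _ _) _; apply: H.
rewrite -rmorphB md_real distrC.
near: y; apply/nbhs_ballP; exists d => // z; rewrite /ball /=.
Unshelve. all: by end_near. Qed.

(** Composition with this retraction extends a function continuous on [[a, b]] to a continuous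
    function on the line, as the fundamental theorem and the extreme value theorem are applied to
    global functions. *)
Definition clamp a b x := Num.max a (Num.min b x).

Lemma clamp_in a b x : a <= b -> a <= clamp a b x <= b.
Proof.
by move=> ab; rewrite /clamp le_max lexx /= ge_max ab ge_min lexx.
Qed.

Lemma clamp_id a b x : a <= x <= b -> clamp a b x = x.
Proof.
by move=> /andP[ax xb]; rewrite /clamp min_r// max_r.
Qed.

Lemma clamp_lip a b x y : `|clamp a b x - clamp a b y| <= `|x - y|.
Proof.
have mx (c u v : R) : `|Num.max c u - Num.max c v| <= `|u - v|.
  have := ler_norm (u - v); have := ler_norm (v - u); rewrite (distrC v u) => h1 h2.
  by rewrite ler_norml; case: (leP c u) => ?; case: (leP c v) => ?; apply/andP; split; lra.
have mn (c u v : R) : `|Num.min c u - Num.min c v| <= `|u - v|.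
  have := ler_norm (u - v); have := ler_norm (v - u); rewrite (distrC v u) => h1 h2.
  by rewrite ler_norml; case: (leP c u) => ?; case: (leP c v) => ?; apply/andP; split; lra.
exact: le_trans (mx _ _ _) (mn _ _ _).
Qed.

Lemma antider g a b : a <= b ->
  (forall x, a <= x <= b -> cont (real_complex R) g x) ->
  exists G, forall x, a <= x <= b -> rder G x (g x).
Proof.
move=> ab cg; pose h x := g (clamp a b x).
have ch x : cont (real_complex R) h x.
  move=> e /(cg _ (clamp_in x ab))[d d0 H]; exists d => // y hy; apply: H.
  apply: le_lt_trans hy; rewrite -!rmorphB !md_real; exact: clamp_lip.
have [|F1 H1] := @real_antider (fun x => complex.Re (h x)) a b _ ab.
  move=> x; apply: cont_continuous (ch x) => z w; apply: le_trans (md_Re _).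
  by case: z w => [? ?] [? ?].
have [|F2 H2] := @real_antider (fun x => complex.Im (h x)) a b _ ab.
  move=> x; apply: cont_continuous (ch x) => z w; apply: le_trans (md_Im _).
  by case: z w => [? ?] [? ?].
exists (fun x => F1 x +i* F2 x) => x xab; apply/slopeP; first exact: complexI.
move=> e e0; have e2 : 0 < e / 2 by lra.
have [r1 r10 K1] := is_derive_eps (H1 x xab) e2.
have [r2 r20 K2] := is_derive_eps (H2 x xab) e2.
exists (Num.min r1 r2); first by rewrite lt_min r10.
move=> y; rewrite -rmorphB md_real lt_min => /andP[/K1 k1 /K2 k2].
apply: le_trans (md_le _) _.
move: k1 k2; rewrite /h clamp_id// [x + _]addrC subrK => k1 k2.
rewrite [leRHS](_ : _ = e / 2 * `|y - x| + e / 2 * `|y - x|); last by field.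
apply: lerD.
  apply: le_trans k1; case: (g x) => p q /=.
  by rewrite mulr0 subr0.
apply: le_trans k2; case: (g x) => p q /=.
by rewrite mulr0 add0r.
Qed.

Lemma rcont_bnd g a b : a <= b -> (forall x, a <= x <= b -> cont (real_complex R) g x) ->
  exists M, forall x, a <= x <= b -> md (g x) <= M.
Proof.
move=> ab cg; pose h x := g (clamp a b x).
have ch x : cont (real_complex R) h x.
  move=> e /(cg _ (clamp_in x ab))[d d0 H]; exists d => // y hy; apply: H.
  apply: le_lt_trans hy; rewrite -!rmorphB !md_real; exact: clamp_lip.
have [|c _ H] := @EVT_max R (fun x => md (h x)) a b ab.
  apply: continuous_subspaceT => x; apply: cont_continuous (ch x) => z w.
  by rewrite ler_norml; have := mdBD z w; have := mdBD w z; rewrite mdBC; lra.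
exists (md (h c)) => x xab; have := H x; rewrite in_itv /= => /(_ xab).
by rewrite {1}/h clamp_id.
Qed.

(** The integral is a relation carried by an antiderivative, so that linearity follows from the
    rules for [slope], and bounds and uniqueness from the mean value inequality. *)
Definition is_int g a b (I : R[i]) :=
  exists2 G, (forall x, a <= x <= b -> rder G x (g x)) & I = G b - G a.

Lemma is_int_ex g a b : a <= b -> (forall x, a <= x <= b -> cont (real_complex R) g x) ->
  exists I, is_int g a b I.
Proof. by move=> ab cg; have [G HG] := antider ab cg; exists (G b - G a); exists G. Qed.

Lemma is_int_bound g a b I M : a <= b -> is_int g a b I ->
  (forall x, a <= x <= b -> md (g x) <= M) -> md I <= M * (b - a).
Proof. by move=> ab [G dG ->] gM; exact: rmvt dG gM. Qed.

Lemma is_intD g h a b I J : is_int g a b I -> is_int h a b J ->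
  is_int (fun x => g x + h x) a b (I + J).
Proof.
move=> [G dG ->] [H dH ->]; exists (fun x => G x + H x); last by ring.
by move=> x xab; apply: slopeD; [exact: dG | exact: dH].
Qed.

Lemma is_intZ c g a b I : is_int g a b I -> is_int (fun x => c * g x) a b (c * I).
Proof.
move=> [G dG ->]; exists (fun x => c * G x); last by ring.
by move=> x xab; apply: slopeZ; exact: dG.
Qed.

Lemma is_int_ext g h a b I : (forall x, a <= x <= b -> g x = h x) ->
  is_int g a b I -> is_int h a b I.
Proof. by move=> gh [G dG ->]; exists G => // x xab; rewrite -gh//; exact: dG. Qed.

Lemma is_int_uniq g a b I J : a <= b -> is_int g a b I -> is_int g a b J -> I = J.
Proof.
move=> ab HI HJ; have := is_intD HI (is_intZ (-1) HJ); rewrite mulN1r => HD.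
have : md (I - J) <= 0 * (b - a).
  by apply: (is_int_bound ab HD) => x _; rewrite mulN1r subrr md0.
by rewrite mul0r => h; apply/eqP; rewrite -subr_eq0 -md_eq0 eq_le h md_ge0.
Qed.

End Antiderivative.

(** * Integrals over circles and Cauchy's formula *)

Section Circle.
Variable R : realType.
Implicit Types (z w c : R[i]) (r t : R).

Definition iu : R[i] := 0 +i* 1.
Definition pi2 : R := pi *+ 2.

Lemma pi2_gt0 : 0 < pi2.
Proof. by rewrite mulrn_wgt0 // pi_gt0. Qed.

Lemma md_iu : md iu = 1.
Proof. by rewrite /md /= expr0n expr1n add0r sqrtr1. Qed.

Lemma iu_pi2 : iu * pi2%:C = tpi R.
Proof. by apply/eqP; rewrite eq_complex /=; apply/andP; split; apply/eqP; rewrite /pi2; ring. Qed.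

Definition ecirc r t : R[i] := r%:C * cexp (iu * t%:C).

Lemma md_ecirc r t : 0 < r -> md (ecirc r t) = r.
Proof.
move=> r0; rewrite /ecirc mdM md_real gtr0_norm// md_cexp /=.
by rewrite !mul0r !mulr0 subrr expR0 mulr1.
Qed.

Lemma ecirc_neq0 r t : 0 < r -> ecirc r t != 0.
Proof. by move=> r0; rewrite -md_gt0 md_ecirc. Qed.

Lemma ecirc_pi2 r : ecirc r pi2 = ecirc r 0.
Proof. by rewrite /ecirc iu_pi2 cexp_tpi mulr0 cexp0. Qed.

Lemma slope_ecirc r t : rder (ecirc r) t (iu * ecirc r t).
Proof.
have H := slopeZ iu (slope_i (real_complex R) t).
have := slopeZ r%:C (slope_comp H (slope_cexp _)).
by congr (slope _ _ _ _); rewrite mulr1 /ecirc; ring.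
Qed.

(* the derivative in [t] of [log (ecirc r t - h)] *)
Definition ker r h t : R[i] := iu * ecirc r t / (ecirc r t - h).

Lemma ecircB_gt0 r h t : 0 < r -> md h < r -> r - md h <= md (ecirc r t - h).
Proof. by move=> r0 hr; apply: le_trans (mdBD _ _); rewrite md_ecirc. Qed.

Lemma ecircB_neq0 r h t : 0 < r -> md h < r -> ecirc r t - h != 0.
Proof. by move=> r0 hr; rewrite -md_gt0; apply: lt_le_trans (ecircB_gt0 t r0 hr); rewrite subr_gt0. Qed.

Lemma cont_ecirc r t : cont (real_complex R) (ecirc r) t.
Proof. exact: slope_cont (slope_ecirc r t). Qed.

Lemma cont_ker r h t : 0 < r -> md h < r -> cont (real_complex R) (ker r h) t.
Proof.
move=> r0 hr; apply: contM.
  by apply: contM; [exact: cont_cst | exact: cont_ecirc].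
apply: contV; first exact: ecircB_neq0.
by apply: contD; [exact: cont_ecirc | exact: cont_cst].
Qed.

Lemma md_ker r h t : 0 < r -> md h < r -> md (ker r h t) <= r / (r - md h).
Proof.
move=> r0 hr; rewrite /ker mdM (mdM iu) mdV md_iu mul1r md_ecirc// ler_pM2l//.
by rewrite lef_pV2 ?ecircB_gt0// posrE ?subr_gt0// md_gt0 ecircB_neq0.
Qed.

Definition disc c r w := md (w - c) <= r.
Definition holo_disc (f : R[i] -> R[i]) c r := forall w, disc c r w -> exists d, cder f w d.

Lemma disc_ecirc c r t : 0 < r -> disc c r (c + ecirc r t).
Proof. by move=> r0; rewrite /disc addrC addKr md_ecirc. Qed.

Lemma cont_circle (f : R[i] -> R[i]) c r t : 0 < r -> holo_disc f c r ->
  cont (real_complex R) (fun t => f (c + ecirc r t)) t.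
Proof.
move=> r0 hf; apply: (cont_comp (f := fun t => c + ecirc r t)).
  by apply: contD; [exact: cont_cst | exact: cont_ecirc].
have [d df] := hf _ (disc_ecirc c t r0); exact: slope_cont df.
Qed.

(* Contract the circle linearly to the interior point [z]; Goursat shows that
   the integral of [f w / (w - z)] is constant along the contraction. *)
Lemma cauchy (f : R[i] -> R[i]) c r z I J : 0 < r -> md (z - c) < r -> holo_disc f c r ->
  is_int (fun t => f (c + ecirc r t) * ker r (z - c) t) 0 pi2 I ->
  is_int (ker r (z - c)) 0 pi2 J -> I = f z * J.
Proof.
move=> r0 zr hf HI HJ; have p0 := ltW pi2_gt0.
pose e t := c + ecirc r t.
have ezE t : e t - z = ecirc r t - (z - c) by rewrite /e; ring.
have ez0 t : e t - z != 0 by rewrite ezE ecircB_neq0.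
have de t : rder e t (iu * ecirc r t).
  by have := slopeD (slope_cst (real_complex R) c t) (slope_ecirc r t); rewrite add0r.
pose w (s t : R) := z + s%:C * (e t - z).
pose ws (s t : R) := e t - z.
pose wt (s t : R) := s%:C * (iu * ecirc r t).
pose q x := f x / (x - z).
have wz s t : w s t - z = s%:C * (e t - z) by rewrite /w; ring.
have wdisc (s t : R) : 0 <= s <= 1 -> disc c r (w s t).
  move=> /andP[s0 s1]; rewrite /disc.
  have -> : w s t - c = (1 - s)%:C * (z - c) + s%:C * ecirc r t.
    by rewrite /w /e rmorphB rmorph1; ring.
  apply: le_trans (mdD _ _) _; rewrite (mdM (1 - s)%:C) (mdM s%:C) !md_real md_ecirc// !ger0_norm ?subr_ge0//.
  have : (1 - s) * md (z - c) <= (1 - s) * r by rewrite ler_wpM2l ?subr_ge0// ltW.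
  lra.
have qwt (s t : R) : 0 < s -> q (w s t) * wt s t = f (w s t) * ker r (z - c) t.
  move=> s0; rewrite /q wz /wt /ker -ezE.
  have sC : s%:C != 0 :> R[i] by rewrite -md_gt0 md_real normr_gt0 gt_eqF.
  by field; rewrite ez0 sC.
have dws s t : rder (w^~ t) s (ws s t) by exact: slope_affine.
have dwt s t : rder (w s) t (wt s t).
  have := slopeD (slope_cst (real_complex R) z t) (slopeZ s%:C (slopeB (de t) (slope_cst (real_complex R) z t))).
  by rewrite add0r subr0.
have dq s t : 0 < s <= 1 -> exists d, cder q (w s t) d.
  move=> /andP[s0 s1]; have [|d df] := hf (w s t); first by apply: wdisc; rewrite ltW.
  eexists; apply: slopeM df _; apply: (slopeV (f := fun x => x - z)).
    rewrite wz mulf_neq0// -md_gt0 md_real normr_gt0 gt_eqF//.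
  apply: slopeB; [exact: slope_i | exact: slope_cst].
have qws_cont s t : 0 < s <= 1 -> cont (real_complex R) (fun s => q (w s t) * ws s t) s.
  move=> s01; apply: contM; last exact: cont_cst.
  apply: (cont_comp (f := w^~ t)); first exact: slope_cont (dws _ _).
  have [d df] := dq s t s01; exact: slope_cont df.
have qwt_cont s t : 0 < s <= 1 -> cont (real_complex R) (fun t => q (w s t) * wt s t) t.
  move=> s01; apply: contM.
    apply: (cont_comp (f := w s)); first exact: slope_cont (dwt _ _).
    have [d df] := dq s t s01; exact: slope_cont df.
  apply: contM; first exact: cont_cst.
  by apply: contM; [exact: cont_cst | exact: cont_ecirc].
(* The contraction stops at a positive [s0], because [q] is singular at [z], the image of [s = 0].
   The limit is taken afterwards, by continuity of [f] at [z]. *)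
have key (s0 : R) Is : 0 < s0 <= 1 ->
    is_int (fun t => f (w s0 t) * ker r (z - c) t) 0 pi2 Is -> Is = I.
  move=> /andP[s00 s01] HIs.
  have /choice [A HA] : forall t, exists G, forall s, s0 <= s <= 1 -> rder G s (q (w s t) * ws s t).
    move=> t; apply: antider => // s /andP[s0s s1]; apply: qws_cont.
    by rewrite s1 (lt_le_trans s00).
  have /choice [B HB] : forall s, exists G, s0 <= s <= 1 -> forall t, 0 <= t <= pi2 -> rder G t (q (w s t) * wt s t).
    move=> s; case: (boolP (s0 <= s <= 1)) => [/andP[s0s s1]|_]; last by exists (fun=> 0).
    have [|G HG] := @antider R (fun t => q (w s t) * wt s t) 0 pi2 p0; last by exists G.
    by move=> t _; apply: qwt_cont; rewrite s1 (lt_le_trans s00).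
  (* The primitives [A t] are chosen independently for each [t]. At the seam [t = pi2] the one
     chosen for [t = 0] is reused, so that these two sides of the rectangle cancel exactly. *)
  pose a s t := A (if t == pi2 then 0 else t) s.
  have := @goursat R q w ws wt a B s0 1 0 pi2 (r + r) s01 p0.
  have Bint (s : R) : s0 <= s <= 1 -> is_int (fun t => f (w s t) * ker r (z - c) t) 0 pi2 (B s pi2 - B s 0).
    move=> s01'; exists (B s) => // t t0; rewrite -qwt; first exact: HB.
    by case/andP: s01' => /(lt_le_trans s00).
  move=> /(_ _ _ _ _ _ _ _)-G; have {}G : circ a B s0 1 0 pi2 = 0.
    apply: G.
    - by move=> s t _; exact: dws.
    - by move=> s t _; exact: dwt.
    - move=> s t _; rewrite /ws ezE; apply: le_trans (mdB _ _) _.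
      by rewrite md_ecirc// lerD2l ltW.
    - move=> s t [/andP[s0s s1] _]; rewrite /wt mdM (mdM iu) md_real md_iu mul1r md_ecirc//.
      rewrite ger0_norm ?(le_trans (ltW s00))//.
      have : s * r <= 1 * r by rewrite ler_wpM2r// ltW.
      lra.
    - by move=> s t [/andP[s0s s1] _]; apply: dq; rewrite s1 (lt_le_trans s00).
    - move=> s t [st _]; rewrite /a; case: eqP => [->|_]; last exact: HA.
      have -> : q (w s pi2) * ws s pi2 = q (w s 0) * ws s 0.
        by rewrite /ws /w /e ecirc_pi2.
      exact: HA.
    - by move=> s t [st tt]; apply: HB.
  have aa s : a s pi2 = a s 0 by rewrite /a eqxx; case: eqP.
  have s0s0 : s0 <= s0 <= 1 by rewrite lexx.
  have s011 : s0 <= (1 : R) <= (1 : R) by rewrite lexx s01.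
  rewrite (is_int_uniq p0 HIs (Bint _ s0s0)).
  have HI' : is_int (fun t => f (w 1 t) * ker r (z - c) t) 0 pi2 I.
    apply: is_int_ext HI => t _; congr (f _ * _).
    by rewrite /w rmorph1 mul1r /e; ring.
  rewrite (is_int_uniq p0 HI' (Bint _ s011)).
  move: G; rewrite /circ !aa => G; apply/eqP; rewrite -subr_eq0 -oppr_eq0 -G; apply/eqP; ring.
apply/eqP; rewrite -subr_eq0 -md_eq0 eq_le md_ge0 andbT leNgt; apply/negP => D0.
set D := md _ in D0.
set k := r / (r - md (z - c)).
have k0 : 0 < k by rewrite divr_gt0// subr_gt0.
have [|d df] := hf z; first by rewrite /disc ltW.
have [|dl dl0 Hd] := slope_cont df (e := D / 2 / (k * pi2)).
  by rewrite !divr_gt0// mulr_gt0// pi2_gt0.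
(* Since [md (e t - z) < r + r + 1], the circle contracted by [s0] lies within [dl] of [z]. *)
pose s0 := Num.min 1 (dl / (r + r + 1)).
have s00 : 0 < s0 <= 1 by rewrite lt_min ltr01 ge_min lexx !divr_gt0//; lra.
have [Is HIs] : exists Is, is_int (fun t => f (w s0 t) * ker r (z - c) t) 0 pi2 Is.
  apply: is_int_ex => // t _; have := qwt_cont s0 t s00.
  by congr (cont _ _ _); apply/funext => x; apply: qwt; case/andP: s00.
have E := key _ _ s00 HIs.
have := is_int_bound (M := D / 2 / (k * pi2) * k) p0 (is_intD HIs (is_intZ (- f z) HJ)).
rewrite E mulNr -/D subr0 => /(_ _) H.
have : D <= D / 2 / (k * pi2) * k * pi2.
  apply: H => t _; rewrite -mulrDl mdM; apply: ler_pM; rewrite ?md_ge0//; last exact: md_ker.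
  apply/ltW/Hd; rewrite /= wz mdM md_real; case/andP: s00 => s00 _; rewrite gtr0_norm//.
  have : md (e t - z) < r + r + 1.
    by rewrite ezE; apply: le_lt_trans (mdB _ _) _; rewrite md_ecirc//; lra.
  have : s0 <= dl / (r + r + 1) by rewrite ge_min lexx orbT.
  rewrite ler_pdivlMr; last lra.
  by move=> h1 h2; apply: lt_le_trans h1; rewrite ltr_pM2l.
have kp : k * pi2 != 0 by rewrite mulf_neq0 ?gt_eqF// pi2_gt0.
have -> : D / 2 / (k * pi2) * k * pi2 = D / 2 by rewrite -mulrA divfK.
lra.
Qed.

End Circle.

(** * Cauchy estimates and removable singularities *)

Section Local.
Variable R : realType.
Implicit Types (f : R[i] -> R[i]) (z w c h : R[i]) (r t M : R).

Lemma cont_ecircV r j t : 0 < r -> cont (real_complex R) (fun t => iu R * (ecirc r t)^-1 ^+ j) t.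
Proof.
move=> r0; apply: contM; first exact: cont_cst.
by apply: contX; apply: contV; [exact: ecirc_neq0 | exact: cont_ecirc].
Qed.

Lemma int_ecircV r j : 0 < r -> (0 < j)%N ->
  is_int (fun t => iu R * (ecirc r t)^-1 ^+ j) 0 (pi2 R) 0.
Proof.
move=> r0 j0; have jn : j%:R != 0 :> R[i] by rewrite pnatr_eq0 -lt0n.
exists (fun t => - j%:R^-1 * (ecirc r t)^-1 ^+ j); last by rewrite ecirc_pi2 subrr.
move=> t _; have E0 := ecirc_neq0 t r0.
have := slopeZ (- j%:R^-1) (slopeX j (slopeV E0 (slope_ecirc r t))).
congr (slope _ _ _ _).
have -> : (ecirc r t)^-1 ^+ j = (ecirc r t)^-1 ^+ j.-1 * (ecirc r t)^-1 by rewrite -exprSr prednK.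
by rewrite /=; move: (_ ^+ j.-1) => X; field; rewrite E0 jn.
Qed.

Lemma int_iu r : is_int (fun t => iu R * (ecirc r t)^-1 ^+ 0) 0 (pi2 R) (tpi R).
Proof.
exists (fun t => iu R * t%:C); last by rewrite iu_pi2 mulr0 subr0.
by move=> t _; rewrite expr0; apply: slopeZ; exact: slope_i.
Qed.

(** Geometric expansion of the Cauchy kernel with exact remainder
    [(h / ecirc r t) ^+ 3 * ker r h t]. Order two is what differentiability of a divided difference
    requires. *)
Lemma ker_expand (g : R -> R[i]) r M (C : nat -> R[i]) h I : 0 < r ->
  (forall t, 0 <= t <= pi2 R -> md (g t) <= M) ->
  (forall j, is_int (fun t => g t * (iu R * (ecirc r t)^-1 ^+ j)) 0 (pi2 R) (C j)) ->
  md h <= r / 2 -> is_int (fun t => g t * ker r h t) 0 (pi2 R) I ->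
  md (I - (C 0%N + C 1%N * h + C 2%N * h ^+ 2)) <= 2 * M * pi2 R * (md h / r) ^+ 3.
Proof.
move=> r0 gM HC hr HI; have p0 := ltW (pi2_gt0 R).
have hr' : md h < r by apply: le_lt_trans hr _; lra.
have M0 : 0 <= M by apply: le_trans (md_ge0 _) (gM 0 _); rewrite lexx.
have HD := is_intD HI (is_intZ (-1) (is_intD (is_intD (HC 0%N) (is_intZ h (HC 1%N))) (is_intZ (h ^+ 2) (HC 2%N)))).
have -> : I - (C 0%N + C 1%N * h + C 2%N * h ^+ 2) =
  I + -1 * (C 0%N + h * C 1%N + h ^+ 2 * C 2%N) by ring.
have -> : 2 * M * pi2 R * (md h / r) ^+ 3 = M * ((md h / r) ^+ 3 * 2) * (pi2 R - 0) by ring.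
apply: (is_int_bound p0 HD) => t tt.
have E0 := ecirc_neq0 t r0; have Eh0 := ecircB_neq0 t r0 hr'.
set v := (X in md X).
have -> : v = g t * ((h / ecirc r t) ^+ 3 * ker r h t).
  by rewrite /v /ker; field; rewrite E0 Eh0.
rewrite (mdM (g t)); apply: ler_pM; rewrite ?md_ge0 ?gM//.
rewrite (mdM (_ ^+ 3)) (mdX _ 3) (mdM h) mdV md_ecirc//.
apply: ler_wpM2l; first by rewrite exprn_ge0// divr_ge0 ?md_ge0// ltW.
apply: le_trans (md_ker t r0 hr') _; rewrite ler_pdivrMr; lra.
Qed.

(* [J] is the winding number [tpi], but a bound suffices *)
Lemma int_ker r h J : 0 < r -> md h <= r / 2 -> is_int (ker r h) 0 (pi2 R) J ->
  md (J - tpi R) <= 2 * pi2 R * (md h / r) ^+ 3.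
Proof.
move=> r0 hr HJ.
have := @ker_expand (fun=> 1) r 1 (fun j => if j == 0%N then tpi R else 0) h J r0.
rewrite mulr1 !mul0r !addr0; apply => //.
- by move=> t _; rewrite md1.
- move=> j; have := @int_ecircV r j r0; have := int_iu r.
  case: j => [H _|j _ /(_ isT) H] /=; apply: is_int_ext H => t _; by rewrite mul1r.
- by apply: is_int_ext HJ => t _; rewrite mul1r.
Qed.

Lemma md_tpi : md (tpi R) = pi2 R.
Proof. by rewrite -iu_pi2 mdM md_iu mul1r md_real ger0_norm// ltW// pi2_gt0. Qed.

Lemma circle_bnd f c r : 0 < r -> holo_disc f c r ->
  exists M, forall t, 0 <= t <= pi2 R -> md (f (c + ecirc r t)) <= M.
Proof.
move=> r0 hf; apply: rcont_bnd (ltW (pi2_gt0 R)) _ => t _; exact: cont_circle.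
Qed.

Lemma circle_int f c r z : 0 < r -> holo_disc f c r -> md (z - c) < r ->
  exists I J, [/\ is_int (fun t => f (c + ecirc r t) * ker r (z - c) t) 0 (pi2 R) I,
    is_int (ker r (z - c)) 0 (pi2 R) J & I = f z * J].
Proof.
move=> r0 hf zr; have p0 := ltW (pi2_gt0 R).
have [|I HI] := @is_int_ex R (fun t => f (c + ecirc r t) * ker r (z - c) t) _ _ p0.
  by move=> t _; apply: contM; [exact: cont_circle | exact: cont_ker].
have [|J HJ] := @is_int_ex R (ker r (z - c)) _ _ p0.
  by move=> t _; exact: cont_ker.
by exists I, J; split => //; exact: cauchy HI HJ.
Qed.

Lemma mean_bound f c r M : 0 < r -> holo_disc f c r ->
  (forall t, 0 <= t <= pi2 R -> md (f (c + ecirc r t)) <= M) -> md (f c) <= M.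
Proof.
move=> r0 hf fM; have p0 := ltW (pi2_gt0 R).
have [|I [J [HI HJ IJ]]] := @circle_int f c r c r0 hf; first by rewrite subrr md0.
have := @int_ker r (c - c) J r0; rewrite subrr md0 mul0r expr0n mulr0 => /(_ _ _) h.
have {h} JE : J = tpi R.
  apply/eqP; rewrite -subr_eq0 -md_eq0 eq_le md_ge0 andbT; apply: h; first lra.
  by rewrite subrr in HJ.
have : md I <= M * (pi2 R - 0).
  apply: (is_int_bound p0 HI) => t tt; rewrite mdM -[M]mulr1; apply: ler_pM; rewrite ?md_ge0 ?fM//.
  rewrite subrr; apply: le_trans (md_ker _ _ _) _; rewrite ?md0 ?subr0 ?divff ?gt_eqF//.
by rewrite IJ JE mdM md_tpi subr0 ler_pM2r// pi2_gt0.
Qed.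

(** The factor 4 is 2 divided by 1/2: on the half disc the kernel is at most 2, and by [int_ker] its
    integral [J] keeps at least half of the modulus [pi2] of [tpi]. *)
Lemma half_bound f c r M z : 0 < r -> holo_disc f c r ->
  (forall t, 0 <= t <= pi2 R -> md (f (c + ecirc r t)) <= M) -> md (z - c) <= r / 2 -> md (f z) <= 4 * M.
Proof.
move=> r0 hf fM zr; have p0 := pi2_gt0 R.
have zr' : md (z - c) < r by apply: le_lt_trans zr _; lra.
have [I [J [HI HJ IJ]]] := circle_int r0 hf zr'.
have M0 : 0 <= M.
  by apply: le_trans (md_ge0 _) (fM 0 _); rewrite lexx ltW.
have hI : md I <= M * 2 * (pi2 R - 0).
  apply: (is_int_bound (ltW p0) HI) => t tt; rewrite mdM; apply: ler_pM; rewrite ?md_ge0 ?fM//.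
  apply: le_trans (md_ker t r0 zr') _; rewrite ler_pdivrMr; lra.
have hJ : pi2 R / 2 <= md J.
  have := int_ker r0 zr HJ; have := mdBD (tpi R) J; rewrite md_tpi mdBC.
  have : (md (z - c) / r) ^+ 3 <= (1 / 2) ^+ 3.
    by apply: lerXn2r; rewrite ?nnegrE ?divr_ge0 ?md_ge0 ?(ltW r0)// ler_pdivrMr//; lra.
  move: (_ ^+ 3) => X; have -> : (1 / 2) ^+ 3 = 1 / 8 :> R by field.
  move=> h1 h2 h3; have : 2 * pi2 R * X <= 2 * pi2 R * (1 / 8) by rewrite ler_pM2l; lra.
  lra.
have : md (f z) * (pi2 R / 2) <= 4 * M * (pi2 R / 2).
  apply: le_trans (_ : md (f z) * md J <= _); first by rewrite ler_wpM2l ?md_ge0.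
  by rewrite -mdM -IJ; lra.
by rewrite ler_pM2r//; lra.
Qed.

Definition quot f c (d : R[i]) w := if w == c then d else (f w - f c) / (w - c).

Lemma quotE f c d w : cder f c d -> f w = f c + quot f c d w * (w - c).
Proof.
rewrite /quot; case: eqP => [->|/eqP wc _]; first by rewrite subrr mulr0 addr0.
by rewrite divfK ?subr_eq0//; ring.
Qed.

(** Cauchy's formula with the expanded kernel gives [f w = a 0 + a 1 * (w - c) + a 2 * (w - c) ^+ 2]
    up to a cubic error. Hence [a 0 = f c] and [a 1 = d], and [a 2] is the derivative of the divided
    difference. *)
Lemma removable f c r d : 0 < r -> holo_disc f c r -> cder f c d ->
  exists e, cder (quot f c d) c e.
Proof.
move=> r0 hf fd; have p0 := pi2_gt0 R; have p0' := ltW p0.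
have [M fM] := circle_bnd r0 hf.
have /choice [C HC] : forall j, exists C, is_int (fun t => f (c + ecirc r t) * (iu R * (ecirc r t)^-1 ^+ j)) 0 (pi2 R) C.
  move=> j; apply: is_int_ex => // t _; apply: contM; first exact: cont_circle.
  exact: cont_ecircV.
have T0 := tpi_neq0 R.
pose a j := C j / tpi R.
have [dl dl0 fc] := cont_bnd (slope_cont fd).
set F := md (f c) + 1 in fc.
(* The first summand comes from the truncation in [ker_expand]. The second comes from [J], known
   only up to the error of [int_ker], which is multiplied by [f w], bounded by [F] near [c]. *)
pose B := (2 * M * pi2 R / r ^+ 3 + F * (2 * pi2 R / r ^+ 3)) / pi2 R.
have exp w : md (w - c) <= r / 2 -> md (w - c) < dl ->
    md (f w - (a 0%N + a 1%N * (w - c) + a 2%N * (w - c) ^+ 2)) <= B * md (w - c) ^+ 3.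
  move=> wr wdl; have wr' : md (w - c) < r by apply: le_lt_trans wr _; lra.
  have [I [J [HI HJ IJ]]] := circle_int r0 hf wr'.
  have h1 := ker_expand r0 fM HC wr HI.
  have h2 := int_ker r0 wr HJ.
  have h3 : md (f w) <= F by exact: fc.
  set D := (X in md X).
  have -> : D = ((I - (C 0%N + C 1%N * (w - c) + C 2%N * (w - c) ^+ 2)) - f w * (J - tpi R)) / tpi R.
    by rewrite /D /a IJ; field.
  rewrite mdM mdV md_tpi /B [leRHS]mulrAC ler_pM2r ?invr_gt0//.
  apply: le_trans (mdB _ _) _; rewrite (mdM (f w)) mulrDl; apply: lerD.
    apply: le_trans h1 _; rewrite expr_div_n; set X := _ ^+ 3; set Y := _ ^+ 3; lra.
  apply: le_trans (ler_pM _ _ h3 h2) _; rewrite ?md_ge0// expr_div_n.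
  by rewrite le_eqVlt; apply/orP; left; apply/eqP; field; rewrite gt_eqF.
have a0 : a 0%N = f c.
  have := exp c; rewrite subrr md0 expr0n /= !mulr0 expr0n mulr0 !addr0 => h.
  apply/eqP; rewrite eq_sym -subr_eq0 -md_eq0 eq_le md_ge0 andbT; apply: h => //; lra.
have B0 : 0 <= B.
  have M0 : 0 <= M by apply: le_trans (md_ge0 _) (fM 0 _); rewrite lexx.
  have F0 : 0 <= F by rewrite /F; have := md_ge0 (f c); lra.
  have r3 : 0 <= r ^+ 3 by rewrite exprn_ge0// ltW.
  rewrite /B; apply: divr_ge0 => //; apply: addr_ge0; first by rewrite divr_ge0// !mulr_ge0.
  by rewrite mulr_ge0// divr_ge0// mulr_ge0.
clearbody B; have a1 : a 1%N = d.
  apply: (cder_uniq (f := f) (z := c)) => //; apply/slopeP => // e e0.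
  exists (Num.min (Num.min (r / 2) dl) (Num.min 1 (e / (B + md (a 2%N) + 1)))).
    rewrite !lt_min dl0 ltr01 !divr_gt0//=.
    have := md_ge0 (a 2%N); lra.
  move=> w; rewrite !lt_min => /andP[/andP[/ltW wr wdl] /andP[w1 we]].
  have := exp w wr wdl; rewrite a0 /= => h.
  have -> : f w - f c - a 1%N * (w - c) =
    (f w - (f c + a 1%N * (w - c) + a 2%N * (w - c) ^+ 2)) + a 2%N * (w - c) ^+ 2 by ring.
  apply: le_trans (mdD _ _) _; rewrite (mdM (a 2%N)) mdX.
  have m0 := md_ge0 (w - c).
  have A0 := md_ge0 (a 2%N).
  rewrite ltr_pdivlMr in we; last lra.
  move: (md (w - c)) (md (a 2%N)) h m0 A0 w1 we => m A h m0 A0 w1 we.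
  apply: le_trans (lerD h (lexx _)) _.
  have -> : B * m ^+ 3 + A * m ^+ 2 = (B * m * m + A * m) * m by ring.
  apply: ler_wpM2r => //.
  have : B * m * m <= B * m by apply: ler_piMr; [exact: mulr_ge0 | exact: ltW].
  lra.
exists (a 2%N); apply/slopeP => // e e0.
exists (Num.min (Num.min (r / 2) dl) (e / (B + 1))).
  rewrite !lt_min dl0 !divr_gt0//=; lra.
move=> w; rewrite !lt_min => /andP[/andP[/ltW wr wdl] we].
rewrite /quot eqxx; case: eqP => [-> |/eqP wc]; first by rewrite !subrr mulr0 subrr md0 mulr0.
have := exp w wr wdl; rewrite a0 a1 /= => h.
rewrite -subr_eq0 in wc.
have m0 : 0 < md (w - c) by rewrite md_gt0.
rewrite -(ler_pM2r m0) -mdM.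
have -> : ((f w - f c) / (w - c) - d - a 2%N * (w - c)) * (w - c) =
   f w - (f c + d * (w - c) + a 2%N * (w - c) ^+ 2) by field.
apply: le_trans h _; rewrite ltr_pdivlMr in we; last lra.
move: (md (w - c)) m0 we => m m0 we.
have -> : B * m ^+ 3 = (B * m) * m * m by ring.
do 2 (apply: ler_wpM2r; first exact: ltW); lra.
Qed.

Lemma quot_holo f c r d : 0 < r -> holo_disc f c r -> cder f c d ->
  holo_disc (quot f c d) c r.
Proof.
move=> r0 hf fd w wr; case: (eqVneq w c) => [->|wc]; first exact: removable r0 hf fd.
have [d' fd'] := hf w wr.
eexists; apply: (@slope_local _ _ id (fun x => (f x - f c) / (x - c)) _ _ _ (md (w - c))) => //.
- by rewrite md_gt0 subr_eq0.
- move=> x; rewrite /quot; case: eqP => // -> /=; by rewrite mdBC ltxx.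
- apply: slopeM; first exact: slopeB fd' (slope_cst _ _ _).
  apply: (slopeV (f := fun x => x - c)); first by rewrite subr_eq0.
  exact: slopeB (slope_i _ _) (slope_cst _ _ _).
Qed.

End Local.

(** * Entire functions of one variable *)

Section Entire1.
Variable R : realType.
Implicit Types (f g : R[i] -> R[i]) (z w c : R[i]) (r e : R).

Definition entire1 f := forall z, exists d, cder f z d.

Definition der f z : R[i] := xget 0 [set d | cder f z d].

Lemma derP f z : (exists d, cder f z d) -> cder f z (der f z).
Proof. by move=> [d fd]; exact: (xgetPex 0 (P := [set d | cder f z d])) (ex_intro _ d fd). Qed.

Lemma der_eq f z d : cder f z d -> der f z = d.
Proof. by move=> fd; exact: cder_uniq (derP (ex_intro _ d fd)) fd. Qed.

Lemma entire1_holo f c r : entire1 f -> holo_disc f c r.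
Proof. by move=> ef z _. Qed.

Lemma entire1_cont f z : entire1 f -> cont id f z.
Proof. by move=> ef; have [d fd] := ef z; exact: slope_cont fd. Qed.

Lemma entire1_cst c : entire1 (fun=> c).
Proof. by move=> z; exists 0; exact: slope_cst. Qed.

Lemma entire1_id : entire1 id.
Proof. by move=> z; exists 1; exact: slope_i. Qed.

Lemma entire1D f g : entire1 f -> entire1 g -> entire1 (fun z => f z + g z).
Proof. by move=> ef eg z; have [a fa] := ef z; have [b gb] := eg z; eexists; exact: slopeD fa gb. Qed.

Lemma entire1M f g : entire1 f -> entire1 g -> entire1 (fun z => f z * g z).
Proof. by move=> ef eg z; have [a fa] := ef z; have [b gb] := eg z; eexists; exact: slopeM fa gb. Qed.

Lemma entire1B f g : entire1 f -> entire1 g -> entire1 (fun z => f z - g z).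
Proof. by move=> ef eg z; have [a fa] := ef z; have [b gb] := eg z; eexists; exact: slopeB fa gb. Qed.

Lemma entire1_comp f g : entire1 f -> entire1 g -> entire1 (fun z => f (g z)).
Proof. by move=> ef eg z; have [b gb] := eg z; have [a fa] := ef (g z); eexists; exact: slope_comp gb fa. Qed.

Lemma entire1_cexp : entire1 (@cexp R).
Proof. by move=> z; eexists; exact: slope_cexp. Qed.

Lemma ball_pt c r : 0 < r -> exists2 w, w != c & md (w - c) < r.
Proof.
have e : c + (r / 2)%:C - c = (r / 2)%:C by ring.
move=> r0; exists (c + (r / 2)%:C).
  by rewrite -subr_eq0 e -md_gt0 md_real normr_gt0 gt_eqF// divr_gt0.
by rewrite e md_real gtr0_norm; lra.
Qed.

Lemma md_small (x : R[i]) : (forall e : R, 0 < e -> md x <= e) -> x = 0.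
Proof.
move=> H; apply/eqP; rewrite -md_eq0 eq_le md_ge0 andbT leNgt; apply/negP => x0.
by have := H (md x / 2); rewrite divr_gt0// => /(_ isT); lra.
Qed.

Lemma cst_ball f c r : (forall z, md (z - c) < r -> cder f z 0) ->
  forall z, md (z - c) < r -> f z = f c.
Proof.
move=> f0 z zr; apply/eqP; rewrite -subr_eq0 -md_eq0 eq_le md_ge0 andbT.
have H t : 0 <= t <= 1 -> md (c + t%:C * (z - c) - c) < r.
  move=> /andP[t0 t1]; rewrite addrC addKr mdM md_real ger0_norm//.
  by apply: le_lt_trans zr; rewrite ler_piMl ?md_ge0.
have := @cmvt R f (fun=> 0) c z 0; rewrite mul0r; apply.
  by move=> t t01; apply: f0; exact: H.
by move=> t _; rewrite md0.
Qed.

(** Cauchy's estimate is [mean_bound] for the divided difference, whose value at the centre is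
    [d]. *)
Lemma der_bound f c r M d : 0 < r -> holo_disc f c r -> cder f c d ->
  (forall t, 0 <= t <= pi2 R -> md (f (c + ecirc r t) - f c) <= M) -> md d <= M / r.
Proof.
move=> r0 hf fd fM; have := mean_bound r0 (quot_holo r0 hf fd) (M := M / r).
rewrite {2}/quot eqxx; apply=> t tt; rewrite /quot.
have E0 := ecirc_neq0 t r0.
rewrite -subr_eq0 [c + _]addrC addrK (negbTE E0) mdM mdV md_ecirc// ler_pM2r ?invr_gt0//.
by rewrite addrC fM.
Qed.

Lemma liouville f M : entire1 f -> (forall z, md (f z) <= M) -> forall z, f z = f 0.
Proof.
move=> ef fM z; apply: (@cst_ball _ _ (md (z - 0) + 1)); last by rewrite ltrDl.
move=> w _; have [d fd] := ef w; suff -> : 0 = d by [].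
apply/esym/md_small => e e0.
have M0 : 0 <= M := le_trans (md_ge0 _) (fM 0).
have r0 : 0 < (2 * M + 1) / e by rewrite divr_gt0//; lra.
apply: le_trans (der_bound (M := 2 * M) r0 (entire1_holo ef) fd _) _.
  move=> t _; apply: le_trans (mdB _ _) _.
  by have := fM w; have := fM (w + ecirc ((2 * M + 1) / e) t); lra.
rewrite ler_pdivrMr// [e * _]mulrC divfK ?gt_eqF//; lra.
Qed.

(** Vanishing to infinite order at [c]: the form in which the identity theorem is used here, with no
    Taylor series. *)
Definition flat f c := forall n : nat, exists K r : R, 0 < r /\
  forall z, md (z - c) < r -> md (f z) <= K * md (z - c) ^+ n.

Lemma flat_factor f c r n : 0 < r -> holo_disc f c r -> flat f c ->
  exists2 g, holo_disc g c r & forall w, f w = (w - c) ^+ n * g w.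
Proof.
move=> r0 hf ff; elim: n => [|n [g hg fg]].
  by exists f => // w; rewrite expr0 mul1r.
have cr : disc c r c by rewrite /disc subrr md0 ltW.
have gd := derP (hg c cr).
have gc0 : g c = 0.
  apply: md_small => e e0; have [K [r1 [r10 H1]]] := ff n.+1.
  have [r2 r20 H2] := slope_cont gd (divr_gt0 e0 (ltr0Sn R 1)).
  have K0 : 0 < `|K| + 1 by apply: ltr_wpDl.
  have [|w wc] := @ball_pt c (Num.min (Num.min r1 r2) (e / 2 / (`|K| + 1))).
    by rewrite !lt_min r10 r20 !divr_gt0.
  rewrite !lt_min => /andP[/andP[w1 w2] we].
  have m0 : 0 < md (w - c) by rewrite md_gt0 subr_eq0.
  have := H1 w w1; rewrite fg mdM mdX.
  have -> : K * md (w - c) ^+ n.+1 = md (w - c) ^+ n * (K * md (w - c)).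
    by rewrite exprS; ring.
  rewrite ler_pM2l ?exprn_gt0// => h.
  have := H2 w w2; have := mdBD (g c) (g w); rewrite mdBC.
  rewrite ltr_pdivlMr// in we.
  have : md (w - c) * K <= md (w - c) * (`|K| + 1).
    by rewrite ler_pM2l//; apply: le_trans (ler_norm _) _; rewrite lerDl.
  move: h; rewrite [K * _]mulrC; lra.
exists (quot g c (der g c)); first exact: quot_holo.
by move=> w; rewrite fg {1}(quotE w gd) gc0 add0r exprSr; ring.
Qed.

(** Division by [(w - c) ^+ n] leaves a holomorphic [g] of modulus at most [M / r ^+ n] on the
    circle. On the half disc this yields [4 * M / 2 ^+ n] as a bound for [f], for every [n]. *)
Lemma flat_zero f c r : 0 < r -> holo_disc f c r -> flat f c ->
  forall z, md (z - c) <= r / 2 -> f z = 0.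
Proof.
move=> r0 hf ff z zr; have [M fM] := circle_bnd r0 hf.
have M0 : 0 <= M by apply: le_trans (md_ge0 _) (fM 0 _); rewrite lexx ltW// pi2_gt0.
have H n : md (f z) <= 4 * M * (1 / 2) ^+ n.
  have [g hg fg] := flat_factor n r0 hf ff.
  have gb : md (g z) <= 4 * (M / r ^+ n).
    apply: (half_bound r0 hg _ zr) => t tt.
    have := fM t tt; rewrite fg (_ : c + ecirc r t - c = ecirc r t); last by ring.
    rewrite mdM mdX (md_ecirc t r0) => h.
    by rewrite ler_pdivlMr ?exprn_gt0// mulrC.
  rewrite fg mdM mdX.
  have -> : 4 * M * (1 / 2) ^+ n = (r / 2) ^+ n * (4 * (M / r ^+ n)).
    have rn : r ^+ n != 0 by rewrite expf_neq0// gt_eqF.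
    have tn : 2 ^+ n != 0 :> R by rewrite expf_neq0// pnatr_eq0.
    by rewrite !expr_div_n expr1n; field; rewrite rn tn.
  apply: ler_pM; rewrite ?exprn_ge0 ?md_ge0//.
  by apply: lerXn2r; rewrite ?nnegrE ?md_ge0// divr_ge0// ltW.
apply: md_small => e e0.
pose n := (Num.truncn (4 * M / e)).+1.
apply: le_trans (H n) _; rewrite expr_div_n expr1n mulrA mulr1.
rewrite ler_pdivrMr ?exprn_gt0// [e * _]mulrC -ler_pdivrMr//.
apply: le_trans (ltW (truncnS_gt _)) _.
by rewrite -natrX ler_nat /n ltnW// ltn_expl.
Qed.

Lemma zero_flat f c r : 0 < r -> (forall z, md (z - c) < r -> f z = 0) -> flat f c.
Proof.
move=> r0 f0 n; exists 0, r; split => // z /f0 ->.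
by rewrite md0 mul0r.
Qed.

Lemma entire1_flat f c : entire1 f -> flat f c -> forall z, f z = 0.
Proof.
move=> ef ff z; have m0 := md_ge0 (z - c).
have r0 : 0 < 2 * md (z - c) + 1 by lra.
by apply: (flat_zero r0 (entire1_holo ef) ff); lra.
Qed.

Lemma entire1_zero f c r : entire1 f -> 0 < r -> (forall z, md (z - c) < r -> f z = 0) ->
  forall z, f z = 0.
Proof. by move=> ef r0 f0; apply: entire1_flat ef (zero_flat r0 f0). Qed.

Lemma cont_neq0 f c : cont id f c -> f c != 0 ->
  exists2 r : R, 0 < r & forall z, md (z - c) < r -> f z != 0.
Proof.
rewrite -md_gt0 => cf fc; have [r r0 H] := cf _ fc; exists r => // z /H.
rewrite -md_gt0; have := mdBD (f c) (f z); rewrite mdBC; lra.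
Qed.

Lemma entire1_mul0 f g : entire1 f -> entire1 g -> (forall z, f z * g z = 0) ->
  (forall z, f z = 0) \/ (forall z, g z = 0).
Proof.
move=> ef eg fg; case: (pselect (forall z, f z = 0)) => [|nf]; first by left.
right; have [c fc] : exists c, f c != 0.
  by apply: contrapT => h; apply: nf => z; apply/eqP/negP => fz; apply: h; exists z; apply/negP.
have [r r0 H] := cont_neq0 (entire1_cont c ef) fc.
apply: entire1_zero eg r0 _ => z /H fz.
by have /eqP := fg z; rewrite mulf_eq0 (negbTE fz) => /eqP.
Qed.

(** Entire functions form an integral domain. A parameter known at each point to lie in a finite
    list can thereby be chosen once for the whole plane. *)
Lemma entire1_prod0 (T : eqType) (s : seq T) (F : T -> R[i] -> R[i]) :
  (forall k, entire1 (F k)) -> (forall z, \prod_(k <- s) F k z = 0) ->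
  exists2 k, k \in s & forall z, F k z = 0.
Proof.
move=> eF; elim: s => [|k s IH] H.
  by have /eqP := H 0; rewrite big_nil oner_eq0.
have es : entire1 (fun z => \prod_(k <- s) F k z).
  elim: (s) => [|k' s' IH'].
    have -> : (fun z => \prod_(k <- [::]) F k z) = (fun=> 1) by apply/funext => z; rewrite big_nil.
    exact: entire1_cst.
  have -> : (fun z => \prod_(k <- k' :: s') F k z) = (fun z => F k' z * \prod_(k <- s') F k z).
    by apply/funext => z; rewrite big_cons.
  exact: entire1M.
have [|h|h] := entire1_mul0 (eF k) es; first by move=> z; have := H z; rewrite big_cons.
  by exists k => //; rewrite mem_head.
by have [k' k's H'] := IH h; exists k' => //; rewrite inE k's orbT.
Qed.

(** Cauchy's estimate is applied to [f] minus its tangent map at [z], on the circle around [w]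
    through [z]. That circle stays within [2 * md (w - z)] of [z], where this function varies by a
    small multiple of [md (w - z)]. *)
Lemma der_cont f z : entire1 f -> cont id (der f) z.
Proof.
move=> ef e e0; have fz := derP (ef z).
have e4 : 0 < e / 4 by lra.
have [r r0 H] := (slopeP _ _ _ (@inj_id _)).1 fz _ e4.
exists (r / 2); first by rewrite divr_gt0.
move=> w /= wr; have [->|wz] := eqVneq w z; first by rewrite subrr md0.
pose h x := f x - der f z * x.
have eh : entire1 h by apply: entire1B => //; apply: entire1M; [exact: entire1_cst | exact: entire1_id].
have hw : cder h w (der f w - der f z).
  have := slopeB (derP (ef w)) (slopeZ (der f z) (slope_i id w)); by rewrite mulr1.
have rho0 : 0 < md (w - z) by rewrite md_gt0 subr_eq0.
apply: (@le_lt_trans _ _ (3 * (e / 4))); last lra.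
rewrite -(mulfK (lt0r_neq0 rho0) (3 * (e / 4))).
apply: (der_bound rho0 (entire1_holo eh) hw _) => t _.
set x := w + _.
have xz : md (x - z) <= 2 * md (w - z).
  have -> : x - z = ecirc (md (w - z)) t + (w - z) by rewrite /x; ring.
  by apply: le_trans (mdD _ _) _; rewrite md_ecirc//; lra.
have -> : h x - h w = (f x - f z - der f z * (x - z)) - (f w - f z - der f z * (w - z)).
  by rewrite /h; ring.
apply: le_trans (mdB _ _) _.
have h1 : md (x - z) < r by lra.
have h2 : md (w - z) < r by lra.
have := H x h1; have := H w h2 => /= A B.
have : e / 4 * md (x - z) <= e / 4 * (2 * md (w - z)) by rewrite ler_pM2l.
lra.
Qed.

(** If [y] were omitted near [c], the function [1 / (f - y)] would be holomorphic on the disc of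
    radius [rho] and larger at the centre than on the circle, where [f - y] has modulus at least
    [md d * rho / 4]. This contradicts [mean_bound]. *)
Lemma open_mapping f c d e : entire1 f -> cder f c d -> d != 0 -> 0 < e ->
  exists2 dl : R, 0 < dl & forall y, md (y - f c) < dl -> exists2 x, md (x - c) < e & f x = y.
Proof.
move=> ef fd; rewrite -md_gt0 => d0 e0.
have [r r0 H] := (slopeP _ _ _ (@inj_id _)).1 fd _ (divr_gt0 d0 (ltr0Sn R 1)).
pose rho := Num.min e r / 2.
have rr : 0 < rho /\ rho < e /\ rho < r.
  have m0 : 0 < Num.min e r by rewrite lt_min e0.
  have m1 : Num.min e r <= e by rewrite ge_min lexx.
  have m2 : Num.min e r <= r by rewrite ge_min lexx orbT.
  by rewrite /rho; split; [|split]; lra.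
case: rr => rho0 [rhoe rhor].
exists (md d * rho / 4); first by rewrite divr_gt0// mulr_gt0.
move=> y hy; apply: contrapT => nx.
have fy x : md (x - c) <= rho -> f x - y != 0.
  move=> xr; apply/negP; rewrite subr_eq0 => /eqP fxy; apply: nx; exists x => //.
  exact: le_lt_trans xr rhoe.
have hg : holo_disc (fun x => (f x - y)^-1) c rho.
  move=> x xr; have [d' fd'] := ef x; eexists.
  apply: (slopeV (f := fun x => f x - y)); first exact: fy.
  exact: slopeB fd' (slope_cst _ _ _).
have := mean_bound rho0 hg (M := (md d * rho / 4)^-1).
have cc : md (f c - y) != 0 by rewrite md_eq0 fy// subrr md0 ltW.
have cc0 : 0 < md (f c - y) by rewrite lt_neqAle eq_sym cc md_ge0.
have q0 : 0 < md d * rho / 4 by rewrite divr_gt0// mulr_gt0.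
rewrite mdV lef_pV2 ?posrE// => /(_ _); rewrite mdBC leNgt hy => /(_ _) h.
suff : false by []; apply: h => t _.
rewrite mdV lef_pV2 ?posrE//; last first.
  by rewrite md_gt0 fy// addrC addKr md_ecirc.
set x := c + _; have xc : md (x - c) = rho by rewrite /x addrC addKr md_ecirc.
have := H x; rewrite /= xc => /(_ rhor) h1.
have : md d * rho <= md (f x - f c) + md d / 2 * rho.
  rewrite -xc -mdM; have -> : d * (x - c) = (f x - f c) - (f x - f c - d * (x - c)) by ring.
  by apply: le_trans (mdB _ _) _; rewrite lerD2l xc.
have -> : f x - y = (f x - f c) - (y - f c) by ring.
have := mdBD (f x - f c) (y - f c); lra.
Qed.

Lemma nonconst_der f c e : entire1 f -> ~ (forall z, f z = f c) -> 0 < e ->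
  exists2 z, md (z - c) < e & der f z != 0.
Proof.
move=> ef nc e0; apply: contrapT => h; apply: nc => z.
apply/eqP; rewrite -subr_eq0; apply/eqP; move: z.
apply: (@entire1_zero (fun z => f z - f c) c e) => //.
  by apply: entire1B => //; exact: entire1_cst.
move=> z zc; suff -> : f z = f c by rewrite subrr.
apply: cst_ball zc => w wc; suff <- : der f w = 0 by exact: derP.
by apply/eqP/negP => /negP w0; apply: h; exists w.
Qed.

Lemma entire1_bnd f c r : entire1 f -> exists M, forall z, md (z - c) <= r -> md (f z) <= M.
Proof.
move=> ef; pose r' := 2 * `|r| + 1.
have r'0 : 0 < r' by rewrite ltr_wpDl// mulr_ge0.
have [M fM] := circle_bnd r'0 (@entire1_holo f c r' ef).
exists (4 * M) => z zr; apply: (half_bound r'0 (@entire1_holo f c r' ef) fM _).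
have := ler_norm r; rewrite /r'; lra.
Qed.

(** The quotient completed by l'Hôpital's rule; it is meant for a denominator with simple zeros. *)
Definition equot f g z := if g z == 0 then der f z / der g z else f z / g z.

Lemma entire1_quot f g : entire1 f -> entire1 g ->
  (forall z, g z = 0 -> f z = 0 /\ der g z != 0) -> entire1 (equot f g).
Proof.
move=> ef eg H z; case: (eqVneq (g z) 0) => gz; last first.
  have [r r0 gr] := cont_neq0 (entire1_cont z eg) gz.
  eexists; apply: (@slope_local _ _ id (fun x => f x / g x) _ _ _ r) => //.
    by move=> x /gr gx; rewrite /equot (negbTE gx).
  apply: slopeM (derP (ef z)) _; apply: slopeV => //; exact: derP.
have [fz dgz] := H z gz.
pose q1 := quot f z (der f z); pose q2 := quot g z (der g z).
have fE := quotE _ (derP (ef z)); have gE := quotE _ (derP (eg z)).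
have [d1 q1d] := removable ltr01 (@entire1_holo f z 1 ef) (derP (ef z)).
have [d2 q2d] := removable ltr01 (@entire1_holo g z 1 eg) (derP (eg z)).
have q2z : q2 z != 0 by rewrite /q2 /quot eqxx.
have [r r0 q2r] := cont_neq0 (slope_cont q2d) q2z.
eexists; apply: (@slope_local _ _ id (fun x => q1 x / q2 x) _ _ _ r) => //; last first.
  by apply: slopeM q1d _; apply: slopeV q2z q2d.
move=> x /q2r q2x; rewrite /equot (fE x) (gE x) fz gz !add0r -/q1 -/q2.
rewrite mulf_eq0 (negbTE q2x) /= subr_eq0; case: eqP => [->|/eqP xz].
  by rewrite /q1 /q2 /quot eqxx.
by field; rewrite subr_eq0 xz q2x.
Qed.

Lemma equotE f g : (forall z, g z = 0 -> f z = 0) -> forall z, f z = equot f g z * g z.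
Proof.
move=> H z; rewrite /equot; case: eqP => [gz|/eqP gz]; first by rewrite gz mulr0 H.
by rewrite divfK.
Qed.

(** The divided difference of [f] at [w'] is bounded on the circle of radius [r / 4] around [w'],
    hence on the half disc, uniformly in [w']. For [finite_part p] this supplies the Lipschitz
    condition of the uniqueness theorem. *)
Lemma locally_lipschitz f c r : 0 < r -> holo_disc f c r ->
  exists K rho : R, 0 < rho /\ forall w w', md (w - c) < rho -> md (w' - c) < rho ->
    md (f w - f w') <= K * md (w - w').
Proof.
move=> r0 hf; have [M fM] := circle_bnd r0 hf.
have B z : md (z - c) <= r / 2 -> md (f z) <= 4 * M by apply: half_bound.
have r4 : 0 < r / 4 by lra.
exists (4 * (8 * M / (r / 4))), (r / 16); split; first lra.
move=> w w' wc w'c.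
have hf' : holo_disc f w' (r / 4).
  move=> x; rewrite /disc => xw; apply: hf; rewrite /disc.
  have -> : x - c = (x - w') + (w' - c) by ring.
  by apply: le_trans (mdD _ _) _; lra.
have [d fd] : exists d, cder f w' d by apply: hf; rewrite /disc; lra.
rewrite (quotE w fd) addrC addKr mdM ler_wpM2r ?md_ge0//.
apply: (half_bound r4 (quot_holo r4 hf' fd) _ _).
  move=> t _; rewrite /quot -subr_eq0 [w' + _]addrC addrK (negbTE (ecirc_neq0 t r4)).
  rewrite mdM mdV md_ecirc// ler_pM2r ?invr_gt0//.
  apply: le_trans (mdB _ _) _.
  have h1 : md (f w') <= 4 * M by apply: B; lra.
  have h2 : md (f (ecirc (r / 4) t + w')) <= 4 * M.
    apply: B; rewrite -addrA; apply: le_trans (mdD _ _) _; rewrite md_ecirc//; lra.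
  lra.
have -> : w - w' = (w - c) - (w' - c) by ring.
by apply: le_trans (mdB _ _) _; lra.
Qed.

End Entire1.

(** * Solutions on a line *)

Section Rigidity.
Variable R : realType.
Implicit Types (f g : R[i] -> R[i]) (z w c : R[i]) (r e : R).

Lemma sum_expM_neq0 (a : R[i]) l : (0 < l)%N -> a != 0 ->
  \sum_(i < l) a ^+ (l.-1 - i) * a ^+ i != 0.
Proof.
move=> l0 a0; rewrite (eq_bigr (fun=> a ^+ l.-1)) => [|i _]; last first.
  by rewrite -exprD subnK// -ltnS prednK.
by rewrite sumr_const card_ord mulrn_eq0 negb_or -lt0n l0 expf_neq0.
Qed.

Lemma cont_sum (T : Type) (i : T -> R[i]) n (F : nat -> T -> R[i]) t :
  (forall k, cont i (F k) t) -> cont i (fun s => \sum_(k < n) F k s) t.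
Proof.
move=> cF; elim: n => [|n IH].
  have -> : (fun s => \sum_(k < 0) F k s) = (fun=> 0) by apply/funext => s; rewrite big_ord0.
  exact: cont_cst.
have -> : (fun s => \sum_(k < n.+1) F k s) = (fun s => \sum_(k < n) F k s + F n s).
  by apply/funext => s; rewrite big_ord_recr.
exact: contD.
Qed.

(** Each use of the mean value inequality gains a factor [|K| * md x]; after [n] of them the bound
    shows that [D] is flat at 0. *)
Lemma gronwall_zero (D : R[i] -> R[i]) (K r : R) : entire1 D -> D 0 = 0 -> 0 < r ->
  (forall x, md x < r -> md (der D x) <= K * md (D x)) -> forall x, D x = 0.
Proof.
move=> eD D0 r0 DK; apply: (entire1_flat (c := 0)) => // n; exists (`|K| ^+ n * xget 0 [set M : R | forall z, md (z - 0) <= r -> md (D z) <= M]), r; split => //.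
have [M HM] := entire1_bnd 0 r eD.
have := xgetPex 0 (P := [set M : R | forall z, md (z - 0) <= r -> md (D z) <= M]) (ex_intro _ M HM).
move: (xget _ _) => {HM}M /= HM.
elim: n => [|n IH] x; rewrite subr0 => xr.
  by rewrite !expr0 mul1r mulr1; apply: HM; rewrite subr0 ltW.
rewrite -[D x]subr0 -D0 exprS exprSr.
have -> : `|K| * `|K| ^+ n * M * (md x ^+ n * md x) = (`|K| * (`|K| ^+ n * M * md x ^+ n)) * md (x - 0).
  by rewrite subr0; ring.
apply: (cmvt (df := der D)) => t /andP[t0 t1]; first exact: derP.
rewrite subr0 add0r.
have tx : md (t%:C * x) <= md x.
  by rewrite mdM md_real ger0_norm// ler_piMl// md_ge0.
apply: le_trans (DK _ (le_lt_trans tx xr)) _.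
apply: le_trans (ler_wpM2r (md_ge0 _) (ler_norm K)) _; rewrite ler_wpM2l//.
apply: le_trans (IH _ _) _; first by rewrite subr0; exact: le_lt_trans tx xr.
rewrite subr0; apply: ler_wpM2l.
  by rewrite mulr_ge0 ?exprn_ge0//; apply: le_trans (md_ge0 _) (HM 0 _); rewrite subrr md0 ltW.
by apply: lerXn2r; rewrite ?nnegrE ?md_ge0.
Qed.

(* The two branches [x |-> f (s + x)] and [x |-> f (t + om * x)] solve the same
   equation with the same value and the same derivative at [0]. *)
Lemma same_value_symmetry f (P : R[i] -> R[i]) l s t : entire1 f -> (0 < l)%N ->
  (forall z, der f z ^+ l = P (f z)) ->
  (exists K r : R, 0 < r /\ forall y y', md (y - f s) < r -> md (y' - f s) < r ->
     md (P y - P y') <= K * md (y - y')) ->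
  f s = f t -> der f s != 0 ->
  exists2 om, om ^+ l = 1 & forall x, f (t + om * x) = f (s + x).
Proof.
move=> ef l0 fP [K [r [r0 PK]]] fst ds.
have dt : der f t != 0.
  by have := expf_neq0 l ds; rewrite fP fst -fP expf_eq0 l0.
pose om := der f s / der f t.
have om1 : om ^+ l = 1 by rewrite expr_div_n !fP fst divff// -fP expf_neq0.
exists om => //.
pose F x := f (s + x); pose G x := f (t + om * x).
have dF x : cder F x (der f (s + x)).
  have := slope_comp (slopeD (slope_cst id s x) (slope_i id x)) (derP (ef (s + x))).
  by rewrite add0r mulr1.
have dG x : cder G x (om * der f (t + om * x)).
  have := slope_comp (slopeD (slope_cst id t x) (slopeZ om (slope_i id x))) (derP (ef (t + om * x))).
  by rewrite add0r mulr1 mulrC.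
have eF : entire1 F by move=> x; eexists; exact: dF.
have eG : entire1 G by move=> x; eexists; exact: dG.
pose D x := F x - G x.
have dD x : der D x = der F x - der G x.
  by rewrite (der_eq (dF x)) (der_eq (dG x)); apply: der_eq; exact: slopeB.
(* The equation is not solved for the derivative: [F'^l - G'^l] is [(F' - G') * Sg], and [Sg 0] is
   [l * F'(0)^(l-1)], which is nonzero. Near 0 the Lipschitz bound for [P] thus bounds [F' - G'] by
   a multiple of [F - G]. *)
pose Sg x := \sum_(i < l) der F x ^+ (l.-1 - i) * der G x ^+ i.
have FG0 : der G 0 = der F 0.
  by rewrite (der_eq (dF 0)) (der_eq (dG 0)) mulr0 !addr0 /om divfK.
have F0 : der F 0 != 0 by rewrite (der_eq (dF 0)) addr0.
have S0 : Sg 0 != 0 by rewrite /Sg FG0 sum_expM_neq0.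
have cS : cont id Sg 0.
  have := @cont_sum _ id l (fun i x => der F x ^+ (l.-1 - i) * der G x ^+ i) 0; apply=> k.
  by apply: contM; apply: contX; exact: der_cont.
rewrite -md_gt0 in S0.
have [d1 d10 H1] := cS _ (divr_gt0 S0 (ltr0Sn R 1)).
have [d2 d20 H2] := entire1_cont 0 eF r0.
have [d3 d30 H3] := entire1_cont 0 eG r0.
have eD : entire1 D by exact: entire1B.
have D0 : D 0 = 0 by rewrite /D /F /G mulr0 !addr0 fst subrr.
suff H : forall x, D x = 0 by move=> x; apply/eqP; rewrite eq_sym -subr_eq0; apply/eqP; exact: H.
apply: (@gronwall_zero D (K / (md (Sg 0) / 2)) (Num.min d1 (Num.min d2 d3))) => //.
  by rewrite !lt_min d10 d20.
move=> x; rewrite -[x]subr0 !lt_min => /and3P[/H1 h1 /H2 h2 /H3 h3].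
rewrite !subr0 in h1 h2 h3 *.
have Sx : md (Sg 0) / 2 <= md (Sg x) by have := mdBD (Sg 0) (Sg x); rewrite mdBC; lra.
have e1 : md (der D x) * md (Sg x) <= K * md (D x).
  rewrite -mdM dD /Sg.
  have <- : der F x ^+ l - der G x ^+ l =
      (der F x - der G x) * \sum_(i < l) der F x ^+ (l.-1 - i) * der G x ^+ i.
    by rewrite subrXX.
  rewrite (der_eq (dF x)) (der_eq (dG x)) exprMn om1 mul1r !fP.
  apply: PK; first by have := h2; rewrite /F addr0.
  by have := h3; rewrite /G mulr0 addr0 fst.
rewrite mulrAC ler_pdivlMr; last by rewrite divr_gt0.
by apply: le_trans e1; rewrite ler_wpM2l ?md_ge0.
Qed.

Lemma cont_md_le F z (B : R) : cont id F z ->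
  (forall e, 0 < e -> exists2 w, md (w - z) < e & md (F w) <= B) -> md (F z) <= B.
Proof.
move=> cF H; rewrite leNgt; apply/negP => BF.
have [|d d0 {}cF] := cF (md (F z) - B); first by rewrite subr_gt0.
have [w wz FB] := H d d0; have := cF w wz; have := mdBD (F z) (F w).
by rewrite mdBC; lra.
Qed.

Lemma avoid_value f c z e : entire1 f -> ~ (forall x, f x = c) -> 0 < e ->
  exists2 w, md (w - z) < e & f w != c.
Proof.
move=> ef nc e0; apply: contrapT => H; apply: nc => x; apply/eqP; rewrite -subr_eq0; apply/eqP.
move: x; apply: (@entire1_zero _ (fun x => f x - c) z e) => //.
  by apply: entire1B => //; exact: entire1_cst.
move=> w wz; apply/eqP; rewrite subr_eq0; apply/negP => /negP fw; apply: H; by exists w.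
Qed.

(* [f] is the composite of [E] with an injective function [h]; this makes
   [(y - y0) / (h y - h y0)] affine in [y]. *)
Lemma rigidity f E : entire1 f -> entire1 E -> ~ (forall z, f z = f 0) ->
  (forall s t, E s = E t -> f s = f t) ->
  (forall s t, f s = f t -> der f s != 0 -> E s = E t) ->
  (forall s t, f s = f t -> der f s != 0 -> der f t != 0) ->
  (forall s t, E s = E t -> der E s != 0 -> der E t != 0) ->
  exists z0 al be, (forall z, E z - E z0 = (al + be * E z) * (f z - f z0)) /\
    (forall z, al + be * E z != 0).
Proof.
move=> ef eE fnc Ef fE fs Es.
have nf c : ~ (forall z, f z = c) by move=> H; apply: fnc => z; rewrite !H.
have nE c : ~ (forall z, E z = c) by move=> H; apply: (nf (f 0)) => z; apply: Ef; rewrite !H.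
(* The base point [z0] must have nonzero derivative for both [f] and [E]: it is found near a point
   where that of [f] is nonzero. *)
have [a _ dfa] := nonconst_der ef (nf (f 0)) ltr01.
have [r1 r10 H1] := cont_neq0 (der_cont a ef) dfa.
have [z0 z0a dE0] := nonconst_der eE (nE (E a)) r10.
have df0 := H1 _ z0a.
pose N z := E z - E z0; pose D z := f z - f z0.
have dN z : der N z = der E z.
  by apply: der_eq; have := slopeB (derP (eE z)) (slope_cst id (E z0) z); rewrite subr0.
have dD z : der D z = der f z.
  by apply: der_eq; have := slopeB (derP (ef z)) (slope_cst id (f z0) z); rewrite subr0.
have eN : entire1 N by apply: entire1B => //; exact: entire1_cst.
have eD : entire1 D by apply: entire1B => //; exact: entire1_cst.
have D0 z : D z = 0 -> f z0 = f z by move=> /eqP; rewrite subr_eq0 => /eqP.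
have N0 z : N z = 0 -> E z = E z0 by move=> /eqP; rewrite subr_eq0 => /eqP.
have DN z : D z = 0 -> N z = 0.
  by move=> /D0 h; rewrite /N -(fE _ _ h df0) subrr.
(* Every zero of [D] lies in the fibre of [f] through [z0], where [f] has nonzero derivative; so it
   is simple, and [N] vanishes there too. *)
pose Q := equot N D.
have eQ : entire1 Q.
  apply: entire1_quot => // z Dz; split; first exact: DN.
  by rewrite dD; apply: fs df0; exact: D0.
have QE z : N z = Q z * D z by apply: equotE.
have Qn z : Q z != 0.
  rewrite /Q /equot; case: (eqVneq (D z) 0) => Dz.
    rewrite dN dD mulf_neq0//.
      by apply: Es dE0; apply: fE df0; exact: D0.
    by rewrite invr_eq0; apply: fs df0; exact: D0.
  rewrite mulf_neq0 ?invr_eq0//; apply: contra Dz => /eqP /N0 /Ef h.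
  by rewrite /D h subrr.
have Qcongr s t : E s = E t -> D s != 0 -> Q s = Q t.
  move=> h Ds; have fh := Ef _ _ h; have Dt : D t != 0 by rewrite /D -fh.
  by rewrite /Q /equot (negbTE Ds) (negbTE Dt) /N /D h fh.
(* The growth of [Q] is at most linear in [E]; this is the input for Liouville's theorem applied to
   [W]. *)
have [C QC] : exists C : R, 0 <= C /\ forall z, md (Q z) <= C * (1 + md (E z)).
  have [r2 r20 H2] := cont_neq0 (der_cont z0 ef) df0.
  have [dl dl0 om] := open_mapping ef (derP (ef z0)) df0 r20.
  have [C1 HC1] := entire1_bnd z0 r2 eQ.
  have C10 : 0 <= C1 by apply: le_trans (md_ge0 _) (HC1 z0 _); rewrite subrr md0 ltW.
  set C := C1 + (1 + md (E z0)) / dl.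
  have C2 : 0 <= (1 + md (E z0)) / dl by apply: divr_ge0; [rewrite addr_ge0 ?md_ge0 | exact: ltW].
  have HD z : D z != 0 -> md (Q z) <= C * (1 + md (E z)).
    move=> Dz; have mE := md_ge0 (E z); rewrite /C mulrDl.
    (* If [f z] is close to [f z0], a point [s] of a fixed disc has the same value of [f], hence of
       [E] and of [Q]. Otherwise the denominator [D z] is bounded away from 0. *)
    case: (ltP (md (f z - f z0)) dl) => h.
      have [s sz fsz] := om _ h.
      have sE : E s = E z by apply: fE => //; exact: H2.
      have -> : Q z = Q s by apply: Qcongr.
      have : md (Q s) <= C1 by apply: HC1; rewrite ltW.
      have : 0 <= C1 * md (E z) by rewrite mulr_ge0.
      have : 0 <= (1 + md (E z0)) / dl * (1 + md (E z)) by rewrite mulr_ge0// addr_ge0.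
      lra.
    have : md (Q z) <= (md (E z) + md (E z0)) / dl.
      rewrite /Q /equot (negbTE Dz) mdM mdV; apply: ler_pM; rewrite ?invr_ge0 ?md_ge0//.
        exact: mdB.
      by rewrite lef_pV2// posrE md_gt0.
    have : (md (E z) + md (E z0)) / dl <= (1 + md (E z0)) / dl * (1 + md (E z)).
      rewrite [leRHS]mulrAC ler_pM2r ?invr_gt0//.
      have : 0 <= md (E z0) * md (E z) by rewrite mulr_ge0// md_ge0.
      have := md_ge0 (E z0); lra.
    have : 0 <= C1 * (1 + md (E z)) by rewrite mulr_ge0// addr_ge0.
    lra.
  have C0 : 0 <= C by rewrite addr_ge0.
  exists (2 * C); split; first lra.
  move=> z; apply: (cont_md_le (entire1_cont z eQ)) => e e0.
  have [d d0 Hd] := cont_bnd (entire1_cont z eE).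
  have [|w] := @avoid_value f (f z0) z (Num.min e d) ef (nf _); first by rewrite lt_min e0.
  rewrite lt_min => /andP[we wd] fw; exists w => //.
  apply: le_trans (HD w _) _; first by rewrite /D subr_eq0.
  have : C * (1 + md (E w)) <= C * (1 + (md (E z) + 1)).
    by apply: ler_wpM2l => //; rewrite lerD2l; exact: Hd.
  have : 0 <= C * md (E z) by rewrite mulr_ge0// md_ge0.
  lra.
case: QC => C0 QC.
have [b _ fb] := @avoid_value f (f z0) z0 1 ef (nf _) ltr01.
have [r3 r30 H3] : exists2 r : R, 0 < r & forall z, md (z - b) < r -> D z != 0.
  by apply: cont_neq0; [exact: entire1_cont | rewrite /D subr_eq0].
(* Halving [r3] keeps the disc of radius [r3 / 2] around [z1], in which [open_mapping] is used
   below, inside the region where [D] has no zero and [Qcongr] applies. *)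
have [|z1 z1b dE1] := @nonconst_der _ E b (r3 / 2) eE (nE (E b)); first by rewrite divr_gt0.
pose N2 z := Q z - Q z1; pose D2 z := E z - E z1.
have dD2 z : der D2 z = der E z.
  by apply: der_eq; have := slopeB (derP (eE z)) (slope_cst id (E z1) z); rewrite subr0.
have eN2 : entire1 N2 by apply: entire1B => //; exact: entire1_cst.
have eD2 : entire1 D2 by apply: entire1B => //; exact: entire1_cst.
have D20 z : D2 z = 0 -> E z1 = E z by move=> /eqP; rewrite subr_eq0 => /eqP.
have Dz1 : D z1 != 0 by apply: H3; lra.
have DN2 z : D2 z = 0 -> N2 z = 0.
  by move=> /D20 h; rewrite /N2 (Qcongr _ _ h)// subrr.
pose W := equot N2 D2.
have eW : entire1 W.
  apply: entire1_quot => // z D2z; split; first exact: DN2.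
  by rewrite dD2; apply: Es dE1; exact: D20.
have WE z : N2 z = W z * D2 z by apply: equotE.
have [B WB] : exists B, forall z, md (W z) <= B.
  have r32 : 0 < r3 / 2 by rewrite divr_gt0.
  have [dl dl0 om] := open_mapping eE (derP (eE z1)) dE1 r32.
  have [C1 HC1] := entire1_bnd z1 (r3 / 2) eW.
  have C10 : 0 <= C1 by apply: le_trans (md_ge0 _) (HC1 z1 _); rewrite subrr md0 ltW.
  pose K := C * (1 + md (E z1)) + md (Q z1).
  have K0 : 0 <= K by rewrite addr_ge0 ?md_ge0// mulr_ge0// addr_ge0// md_ge0.
  have C3 : 0 <= K / dl by rewrite divr_ge0// ltW.
  exists (C1 + (C + K / dl)) => z; apply: (cont_md_le (entire1_cont z eW)) => e e0.
  have [w we Ew] := avoid_value z eE (nE (E z1)) e0; exists w => //.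
  have D2w : D2 w != 0 by rewrite /D2 subr_eq0.
  case: (ltP (md (E w - E z1)) dl) => h.
    have [s sz Esw] := om _ h.
    have Ds : D s != 0.
      apply: H3; have -> : s - b = (s - z1) + (z1 - b) by ring.
      by apply: le_lt_trans (mdD _ _) _; lra.
    have -> : W w = W s.
      have D2s : D2 s != 0 by rewrite /D2 Esw.
      by rewrite /W /equot (negbTE D2w) (negbTE D2s) /N2 /D2 Esw (Qcongr _ _ Esw).
    have : md (W s) <= C1 by apply: HC1; rewrite ltW.
    lra.
  have : md (W w) <= C + K / dl; last lra.
  have m0 : 0 < md (D2 w) by rewrite md_gt0.
  rewrite /W /equot (negbTE D2w) mdM mdV ler_pdivrMr// mulrDl.
  have k1 : md (N2 w) <= C * (1 + md (E w)) + md (Q z1).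
    by apply: le_trans (mdB _ _) _; rewrite lerD2r.
  have k2 : C * (1 + md (E w)) <= C * (1 + (md (D2 w) + md (E z1))).
    by apply: ler_wpM2l => //; rewrite lerD2l; have := mdBD (E w) (E z1); rewrite /D2; lra.
  have k3 : K <= K / dl * md (D2 w) by rewrite mulrAC ler_pdivlMr// ler_wpM2l.
  by move: k3; rewrite {1}/K; lra.
have WC := liouville eW WB.
exists z0, (Q z1 - W 0 * E z1), (W 0).
have QL z : Q z = Q z1 - W 0 * E z1 + W 0 * E z.
  have : N2 z = W 0 * D2 z by rewrite WE WC.
  by rewrite /N2 /D2 => /eqP; rewrite subr_eq => /eqP ->; ring.
by split => z; rewrite -QL; [exact: QE | exact: Qn].
Qed.

End Rigidity.

(** * Periods of a nonconstant entire function *)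

Section Periods.
Variable R : realType.
Variable f : R[i] -> R[i].

Definition period (tau : R[i]) := forall x, f (x + tau) = f x.

Lemma period0 : period 0.
Proof. by move=> x; rewrite addr0. Qed.

Lemma periodD a b : period a -> period b -> period (a + b).
Proof. by move=> pa pb x; rewrite addrA pb pa. Qed.

Lemma periodN a : period a -> period (- a).
Proof. by move=> pa x; rewrite -(pa (x - a)) subrK. Qed.

Lemma periodB a b : period a -> period b -> period (a - b).
Proof. by move=> pa /periodN; exact: periodD. Qed.

Lemma periodZ a (k : int) : period a -> period (k%:~R * a).
Proof.
move=> pa; have pn n : period (n%:R * a).
  elim: n => [|n IH]; first by rewrite mul0r; exact: period0.
  by rewrite -natr1 mulrDl mul1r; exact: periodD.
case: k => n; first exact: pn.
rewrite NegzE mulrNz mulNr; apply: periodN; exact: pn.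
Qed.

Hypothesis ef : entire1 f.
Hypothesis fnc : ~ (forall z, f z = f 0).

Lemma period_discrete : exists2 dl : R, 0 < dl &
  forall tau, period tau -> md tau < dl -> tau = 0.
Proof.
have [s _ ds] := nonconst_der ef fnc (@ltr01 R).
have d0 : 0 < md (der f s) by rewrite md_gt0.
have [r r0 H] := (slopeP _ _ _ (@inj_id _)).1 (derP (ef s)) _ (divr_gt0 d0 (ltr0Sn R 1)).
exists r => // tau pt tr; apply/eqP; rewrite -md_eq0 eq_le md_ge0 andbT leNgt; apply/negP => t0.
have := H (s + tau); rewrite /= [s + tau - s]addrC addKr => /(_ tr).
rewrite pt subrr sub0r mdN mdM ler_pM2r//; lra.
Qed.

(** Two periods independent over the reals would bring every point into a bounded parallelogram, and
    [f] would be constant by Liouville's theorem. *)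
Lemma period_real tau tau' : tau != 0 -> period tau -> period tau' -> exists x : R, tau' = x%:C * tau.
Proof.
move=> t0 pt pt'; pose v := tau' / tau.
have vE : tau' = v * tau by rewrite divfK.
have [v0|v0] := eqVneq (complex.Im v) 0.
  exists (complex.Re v); rewrite vE; congr (_ * _).
  by move: (v) v0 => [a b] /= ->.
exfalso; apply: fnc.
have [M fM] := entire1_bnd 0 (md tau * (1 + `|complex.Im v|)) ef.
apply: (liouville ef (M := M)) => z.
pose w := z / tau; pose j := Num.floor (complex.Im w / complex.Im v).
pose w1 := w - j%:~R * v; pose k := Num.floor (complex.Re w1); pose w2 := w1 - k%:~R.
have zE : z = w2 * tau + j%:~R * tau' + k%:~R * tau.
  by rewrite vE /w2 /w1 /w; move: (v) => v1; field; exact: t0.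
have intC (m : int) : m%:~R = (m%:~R : R)%:C by rewrite rmorph_int.
rewrite zE (periodZ k pt) (periodZ j pt'); apply: fM; rewrite subr0 mdM mulrC ler_pM2l ?md_gt0//.
apply: le_trans (md_le _) _; apply: lerD.
  have /andP[] := mem_rg1_floor (complex.Re w1); rewrite -/k.
  have -> : complex.Re w2 = complex.Re w1 - k%:~R.
    by rewrite /w2 intC; case: (w1) => a b.
  by move=> h1 h2; rewrite ger0_norm; lra.
have -> : complex.Im w2 = complex.Im v * (complex.Im w / complex.Im v - j%:~R).
  rewrite /w2 /w1 !intC; case: (w) (v) v0 => a b [c d] /= v0; field; exact: v0.
rewrite normrM ler_piMr//.
have /andP[] := mem_rg1_floor (complex.Im w / complex.Im v); rewrite -/j.
by move=> h1 h2; rewrite ger0_norm; lra.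
Qed.

(** The generator is the least positive real multiple of [tau] that is a period. The infimum is
    attained: otherwise two multiples close to it would differ by a period shorter than
    [period_discrete] allows. Remainders modulo it vanish by minimality. *)
Lemma period_generator tau : tau != 0 -> period tau ->
  exists2 t0, t0 != 0 & forall t, period t <-> exists k : int, t = k%:~R * t0.
Proof.
move=> tn pt; have [dl dl0 disc] := period_discrete.
have m0 : 0 < md tau by rewrite md_gt0.
pose A := [set x : R | 0 < x /\ period (x%:C * tau)].
have A1 : A 1 by split; rewrite ?ltr01// rmorph1 mul1r.
have Alb : lbound A (dl / md tau).
  move=> x [x0 px]; rewrite leNgt; apply/negP => xd.
  have := disc _ px; rewrite mdM md_real gtr0_norm// -ltr_pdivlMr// => /(_ xd) /eqP.
  by rewrite mulf_eq0 (negbTE tn) orbF => /eqP/(@complexI R) x00; rewrite x00 ltxx in x0.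
have hinf : has_inf A by split; [exists 1 | exists (dl / md tau)].
set al := inf A.
have eta0 : 0 < dl / md tau by rewrite divr_gt0.
have al0 : 0 < al by apply: lt_le_trans eta0 _; apply: lb_le_inf => //; exists 1.
have alA : A al.
  have [x1 Ax1 x1l] := inf_adherent eta0 hinf; rewrite -/al in x1l.
  have [<- //|x1n] := eqVneq x1 al.
  have x1g : al < x1 by rewrite lt_neqAle eq_sym x1n /=; apply: ge_inf => //; case: hinf.
  have e0 : 0 < x1 - al by rewrite subr_gt0.
  have [x2 Ax2 x2l] := inf_adherent e0 hinf; rewrite -/al addrC subrK in x2l.
  have x2g : al <= x2 by apply: ge_inf => //; case: hinf.
  have A3 : A (x1 - x2).
    by split; [rewrite subr_gt0 | rewrite rmorphB mulrBl; apply: periodB; [case: Ax1 | case: Ax2]].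
  by have := Alb _ A3; lra.
exists (al%:C * tau).
  by rewrite mulf_neq0// -md_gt0 md_real normr_gt0 gt_eqF.
move=> t; split; last first.
  by move=> [k ->]; apply: periodZ; case: alA.
move=> ptt; have [x tE] := period_real tn pt ptt.
pose k := Num.floor (x / al); exists k; pose y := x - k%:~R * al.
have yE : t - k%:~R * (al%:C * tau) = y%:C * tau.
  by rewrite tE /y rmorphB rmorphM rmorph_int; ring.
have py : period (y%:C * tau) by rewrite -yE; apply: periodB => //; apply: periodZ; case: alA.
have /andP[] := mem_rg1_floor (x / al); rewrite -/k ler_pdivlMr// ltr_pdivrMr// mulrDl mul1r => h1 h2.
have y0 : y = 0.
  apply/eqP; rewrite eq_le [0 <= y]subr_ge0 h1 andbT leNgt; apply/negP => y0.
  have : al <= y by apply: ge_inf; [case: hinf | split].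
  by rewrite /y; lra.
by apply/eqP; rewrite -subr_eq0 yE y0 mul0r.
Qed.

End Periods.

(** * Entire functions whose generic fibres are orbits of affine maps *)

Section LineClass.
Variable R : realType.
Variables (f : R[i] -> R[i]) (l : nat).
Hypothesis l0 : (0 < l)%N.
Hypothesis ef : entire1 f.
Hypothesis fnc : ~ (forall z, f z = f 0).
Hypothesis fsym : forall s t, f s = f t -> der f s != 0 ->
  exists2 om, om ^+ l = 1 & forall x, f (t + om * x) = f (s + x).
Hypothesis fsimple : forall s t, f s = f t -> der f s != 0 -> der f t != 0.

Let sym om b := om ^+ l = 1 /\ forall x, f (om * x + b) = f x.

Let fsymb s t : f s = f t -> der f s != 0 -> exists om b, sym om b /\ t = om * s + b.
Proof.
move=> fst ds; have [ om o1 H] := fsym fst ds; exists om, (t - om * s); split; last by ring.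
by split => // x; rewrite -[in RHS](subrK s x) [in RHS]addrC -H; congr f; ring.
Qed.

Let om_neq0 om b : sym om b -> om != 0.
Proof. by move=> [ o1 _]; apply: contraTneq isT => o0; move/eqP: o1; rewrite o0 expr0n gtn_eqF// eq_sym oner_eq0. Qed.

Lemma closed_rootX (c : R[i]) m : (0 < m)%N -> exists y, y ^+ m = c.
Proof.
move=> m0; have := @solve_monicpoly R[i] m (fun i => if i == 0%N then c else 0) m0.
move=> [y yE]; exists y; rewrite yE (bigD1 (Ordinal m0)) //= expr0 mulr1 big1 ?addr0 => // i.
by rewrite -val_eqE /= => /negbTE ->; rewrite mul0r.
Qed.

Lemma rootsX_seq (c : R[i]) : c != 0 -> exists rs : seq R[i], forall x, (x \in rs) = (x ^+ l == c).
Proof.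
move=> c0; have [rs rsE] := closed_field_poly_normal ('X^l - c%:P : {poly R[i]}).
exists rs => x; have := root_prod_XsubC rs x.
have mon : lead_coef ('X^l - c%:P : {poly R[i]}) = 1 by apply/eqP; rewrite -monicE monicXnsubC.
rewrite mon scale1r in rsE; rewrite -rsE => <-.
by rewrite /root !hornerE ?hornerXn subr_eq0.
Qed.

(** Without translations the affine symmetries commute, so they share a fixed point [t1]. Their
    linear parts form a finite group of some order [m], which can only be that of all [m]-th roots
    of unity; the model with these fibres is [(z - t1) ^+ m]. *)
Lemma class_finite : (forall tau, period f tau -> tau = 0) ->
  exists m c b A, [/\ (0 < m)%N, c != 0 & forall z, f z = A + c * (z - b) ^+ m].
Proof.
move=> np.
have [t1 symE] : exists t1, forall om b, sym om b -> b = t1 - om * t1.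
  case: (pselect (exists om b, sym om b /\ om <> 1)) => [[ o0 [b0 [[ o01 H0] /eqP on1]]]|H].
    exists (b0 / (1 - o0)) => om b sb; have [ o1 Hb] := sb.
    have d0 : 1 - o0 != 0 by rewrite subr_eq0 eq_sym.
    have on0 := om_neq0 sb; have o0n0 := om_neq0 (conj o01 H0).
    (* This translation is the discrepancy between the two orders of composition of the two
       symmetries. *)
    have : period f (o0 * b + b0 - om * b0 - b).
      move=> y; pose x := (y - om * b0 - b) / (o0 * om).
      have e1 : y = om * (o0 * x + b0) + b by rewrite /x; field; rewrite on0 o0n0.
      have -> : y + (o0 * b + b0 - om * b0 - b) = o0 * (om * x + b) + b0.
        by rewrite /x; field; rewrite on0 o0n0.
      by rewrite H0 Hb [in RHS]e1 Hb H0.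
    move=> /np h; apply: (mulIf d0).
    have -> : (b0 / (1 - o0) - om * (b0 / (1 - o0))) * (1 - o0) = b0 - om * b0 by field.
    by apply/eqP; rewrite -subr_eq0 -oppr_eq0 -h; apply/eqP; ring.
  exists 0 => om b sb; rewrite mulr0 subr0; have om1 : om = 1.
    by apply: contrapT => o1; apply: H; exists om, b.
  by apply: np => x; case: sb => _ /(_ x); rewrite om1 mul1r.
have [rs rsP] := rootsX_seq (oner_neq0 R[i]).
pose S := undup [seq om <- rs | `[< sym om (t1 - om * t1) >]].
have SP om : reflect (sym om (t1 - om * t1)) (om \in S).
  rewrite mem_undup mem_filter rsP; apply: (iffP andP) => [[/asboolP//]|h].
  by split; [exact/asboolP | case: h => ->].
have S1 : 1 \in S.
  by apply/SP; split; [rewrite expr1n | move=> x; rewrite !mul1r subrr addr0].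
have Smul a b : a \in S -> b \in S -> a * b \in S.
  move=> /SP[a1 Ha] /SP[b1 Hb]; apply/SP; split; first by rewrite exprMn a1 b1 mulr1.
  move=> x; rewrite -[RHS]Hb -[RHS]Ha; congr f; ring.
pose m := size S.
have m0 : (0 < m)%N by rewrite /m; case: (S) S1.
have uS : uniq S by exact: undup_uniq.
have S0 om : om \in S -> om != 0 by move=> /SP/om_neq0.
have Sm om : om \in S -> om ^+ m = 1.
  move=> oS; have o0 := S0 _ oS.
  have pm : perm_eq [seq om * x | x <- S] S.
    apply: uniq_perm => //; first by rewrite map_inj_uniq//; exact: mulfI.
    have us : uniq [seq om * x | x <- S] by rewrite map_inj_uniq//; exact: mulfI.
    have sub : {subset [seq om * x | x <- S] <= S}.
      by move=> _ /mapP[x xS ->]; exact: Smul.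
    by have [] := uniq_min_size us sub; rewrite ?size_map.
  (* Lagrange's argument: multiplication by [om] permutes [S], so it multiplies the product of [S]
     both by [om ^+ m] and by 1. *)
  have : \prod_(x <- [seq om * x | x <- S]) x = \prod_(x <- S) x by exact: perm_big.
  rewrite big_map big_split /= big_const_seq count_predT iter_mulr_1 -/m.
  rewrite -[RHS]mul1r => /mulIf; apply.
  by rewrite prodf_seq_neq0; apply/allP => x xS /=; exact: S0.
(* Conversely, the [m] elements of [S] already exhaust the roots of ['X^m - 1]. *)
have mS om : om ^+ m = 1 -> om \in S.
  move=> o1; apply: contraT => oS.
  have := @max_poly_roots R[i] ('X^m - 1%:P) (om :: S).
  rewrite -size_poly_eq0 size_XnsubC// => /(_ isT).
  rewrite /= oS uS ltnn => /(_ _ isT); apply.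
  by rewrite /root !hornerE ?hornerXn o1 subrr eqxx; apply/allP => x /Sm x1; rewrite /root !hornerE ?hornerXn x1 subrr.
pose E z := (z - t1) ^+ m.
have dE z : cder E z (m%:R * (z - t1) ^+ m.-1).
  have := slopeX m (slopeB (slope_i id z) (slope_cst id t1 z)).
  by rewrite subr0 mulr1.
have eE : entire1 E by move=> z; eexists; exact: dE.
have m_n0 : m%:R != 0 :> R[i] by rewrite pnatr_eq0 -lt0n.
have [|||z0 [al [be [H1 H2]]]] := @rigidity R f E ef eE fnc _ _ fsimple.
- move=> s t Est; have [st|st] := eqVneq s t1.
    suff -> : t = s by [].
    move: Est; rewrite /E st subrr expr0n gtn_eqF//= => /esym/eqP.
    by rewrite expf_eq0 m0 subr_eq0 => /eqP.
  rewrite -subr_eq0 in st; pose om := (t - t1) / (s - t1).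
  have /mS/SP[_ Ho] : om ^+ m = 1 by rewrite expr_div_n -[X in X / _]Est divff// expf_neq0.
  by rewrite -(Ho s); congr f; rewrite /om; field.
- move=> s t fst ds; have [ om [b [sb ->]]] := fsymb fst ds.
  have bE := symE _ _ sb; have oS : om \in S by apply/SP; rewrite -bE.
  rewrite /E bE; have -> : om * s + (t1 - om * t1) - t1 = om * (s - t1) by ring.
  by rewrite exprMn (Sm _ oS) mul1r.
- move=> s t Est; rewrite !(der_eq (dE _)) !mulf_eq0 !negb_or m_n0 /=.
  apply: contra; rewrite !expf_eq0 => /andP[m1 /eqP t0]; rewrite m1 /=.
  by move/eqP: Est; rewrite /E t0 expr0n gtn_eqF//= expf_eq0 => /andP[].
(* The model [E] takes every value, so [al + be * E] would vanish somewhere if [be] were nonzero. *)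
have be0 : be = 0.
  apply/eqP/negP => /negP b0; have [y yE] := closed_rootX (- al / be) m0.
  have := H2 (t1 + y); rewrite /E [t1 + y - t1]addrC addKr yE mulrC divfK// subrr.
  by rewrite eqxx.
have al0 : al != 0 by have := H2 0; rewrite be0 mul0r addr0.
exists m, (al^-1), t1, (f z0 - E z0 / al); split => //; first by rewrite invr_eq0.
move=> z; have := H1 z; rewrite be0 mul0r addr0 -/(E z) => h.
have -> : al^-1 * E z = (E z - E z0) / al + E z0 / al by field.
by rewrite h; field.
Qed.

Lemma cexp_eq (t0 s t : R[i]) : t0 != 0 ->
  cexp (tpi R / t0 * s) = cexp (tpi R / t0 * t) <-> exists j : int, s - t = j%:~R * t0.
Proof.
move=> tn; have T0 := tpi_neq0 R; split.
  move=> h; have : cexp (tpi R / t0 * (s - t)) = 1 by rewrite mulrBr cexpB h divff// cexp_neq0.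
  move=> /cexp_eq1[j hj]; exists j; apply: (mulfI T0); apply: (mulIf (x := t0^-1)).
    by rewrite invr_eq0.
  have -> : tpi R * (s - t) * t0^-1 = tpi R / t0 * (s - t) by ring.
  by rewrite hj; field; exact: tn.
move=> [j hj]; have -> : tpi R / t0 * s = j%:~R * tpi R + tpi R / t0 * t.
  have -> : s = t + j%:~R * t0 by rewrite -hj; ring.
  by field.
by rewrite cexpD cexp_int mul1r.
Qed.

Lemma ccosh_surj (w : R[i]) : exists z, ccosh z = w.
Proof.
have [y yE] := closed_rootX (w ^+ 2 - 1) (isT : (0 < 2)%N).
have wy0 : w + y != 0.
  apply/negP => /eqP h; have : (w + y) * (w - y) = 1.
    have -> : (w + y) * (w - y) = w ^+ 2 - y ^+ 2 by ring.
    by rewrite yE; ring.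
  by rewrite h mul0r => /eqP; rewrite eq_sym oner_eq0.
have [z zE] := cexp_surj wy0; exists z.
rewrite /ccosh cexpN zE; have -> : (w + y)^-1 = w - y.
  apply: (mulfI wy0); rewrite divff//.
  have -> : (w + y) * (w - y) = w ^+ 2 - y ^+ 2 by ring.
  by rewrite yE; ring.
by field.
Qed.

Definition csinh (z : R[i]) := (cexp z - cexp (- z)) / 2%:R.

Lemma csinh_sqr z : csinh z ^+ 2 = ccosh z ^+ 2 - 1.
Proof. by rewrite /csinh /ccosh cexpN; field; exact: cexp_neq0. Qed.

Lemma slope_ccosh z : cder (@ccosh R) z (csinh z).
Proof.
have := slopeZ 2^-1 (slopeD (slope_cexp z) (slope_comp (slopeN (slope_i id z)) (slope_cexp (- z)))).
have -> : (fun s => 2^-1 * (cexp s + cexp (- id s))) = @ccosh R.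
  by apply/funext => s; rewrite mulrC.
by congr (slope _ _ _ _); rewrite /csinh; ring.
Qed.

Lemma ccosh_eq (u v : R[i]) : ccosh u = ccosh v -> cexp u = cexp v \/ cexp (u + v) = 1.
Proof.
rewrite /ccosh !cexpN => h; have u0 := cexp_neq0 u; have v0 := cexp_neq0 v.
have : (cexp u - cexp v) * (cexp (u + v) - 1) = 0.
  rewrite cexpD; have -> : (cexp u - cexp v) * (cexp u * cexp v - 1) =
    2%:R * (cexp u * cexp v) * ((cexp u + (cexp u)^-1) / 2%:R - (cexp v + (cexp v)^-1) / 2%:R).
    by field; rewrite u0 v0.
  by rewrite h subrr mulr0.
move/eqP; rewrite mulf_eq0 !subr_eq0 => /orP[/eqP|/eqP]; [by left | by right].
Qed.

(** The linear part of a symmetry maps the period group, generated by [t0], into itself; it is an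
    integer and a root of unity, hence 1 or -1. If only 1 occurs, the model is the exponential of
    period [t0]. A reflection [x |-> b0 - x] turns it into the hyperbolic cosine centred at
    [b0 / 2]. *)
Lemma class_periodic tau : tau != 0 -> period f tau ->
  (exists A B k, [/\ B != 0, k != 0 & forall z, f z = A + B * cexp (k * z)]) \/
  (exists A B k d, [/\ B != 0, k != 0 & forall z, f z = A + B * ccosh (k * z + d)]).
Proof.
move=> tn pt; have [t0 t0n perE] := period_generator ef fnc tn pt.
pose k := tpi R / t0; have k0 : k != 0 by rewrite mulf_neq0 ?invr_eq0// tpi_neq0.
have pt0 : period f t0 by apply/perE; exists 1; rewrite mul1r.
have om_sgn om b : sym om b -> om = 1 \/ om = -1.
  move=> sb; have [ o1 Ho] := sb; have on := om_neq0 sb.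
  have /perE[j oj] : period f (om * t0).
    move=> x; pose y := (x - b) / om.
    have xE : x = om * y + b by rewrite /y; field.
    have -> : x + om * t0 = om * (y + t0) + b by rewrite xE; ring.
    by rewrite Ho pt0 xE Ho.
  have oE : om = j%:~R by apply: (mulIf t0n).
  have : `|(j%:~R : R)| ^+ l = 1.
    by rewrite -md_real -mdX rmorph_int -oE o1 md1.
  move=> /eqP; rewrite pexprn_eq1// gtn_eqF//= => /eqP j1.
  have : (j%:~R : R) ^+ 2 = 1 by rewrite -real_normK ?num_real// j1 expr1n.
  move=> /eqP; rewrite sqrf_eq1 => /orP[/eqP h|/eqP h]; [left|right].
    by rewrite oE -(rmorph_int (real_complex R)) h rmorph1.
  by rewrite oE -(rmorph_int (real_complex R)) h rmorphN rmorph1.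
have sym1 b : sym 1 b -> exists j : int, b = j%:~R * t0.
  by move=> [_ H]; apply/perE => x; rewrite -[RHS]H mul1r.
case: (pselect (exists b, sym (-1) b)) => [[b0 sb0]|nb].
  right; pose t1 := b0 / 2%:R; pose E z := ccosh (k * (z - t1)).
  have dE z : cder E z (csinh (k * (z - t1)) * k).
    have h := slopeZ k (slopeB (slope_i id z) (slope_cst id t1 z)).
    by rewrite subr0 mulr1 in h; exact: slope_comp h (slope_ccosh _).
  have eE : entire1 E by move=> z; eexists; exact: dE.
  have [|||z0 [al [be [H1 H2]]]] := @rigidity R f E ef eE fnc _ _ fsimple.
  - move=> s t /ccosh_eq[|].
      move/(cexp_eq _ _ t0n) => [j hj].
      have -> : s = t + j%:~R * t0 by rewrite -hj; ring.
      exact: periodZ.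
    rewrite -mulrDr => h.
    have /(cexp_eq _ _ t0n)[j hj] : cexp (k * (s - t1 + (t - t1))) = cexp (k * 0).
      by rewrite mulr0 cexp0.
    have -> : s = (-1 * t + b0) + j%:~R * t0 by rewrite -hj /t1; field.
    by rewrite (periodZ j pt0); case: sb0 => _ ->.
  - move=> s t fst ds; have [ om [b [sb ->]]] := fsymb fst ds; rewrite /E.
    case: (om_sgn _ _ sb) => oE; rewrite oE in sb *.
      have [j ->] := sym1 _ sb; rewrite /ccosh !cexpN.
      suff -> : cexp (k * (1 * s + j%:~R * t0 - t1)) = cexp (k * (s - t1)) by [].
      by apply/(cexp_eq _ _ t0n); exists j; ring.
    have /perE[j hj] : period f (b - b0).
      move=> x; case: sb sb0 => _ H [_ H'].
      have -> : x + (b - b0) = -1 * (b0 - x) + b by ring.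
      by rewrite H -[LHS]H'; congr f; ring.
    rewrite /ccosh !cexpN.
    suff -> : cexp (k * (-1 * s + b - t1)) = (cexp (k * (s - t1)))^-1 by rewrite invrK addrC.
    rewrite -cexpN -(mulrN k); apply/(cexp_eq _ _ t0n); exists j; rewrite -hj /t1; by field.
  - move=> s t Est; rewrite !(der_eq (dE _)) => ds; apply: mulf_neq0 k0.
    apply: contra ds => /eqP h.
    have : csinh (k * (s - t1)) ^+ 2 = csinh (k * (t - t1)) ^+ 2.
      by rewrite !csinh_sqr; congr (_ ^+ 2 - 1); exact: Est.
    by rewrite h expr0n /= => /eqP; rewrite expf_eq0 /= => /eqP ->; rewrite mul0r.
  have be0 : be = 0.
    apply/eqP/negP => /negP b0'; have [y yE] := ccosh_surj (- al / be).
    have := H2 (t1 + y / k); rewrite /E.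
    have -> : k * (t1 + y / k - t1) = y by field.
    by rewrite yE mulrC divfK// subrr eqxx.
  have al0 : al != 0 by have := H2 0; rewrite be0 mul0r addr0.
  exists (f z0 - E z0 / al), al^-1, k, (- (k * t1)); split => //; first by rewrite invr_eq0.
  move=> z; have := H1 z; rewrite be0 mul0r addr0 -mulrBr -/(E z) => h.
  have -> : al^-1 * E z = (E z - E z0) / al + E z0 / al by field.
  by rewrite h; field.
left; pose E z := cexp (k * z).
have dE z : cder E z (cexp (k * z) * k).
  have h := slopeZ k (slope_i id z).
  by rewrite mulr1 in h; exact: slope_comp h (slope_cexp _).
have eE : entire1 E by move=> z; eexists; exact: dE.
have En z : E z != 0 by exact: cexp_neq0.
have [|||z0 [al [be [H1 H2]]]] := @rigidity R f E ef eE fnc _ _ fsimple.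
- move=> s t /(cexp_eq _ _ t0n) [j hj].
  have -> : s = t + j%:~R * t0 by rewrite -hj; ring.
  exact: periodZ.
- move=> s t fst ds; have [ om [b [sb ->]]] := fsymb fst ds; apply/(cexp_eq _ _ t0n).
  case: (om_sgn _ _ sb) => oE; rewrite oE in sb *; last by case: nb; exists b.
  by have [j ->] := sym1 _ sb; exists (- j); rewrite mulrNz; ring.
- by move=> s t _ _; rewrite (der_eq (dE _)) mulf_neq0// cexp_neq0.
(* The exponential omits only 0, so a nonvanishing [al + be * E] has [be = 0] or [al = 0]. In the
   second case [f] is affine in [1 / E], which is why [- k] appears. *)
have [be0|be0] := eqVneq be 0.
  have al0 : al != 0 by have := H2 0; rewrite be0 mul0r addr0.
  exists (f z0 - E z0 / al), al^-1, k; split => //; first by rewrite invr_eq0.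
  move=> z; have := H1 z; rewrite be0 mul0r addr0 -/(E z) => h.
  have -> : al^-1 * E z = (E z - E z0) / al + E z0 / al by field.
  by rewrite h; field.
have al0 : al = 0.
  apply/eqP/negP => /negP a0.
  have [|y yE] := @cexp_surj R (- al / be); first by rewrite mulf_neq0 ?oppr_eq0 ?invr_eq0.
  have := H2 (y / k); rewrite /E.
  have -> : k * (y / k) = y by field.
  by rewrite yE mulrC divfK// subrr eqxx.
exists (f z0 + be^-1), (- (E z0 / be)), (- k); rewrite !oppr_eq0 mulf_neq0 ?invr_eq0//.
split => // z; have := H1 z; rewrite al0 add0r => h.
rewrite (mulNr k) cexpN -/(E z); have Ez := En z.
have -> : f z = f z0 + (E z - E z0) / (be * E z) by rewrite h; field; rewrite be0 Ez.
by field; rewrite be0 Ez.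
Qed.

Lemma line_class :
  [\/ exists m c b A, [/\ (0 < m)%N, c != 0 & forall z, f z = A + c * (z - b) ^+ m],
      exists A B k, [/\ B != 0, k != 0 & forall z, f z = A + B * cexp (k * z)] |
      exists A B k d, [/\ B != 0, k != 0 & forall z, f z = A + B * ccosh (k * z + d)]].
Proof.
case: (pselect (exists tau, tau <> 0 /\ period f tau)) => [[tau [/eqP tn pt]]|H].
  by case: (class_periodic tn pt) => ?; [apply: Or32 | apply: Or33].
apply: Or31; apply: class_finite => tau pt; apply: contrapT => tn; apply: H.
by exists tau.
Qed.

End LineClass.

(** * Entire functions of several variables and meromorphic functions *)

Section Bridge.
Variable R : realType.

Lemma gt0_real (e : R[i]) : 0 < e -> exists2 r : R, 0 < r & e = r%:C.
Proof.
case: e => a b; rewrite ltcE /= => /andP[/eqP -> a0]; by exists a.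
Qed.

Lemma nbhs_md (V : normedModType R[i]) (x : V) (P : set V) :
  nbhs x P -> exists2 r : R, 0 < r & forall y, `|x - y| < r%:C -> P y.
Proof.
move=> /nbhs_ballP[e /= e0 H]; have [r r0 eE] := gt0_real e0.
exists r => // y yr; apply: H; rewrite -ball_normE /=; by rewrite eE.
Qed.

Lemma md_nbhs (V : normedModType R[i]) (x : V) (P : set V) (r : R) :
  0 < r -> (forall y, `|x - y| < r%:C -> P y) -> nbhs x P.
Proof.
move=> r0 H; apply/nbhs_ballP; exists r%:C => /=; first by rewrite ltcR.
by move=> y; rewrite -ball_normE /=; exact: H.
Qed.

Lemma derivable_slope (V : normedModType R[i]) (f : V -> R[i]) x v :
  derivable f x v -> cder (fun s : R[i] => f (x + s *: v)) 0 ('D_v f x).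
Proof.
move=> df; apply/slopeP => //= e e0.
have /cvgrPdist_lt/(_ e%:C) : (fun h : R[i] => h^-1 *: (f (h *: v + x) - f x)) @ 0^' --> 'D_v f x.
  by apply: df.
rewrite ltcR => /(_ e0) /nbhs_md [r r0 H]; exists r => // s; rewrite subr0 => sr.
rewrite scale0r addr0; have [->|s0] := eqVneq s 0.
  by rewrite scale0r addr0 subrr mulr0 subr0 md0 mulr0.
have := H s; rewrite sub0r normrN normE ltcR => /(_ sr s0).
rewrite normE ltcR [s *: v + x]addrC => /ltW h.
have -> : f (x + s *: v) - f x - 'D_v f x * s =
   - ('D_v f x - s^-1 *: (f (x + s *: v) - f x)) * s.
  by rewrite /GRing.scale /=; field.
by rewrite mdM mdN ler_wpM2r ?md_ge0.
Qed.

Lemma slope_shift (g : R[i] -> R[i]) z d : cder (fun s => g (z + s)) 0 d -> cder g z d.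
Proof.
move=> H; have H1 : cder (fun w => w - z) z 1.
  by have := slopeB (slope_i id z) (slope_cst id z z); rewrite subr0.
have := slope_comp H1 (F := fun s => g (z + s)) (b := d).
rewrite subrr mulr1 => /(_ H); congr (slope _ _ _ _).
by apply/funext => w; congr g; ring.
Qed.

Lemma derivable_cder (f : R[i] -> R[i]) z : derivable f z 1 -> exists d, cder f z d.
Proof.
move=> /derivable_slope H; eexists; apply: slope_shift.
move: H; congr (slope _ _ _ _); apply/funext => s.
by congr (f (_ + _)); rewrite /GRing.scale /= mulr1.
Qed.

Lemma cder_derivable (f : R[i] -> R[i]) z d : cder f z d -> derivable f z 1.
Proof.
move=> /(slopeP _ _ _ (@inj_id _)) H; apply/cvg_ex; exists d; apply/cvgrPdist_lt => e e0.
have [r r0 ->] := gt0_real e0; have [|r1 r10 {}H] := H (r / 2); first by rewrite divr_gt0.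
apply: (@md_nbhs _ 0 _ r1) => // h; rewrite sub0r normrN normE ltcR => hr h0.
have := H (h + z); rewrite /= addrK => /(_ hr) H1.
rewrite normE ltcR; have hn : 0 < md h by rewrite md_gt0.
rewrite /GRing.scale /= mulr1 mdBC.
have e1 : h^-1 * (f (h + z) - f z) - d = (f (h + z) - f z - d * h) / h by field.
rewrite e1 mdM mdV ltr_pdivrMr//; apply: le_lt_trans H1 _; rewrite ltr_pM2r//; lra.
Qed.

Lemma cder_differentiable (f : R[i] -> R[i]) z d : cder f z d -> differentiable f z.
Proof. by move=> /cder_derivable /derivable1_diffP. Qed.

Section Entire.
Variable n : nat.
Implicit Types (u : 'rV[R[i]]_n -> R[i]) (z v rho : 'rV[R[i]]_n).

Lemma entire_slice u z v : entire u -> forall s, cder (fun s : R[i] => u (z + s *: v)) s ('D_v u (z + s *: v)).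
Proof.
move=> eu s; apply: slope_shift.
have := derivable_slope (diff_derivable (v := v) (eu (z + s *: v))).
congr (slope _ _ _ _); apply/funext => t; congr u.
by rewrite scalerDl addrA.
Qed.

Lemma entire_slice1 u z v : entire u -> entire1 (fun s : R[i] => u (z + s *: v)).
Proof. by move=> eu s; eexists; exact: entire_slice. Qed.

Lemma sum_partial u z rho : entire u -> \sum_(j < n) rho 0 j * partial u j z = 'D_rho u z.
Proof.
move=> eu; rewrite deriveE; last exact: eu.
rewrite {2}(row_sum_delta rho) linear_sum; apply: eq_bigr => j _.
by rewrite linearZ /= /partial deriveE.
Qed.

Lemma entire_cst c : entire (fun _ : 'rV[R[i]]_n => c).
Proof. by move=> z; exact: differentiable_cst. Qed.

Lemma entireD u w : entire u -> entire w -> entire (fun z => u z + w z).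
Proof. by move=> eu ew z; exact: differentiableD. Qed.

Lemma entire_comp1 u (F : R[i] -> R[i]) : entire1 F -> entire u -> entire (fun z => F (u z)).
Proof.
move=> eF eu z; have [d Fd] := eF (u z).
exact: differentiable_comp (eu z) (cder_differentiable Fd).
Qed.

Lemma entireZ c u : entire u -> entire (fun z => c * u z).
Proof.
move=> eu; apply: (entire_comp1 (F := fun x => c * x)) => //.
by apply: entire1M; [exact: entire1_cst | exact: entire1_id].
Qed.

Lemma entire_sum (m : nat) (F : 'I_m -> 'rV[R[i]]_n -> R[i]) : (forall k, entire (F k)) ->
  entire (fun z => \sum_(k < m) F k z).
Proof.
move=> eF z; have -> : (fun z => \sum_(k < m) F k z) = \sum_(k < m) F k.
  by apply/funext => w; rewrite fct_sumE.
by apply: differentiable_sum => k; exact: eF.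
Qed.

Lemma entire_coord j : entire (fun z : 'rV[R[i]]_n => z 0 j).
Proof.
move=> z.
exact: differentiable_coord.
Qed.

Lemma entire_shift u v : entire u -> entire (fun z => u (z + v)).
Proof.
move=> eu z; apply: (@differentiable_comp _ _ _ _ (fun z => z + v) u); last exact: eu.
by apply: differentiableD.
Qed.

Definition lform (sigma z : 'rV[R[i]]_n) : R[i] := \sum_(j < n) sigma 0 j * z 0 j.

Lemma lformD sigma z v : lform sigma (z + v) = lform sigma z + lform sigma v.
Proof. by rewrite /lform -big_split /=; apply: eq_bigr => j _; rewrite mxE mulrDr. Qed.

Lemma lformZ sigma c z : lform sigma (c *: z) = c * lform sigma z.
Proof. by rewrite /lform big_distrr /=; apply: eq_bigr => j _; rewrite mxE; ring. Qed.

Lemma entire_lform sigma : entire (lform sigma).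
Proof. by apply: entire_sum => j; apply: entireZ; exact: entire_coord. Qed.

(** When [lform sigma rho = 1], this is the projection along [rho] onto the kernel of [sigma].
    Composing an entire function with it makes that function constant along [rho]. *)
Definition proj (rho sigma z : 'rV[R[i]]_n) := z - lform sigma z *: rho.

Lemma entire_proj u rho sigma : entire u -> entire (fun z => u (proj rho sigma z)).
Proof.
move=> eu z; apply: (@differentiable_comp _ _ _ _ (proj rho sigma) u); last exact: eu.
apply: differentiableB => //; apply: differentiableZl; exact: entire_lform.
Qed.

Lemma proj_shift rho sigma z t : lform sigma rho = 1 -> proj rho sigma (z + t *: rho) = proj rho sigma z.
Proof.
move=> h; rewrite /proj lformD lformZ h mulr1 scalerDl opprD addrACA subrr addr0 //.
Qed.

Lemma projK rho sigma z : proj rho sigma z + lform sigma z *: rho = z.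
Proof. by rewrite subrK. Qed.

Lemma invariant_partial u rho : entire u -> (forall z t, u (z + t *: rho) = u z) ->
  forall z, \sum_(j < n) rho 0 j * partial u j z = 0.
Proof.
move=> eu H z; rewrite sum_partial//.
have := entire_slice z rho eu 0; rewrite scale0r addr0.
have -> : (fun s : R[i] => u (z + s *: rho)) = (fun=> u z) by apply/funext => s.
move=> h; exact: cder_uniq h (slope_cst _ _ _).
Qed.

End Entire.

Section Mero.
Variables (p : R[i] -> option R[i]).
Hypothesis pm : meromorphic p.

Lemma mero_finite a v : p a = Some v -> exists2 r : R, 0 < r &
  holo_disc (finite_part p) a r /\ forall w, disc a r w -> p w = Some (finite_part p w).
Proof.
move=> pa; have := pm a; rewrite pa => /nbhs_md[r r0 H].
have G w : disc a (r / 2) w -> p w /\ derivable (finite_part p) w 1.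
  by move=> wr; apply: H; rewrite normE ltcR mdBC; move: wr; rewrite /disc; lra.
exists (r / 2); first by rewrite divr_gt0.
split => w /G [pw dw]; first exact: derivable_cder.
by rewrite /finite_part; case: (p w) pw.
Qed.

Lemma mero_pole a (M : R) : p a = None -> exists2 r : R, 0 < r & forall w, w != a -> md (w - a) < r ->
  p w = Some (finite_part p w) /\ M < md (finite_part p w).
Proof.
move=> pa; have := pm a; rewrite pa => -[/nbhs_md[r r0 H] poo].
have /nbhs_md[r1 r10 H1] : nbhs a [set w | w != a -> M%:C < `|finite_part p w|].
  apply: (poo [set x | M%:C < x]); exists M%:C; split => //.
  by rewrite complex_real.
exists (Num.min r r1); first by rewrite lt_min r0.
move=> w wa; rewrite lt_min => /andP[w1 w2]; split.
  have := H w; rewrite normE ltcR mdBC => /(_ w1 wa).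
  by rewrite /finite_part; case: (p w).
by have := H1 w; rewrite normE ltcR mdBC => /(_ w2 wa); rewrite normE ltcR.
Qed.

End Mero.

End Bridge.

(** * The polynomial attached to a solution on a line *)

Section Values.
Variable R : realType.
Variables (p : R[i] -> option R[i]) (l : nat).
Hypothesis pm : meromorphic p.
Hypothesis l0 : (0 < l)%N.
Implicit Types (f : R[i] -> R[i]) (a b c k d A B w : R[i]) (m h : nat).

Definition solution f := entire1 f /\ forall t, p (f t) = Some (der f t ^+ l).

Lemma solution_class f : solution f ->
  [\/ forall t, f t = f 0,
      exists m c b A, [/\ (0 < m)%N, c != 0 & forall z, f z = A + c * (z - b) ^+ m],
      exists A B k, [/\ B != 0, k != 0 & forall z, f z = A + B * cexp (k * z)] |
      exists A B k d, [/\ B != 0, k != 0 & forall z, f z = A + B * ccosh (k * z + d)]].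
Proof.
move=> [ef fp]; case: (pselect (forall t, f t = f 0)) => [H|nc]; first exact: Or41.
have fP z : der f z ^+ l = finite_part p (f z) by rewrite /finite_part fp.
have sy s t : f s = f t -> der f s != 0 ->
    exists2 om, om ^+ l = 1 & forall x, f (t + om * x) = f (s + x).
  move=> fst ds; apply: (same_value_symmetry ef l0 fP) => //.
  have [r r0 [hp _]] := mero_finite pm (fp s).
  exact: locally_lipschitz r0 hp.
have si s t : f s = f t -> der f s != 0 -> der f t != 0.
  move=> fst ds; have := expf_neq0 l ds.
  by rewrite fP fst -fP expf_eq0 l0.
by case: (line_class l0 ef nc sy si) => h; [apply: Or42 | apply: Or43 | apply: Or44].
Qed.

Lemma value_const f a : solution f -> (forall t, f t = a) -> p a = Some 0.
Proof.
move=> [ef fp] fa; have := fp 0; rewrite fa => ->; congr Some.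
have -> : der f 0 = 0.
  apply: der_eq; have -> : f = (fun=> a) by apply/funext.
  exact: slope_cst.
by rewrite expr0n gtn_eqF.
Qed.

(** The reading of [p (A + y ^+ m)] contains [y ^+ (m.-1 * l)], although it depends on [y ^+ m]
    only. Comparing [y = 1] with the root of unity [exp (2 pi i / m)] forces [m] to divide [l]. *)
Lemma value_power f m c b A : solution f -> (0 < m)%N -> c != 0 ->
  (forall z, f z = A + c * (z - b) ^+ m) ->
  (m %| l)%N /\ forall w, p w = Some (m%:R ^+ l * c ^+ (l %/ m) * (w - A) ^+ (l - l %/ m)).
Proof.
move=> [ef fp] m0 c0 fE; have [g gE] := closed_rootX c m0.
have g0 : g != 0 by apply: contraNneq c0 => g0; rewrite -gE g0 expr0n gtn_eqF.
have dE t : der f t = c * (m%:R * (t - b) ^+ m.-1).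
  apply: der_eq.
  have := slopeD (slope_cst id A t) (slopeZ c (slopeX m (slopeB (slope_i id t) (slope_cst id b t)))).
  rewrite subr0 mulr1 add0r; congr (slope _ _ _ _); by apply/funext => z; rewrite fE.
have pE y : p (A + y ^+ m) = Some ((m%:R * g) ^+ l * y ^+ (m.-1 * l)).
  have := fp (b + y / g); rewrite fE dE.
  have -> : b + y / g - b = y / g by ring.
  have -> : c * (y / g) ^+ m = y ^+ m by rewrite expr_div_n gE; field.
  move=> ->; congr Some; rewrite [in RHS]exprM -exprMn; congr (_ ^+ _).
  rewrite expr_div_n -gE -{1}(prednK m0) exprS; field.
  by rewrite expf_neq0.
have mn0 : m%:R != 0 :> R[i] by rewrite pnatr_eq0 -lt0n.
have ml : (m %| l)%N.
  pose ze := cexp (tpi R / m%:R).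
  have zem : ze ^+ m = 1.
    rewrite -cexpMn; have -> : m%:R * (tpi R / m%:R) = tpi R by field.
    exact: cexp_tpi.
  have h1 := pE ze; have h2 := pE 1; rewrite !expr1n mulr1 in h2; rewrite zem h2 in h1.
  have nz : (m%:R * g) ^+ l != 0 by rewrite expf_neq0// mulf_neq0.
  have : ze ^+ (m.-1 * l) = 1 by case: h1 => /esym h1; apply: (mulfI nz); rewrite mulr1.
  move=> H; have zel : ze ^+ l = 1.
    have : ze ^+ (m * l) = 1 by rewrite exprM zem expr1n.
    by rewrite -{1}(prednK m0) mulSn exprD H mulr1.
  move: zel; rewrite -cexpMn => /cexp_eq1[j hj].
  have lE : l%:R = j%:~R * m%:R :> R[i].
    apply: (mulIf (tpi_neq0 R)); have := congr1 (fun x => x * m%:R) hj => hj'.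
    rewrite mulrAC -hj'; by field.
  have : (l : int) = j * m.
    by apply: (@intr_inj R[i]); rewrite intrM; exact: lE.
  by move=> h; apply/dvdnP; exists `|j|%N; have := congr1 absz h; rewrite abszM.
split => // w; have [y yE] := closed_rootX (w - A) m0.
have := pE y; rewrite yE addrC subrK => ->; congr Some.
rewrite exprMn -yE -!exprM -gE -exprM.
have [q lE] := dvdnP ml; rewrite lE mulnK//.
have -> : (m * (q * m - q) = m.-1 * (q * m))%N.
  have -> : (q * m - q = q * m.-1)%N by rewrite -{1}(prednK m0) mulnS addKn.
  by ring.
by rewrite [(m * q)%N]mulnC.
Qed.

(** [f] omits [A], so [p A] cannot be read off it. The neighbouring values are bounded, which
    excludes a pole, and tend to 0, which gives the value by continuity. *)
Lemma value_exp f A B k : solution f -> B != 0 -> k != 0 ->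
  (forall z, f z = A + B * cexp (k * z)) -> forall w, p w = Some (k ^+ l * (w - A) ^+ l).
Proof.
move=> [ef fp] B0 k0 fE.
have dE t : der f t = B * (cexp (k * t) * k).
  apply: der_eq; have h := slopeZ k (slope_i id t).
  have := slopeD (slope_cst id A t) (slopeZ B (slope_comp h (slope_cexp _))).
  rewrite mulr1 add0r; congr (slope _ _ _ _); by apply/funext => z; rewrite fE.
have pE w : w != A -> p w = Some (k ^+ l * (w - A) ^+ l).
  move=> wA; have [|y yE] := @cexp_surj R ((w - A) / B).
    by rewrite mulf_neq0 ?invr_eq0 ?subr_eq0.
  have := fp (y / k); rewrite fE dE; have -> : k * (y / k) = y by field.
  rewrite yE; have -> : A + B * ((w - A) / B) = w by field.
  move=> ->; congr Some; rewrite -exprMn; congr (_ ^+ _); by field.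
move=> w; have [->|] := eqVneq w A; last exact: pE.
rewrite subrr expr0n gtn_eqF// mulr0.
pose K := md (k ^+ l); have K0 : 0 <= K by exact: md_ge0.
case pA : (p A) => [v|]; last first.
  have [r r0 H] := mero_pole pm K pA.
  have [|x xA] := @ball_pt R A (Num.min r 1); first by rewrite lt_min r0 ltr01.
  rewrite lt_min => /andP[xr x1]; have [] := H x xA xr; rewrite (pE _ xA) => -[<-].
  rewrite mdM -/K mdX => h; exfalso; move: h; apply/negP; rewrite -leNgt.
  by rewrite ler_piMr// exprn_ile1 ?md_ge0// ltW.
have [r r0 [hp hs]] := mero_finite pm pA.
have Ar : disc A r A by rewrite /disc subrr md0 ltW.
congr Some; have := hs A Ar; rewrite pA => -[->].
apply: md_small => e e0; have [d fd] := hp A Ar.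
have [|r1 r10 H1] := slope_cont fd (e := e / 2); first by rewrite divr_gt0.
have [|x xA] := @ball_pt R A (Num.min (Num.min r r1) (Num.min 1 (e / 2 / (K + 1)))).
  by rewrite !lt_min r0 r10 ltr01 !divr_gt0//; lra.
rewrite !lt_min => /andP[/andP[xr xr1] /andP[x1 xe]].
have := hs x (ltW xr); rewrite (pE _ xA) => -[hx].
have := H1 x xr1; rewrite -hx => h.
have : md (k ^+ l * (x - A) ^+ l) <= e / 2.
  rewrite mdM -/K mdX; rewrite ltr_pdivlMr in xe; last lra.
  have : md (x - A) ^+ l <= md (x - A).
    by rewrite -(prednK l0) exprS ler_piMr ?md_ge0// exprn_ile1 ?md_ge0// ltW.
  move=> h1; have : K * md (x - A) ^+ l <= K * md (x - A) by rewrite ler_wpM2l.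
  have := md_ge0 (x - A); lra.
have := mdBD (finite_part p A) (k ^+ l * (x - A) ^+ l).
by rewrite mdBC; lra.
Qed.

(** The points [y] and [- y] have the same hyperbolic cosine and opposite hyperbolic sines, while
    [p] sees only the former. An odd [l] would therefore force [csinh y = 0], which fails when
    [ccosh y] is 2. *)
Lemma value_cosh f A B k d : solution f -> B != 0 -> k != 0 ->
  (forall z, f z = A + B * ccosh (k * z + d)) -> ~~ odd l /\
  forall w, p w = Some (k ^+ l * ((w - (A + B)) ^+ (l %/ 2) * (w - (A - B)) ^+ (l %/ 2))).
Proof.
move=> [ef fp] B0 k0 fE.
have dE t : der f t = B * (csinh (k * t + d) * k).
  apply: der_eq; have h := slopeD (slopeZ k (slope_i id t)) (slope_cst id d t).
  have := slopeD (slope_cst id A t) (slopeZ B (slope_comp h (slope_ccosh _))).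
  rewrite addr0 mulr1 add0r; congr (slope _ _ _ _); by apply/funext => z; rewrite fE.
have pE y : p (A + B * ccosh y) = Some ((B * k) ^+ l * csinh y ^+ l).
  have := fp ((y - d) / k); rewrite fE dE.
  have -> : k * ((y - d) / k) + d = y by field.
  by move=> ->; congr Some; rewrite -exprMn; congr (_ ^+ _); ring.
have le : ~~ odd l.
  have [y yE] := ccosh_surj (2%:R : R[i]).
  have s0 : csinh y != 0.
    apply/negP => /eqP s0; have := csinh_sqr y; rewrite s0 yE expr0n /= => /eqP.
    by rewrite -natrX -(natrB _ (isT : (1 <= 4)%N)) eq_sym pnatr_eq0.
  have cN : ccosh (- y) = ccosh y by rewrite /ccosh opprK addrC.
  have sN : csinh (- y) = - csinh y by rewrite /csinh opprK; ring.
  have := pE (- y); rewrite cN pE sN => -[/eqP].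
  rewrite -subr_eq0 -mulrBr mulf_eq0 expf_eq0 mulf_eq0 (negbTE B0) (negbTE k0) andbF /=.
  rewrite [(- _) ^+ _]exprNn; case ol : (odd l) => //.
  rewrite -signr_odd ol expr1 mulN1r opprK -mulr2n mulrn_eq0 /= expf_eq0 (negbTE s0) andbF.
  by [].
split => // w; have [y yE] := ccosh_surj ((w - A) / B).
have := pE y; rewrite yE; have -> : A + B * ((w - A) / B) = w by field.
move=> ->; congr Some.
have lE : l = (2 * (l %/ 2))%N by rewrite mulnC divnK// dvdn2.
rewrite {1 2 3}lE !exprM -!exprMn; congr (_ ^+ _).
by rewrite exprMn csinh_sqr yE; field.
Qed.

End Values.

(** * Comparing the expressions of [p] read on two lines *)

Section Matching.
Variable R : realType.
Implicit Types (a c : R[i]).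

Lemma powfun_eq a a' c c' h h' : c != 0 -> c' != 0 ->
  (forall w, c * (w - a) ^+ h = c' * (w - a') ^+ h') ->
  [/\ h = h', c = c' & (0 < h)%N -> a = a'].
Proof.
move=> c0 c0' H.
case: h h' H => [|h] [|h'] H.
- by have := H 0; rewrite !expr0 !mulr1 => ->.
- by have := H a'; rewrite subrr expr0 exprS mul0r mulr0 mulr1 => c00; rewrite c00 eqxx in c0.
- by have := H a; rewrite subrr expr0 exprS mul0r mulr0 mulr1 => c00; rewrite -c00 eqxx in c0'.
have aa : a = a'.
  have := H a; rewrite subrr exprS mul0r mulr0 => /esym/eqP.
  by rewrite mulf_eq0 (negbTE c0') expf_eq0 /= subr_eq0 => /eqP.
subst a'; have cc : c = c' by have := H (a + 1); rewrite [a + 1 - a]addrC addKr !expr1n !mulr1.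
(* At distance 2 from the common zero the two sides are powers of 2, which separates the
   exponents. *)
subst c'; split => //; have := H (a + 2%:R).
rewrite [a + 2%:R - a]addrC addKr => /(mulfI c0).
rewrite -!natrX => /eqP; rewrite eqr_nat eqn_exp2l// => /eqP //.
Qed.

Lemma pow_neq_prodpow a a1 a2 c c' h g : (0 < g)%N -> a1 != a2 -> c != 0 ->
  ~ (forall w, c * (w - a) ^+ h = c' * ((w - a1) ^+ g * (w - a2) ^+ g)).
Proof.
move=> g0 a12 c0 H.
have := H a1; rewrite subrr expr0n gtn_eqF//= mul0r mulr0 => /eqP.
rewrite mulf_eq0 (negbTE c0) expf_eq0 subr_eq0 /= => /andP[_ /eqP a1E].
have := H a2; rewrite subrr expr0n gtn_eqF//= mulr0 mulr0 => /eqP.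
rewrite mulf_eq0 (negbTE c0) expf_eq0 subr_eq0 /= => /andP[_ /eqP a2E].
by rewrite a1E a2E eqxx in a12.
Qed.

Lemma prodpow_eq (A B A' B' c c' : R[i]) g : (0 < g)%N -> c != 0 -> c' != 0 -> B != 0 -> 
  (forall w, c * ((w - (A + B)) ^+ g * (w - (A - B)) ^+ g) =
     c' * ((w - (A' + B')) ^+ g * (w - (A' - B')) ^+ g)) ->
  [/\ c = c', A = A' & B' = B \/ B' = - B].
Proof.
move=> g0 c0 c0' B0 H.
have r1 : A + B = A' + B' \/ A + B = A' - B'.
  have := H (A + B); rewrite subrr expr0n gtn_eqF//= mul0r mulr0 => /esym/eqP.
  rewrite !mulf_eq0 (negbTE c0') !expf_eq0 !subr_eq0 /=.
  by move=> /orP[/andP[_ /eqP]|/andP[_ /eqP]]; [left|right].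
have r2 : A - B = A' + B' \/ A - B = A' - B'.
  have := H (A - B); rewrite subrr expr0n gtn_eqF//= mulr0 mulr0 => /esym/eqP.
  rewrite !mulf_eq0 (negbTE c0') !expf_eq0 !subr_eq0 /=.
  by move=> /orP[/andP[_ /eqP]|/andP[_ /eqP]]; [left|right].
have t0 : 2%:R != 0 :> R[i] by rewrite pnatr_eq0.
have BN : A + B <> A - B.
  move=> h; have : 2%:R * B = (A + B) - (A - B) by ring.
  rewrite h subrr.
  by move/eqP; rewrite mulf_eq0 (negbTE t0) (negbTE B0).
have AB : A = A' /\ (B' = B \/ B' = - B).
  case: r1 r2 => h1 [h2|h2].
  - by case: BN; rewrite h1 h2.
  - have e : A = A'.
      apply: (mulfI t0); have -> : 2%:R * A = (A + B) + (A - B) by ring.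
      by rewrite h1 h2; ring.
    by split => //; left; apply: (addrI A'); rewrite -h1 e.
  - have e : A = A'.
      apply: (mulfI t0); have -> : 2%:R * A = (A + B) + (A - B) by ring.
      by rewrite h1 h2; ring.
    by split => //; right; apply: (addrI A'); rewrite -h2 e.
  - by case: BN; rewrite h1 h2.
case: AB => AA BB; split => //; subst A'.
have := H (A + 2%:R * B).
have e1 : A + 2%:R * B - (A + B) = B by ring.
have e2 : A + 2%:R * B - (A - B) = 3%:R * B by ring.
have n3 : 3%:R != 0 :> R[i] by rewrite pnatr_eq0.
have nz : B ^+ g * (3%:R * B) ^+ g != 0 by rewrite !(mulf_neq0, expf_neq0).
case: BB => ->; rewrite ?opprK e1 e2; first by move/(mulIf nz).
by rewrite [X in _ = c' * X]mulrC => /(mulIf nz).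
Qed.

End Matching.

(** * Entire logarithms *)

Section Log.
Variable R : realType.

(** Where [cexp] differs from 1 by less than 1/2, the map [cexp z - z] is Lipschitz with constant
    1/2. Hence [cexp] is injective there and its inverse is Lipschitz with constant 2;
    [open_mapping] provides the preimages of the points near 1. *)
Lemma local_log : exists Lg : R[i] -> R[i], exists2 dl : R, 0 < dl & Lg 1 = 0 /\
  forall w, md (w - 1) < dl -> cexp (Lg w) = w /\ cder Lg w w^-1.
Proof.
have eE := @entire1_cexp R.
have h2 : 0 < 1 / 2 :> R by lra.
have [r r0 Hr] := entire1_cont 0 eE h2.
have inj a b : md a < r -> md b < r -> md (a - b) <= 2 * md (cexp a - cexp b).
  move=> ar br; have := @cmvt R (fun z => cexp z - z) (fun z => cexp z - 1) b a (1 / 2).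
  have seg (t : R) : 0 <= t <= 1 -> md (b + t%:C * (a - b)) < r.
    move=> /andP[t0 t1]; have -> : b + t%:C * (a - b) = (1 - t)%:C * b + t%:C * a.
      by rewrite rmorphB rmorph1; ring.
    apply: le_lt_trans (mdD _ _) _; rewrite !mdM !md_real !ger0_norm ?subr_ge0//.
    have [->|t1n] := eqVneq t 1; first by rewrite subrr mul0r add0r mul1r.
    have : (1 - t) * md b < (1 - t) * r by rewrite ltr_pM2l// subr_gt0 lt_neqAle t1n.
    have : t * md a <= t * r by rewrite ler_wpM2l// ltW.
    lra.
  move=> /(_ _ _)-H; have {H} : md (cexp a - a - (cexp b - b)) <= 1 / 2 * md (a - b).
    apply: H => t t01; first exact: slopeB (slope_cexp _) (slope_i _ _).
    have h : md (cexp (b + t%:C * (a - b)) - cexp 0) < 1 / 2.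
      by apply: Hr; rewrite /= subr0; exact: seg.
    by rewrite cexp0 in h; exact: ltW.
  move=> h; have := mdB (cexp a - cexp b) (cexp a - a - (cexp b - b)).
  have -> : cexp a - cexp b - (cexp a - a - (cexp b - b)) = a - b by ring.
  lra.
have [|dl dl0 om] := open_mapping eE (@slope_cexp0 R) _ r0; first exact: oner_neq0.
rewrite cexp0 in om.
have /choice[Lg HL] : forall w, exists x, md (w - 1) < dl -> md x < r /\ cexp x = w.
  move=> w; case: (ltP (md (w - 1)) dl) => h; last by exists 0.
  by have [x xr xw] := om w h; exists x => _; rewrite subr0 in xr.
have d11 : md (1 - 1 : R[i]) < dl by rewrite subrr md0.
exists Lg, dl => //; split.
  have [L1 L2] := HL 1 d11; have := @inj (Lg 1) 0 L1.
  rewrite md0 L2 cexp0 subr0 subrr md0 mulr0 => /(_ r0) h.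
  by apply/eqP; rewrite -md_eq0 eq_le h md_ge0.
move=> w0 w0d; have [x0r x0E] := HL w0 w0d; split => //.
have [h [hx ch hE]] := slope_cexp (Lg w0).
set r1 := dl - md (w0 - 1); have r10 : 0 < r1 by rewrite subr_gt0.
have near1 w : md (w - w0) < r1 -> md (w - 1) < dl.
  move=> wr; have -> : w - 1 = (w - w0) + (w0 - 1) by ring.
  by apply: le_lt_trans (mdD _ _) _; rewrite /r1 in wr; lra.
have cL : cont id Lg w0.
  move=> e e0; exists (Num.min r1 (e / 2)); first by rewrite lt_min r10 divr_gt0.
  move=> w; rewrite lt_min => /andP[/near1 wd we].
  have [wr wE] := HL w wd; apply: le_lt_trans (inj _ _ wr x0r) _.
  by rewrite wE x0E; rewrite /= in we; lra.
have ck : cont id (fun w => h (Lg w)) w0 by exact: cont_comp cL ch.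
have k0 : h (Lg w0) != 0 by rewrite hx cexp_neq0.
have [r2 r20 kr] := cont_neq0 ck k0.
(* The inverse function has the inverse slope factor: [h] is that of [cexp] at [Lg w0], evaluated
   along [Lg]. *)
apply: (@slope_local _ _ id (fun w => Lg w0 + (h (Lg w))^-1 * (w - w0)) _ _ _ (Num.min r1 r2)) => //.
- by rewrite lt_min r10.
- move=> w; rewrite lt_min => /andP[/near1 wd /kr kw].
  have [_ wE] := HL w wd; have := hE (Lg w); rewrite wE x0E => e.
  have -> : w - w0 = h (Lg w) * (Lg w - Lg w0) by rewrite {1}e /=; ring.
  by field.
- exists (fun w => (h (Lg w))^-1); split.
  + by rewrite hx x0E.
  + exact: contV.
  + by move=> w; rewrite subrr mulr0 addr0.
Qed.

Lemma differentiable_local (V : normedModType R[i]) (f g : V -> R[i]) x :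
  (\forall y \near x, f y = g y) -> differentiable g x -> differentiable f x.
Proof.
move=> fg dg; have fgx : f x = g x by exact: nbhs_singleton fg.
pose e := f - g.
have He : e \o shift x = cst (e x) + (\0 : V -> R[i]) +o_ 0 id.
  apply/eqaddoP => eps eps0.
  have : \forall y \near 0, f (y + x) = g (y + x).
    have [r r0 H] := nbhs_md fg; apply: (md_nbhs r0) => y yr; apply: H.
    by rewrite opprD addrCA subrr addr0 -[- y]add0r.
  apply: filterS => y /= fgy; rewrite /e !fctE /= fgy fgx !subrr !addr0 subrr normr0.
  by rewrite mulr_ge0// ltW.
have de : differentiable e x.
  have c0 : continuous (\0 : {linear V -> R[i]}) by move=> y; exact: cst_continuous.
  have E := diff_unique c0 He.
  by apply/diff_locallyP; rewrite E; split.
have -> : f = g + e by rewrite /e addrC subrK.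
exact: differentiableD.
Qed.

Lemma real_complex_continuous : continuous (real_complex R : R -> R[i]).
Proof.
move=> s; apply/cvgrPdist_lt => e /gt0_real[r r0 ->].
near=> t; rewrite -rmorphB normE ltcR md_real.
near: t; apply/nbhs_ballP; exists r => // y; rewrite /ball /=.
Unshelve. all: by end_near. Qed.

Variable n : nat.
Variable X : 'rV[R[i]]_n -> R[i].
Hypothesis eX : entire X.
Hypothesis X0 : forall z, X z != 0.

Let Y z (s : R[i]) := X (0 + s *: z).

(** Compactness of [[0, 1]] makes the comparison of neighbouring rays uniform, so that the ratio
    stays in the domain of the local logarithm along the whole ray. *)
Let tube z (dl : R) : 0 < dl -> \forall z' \near z, forall s : R, 0 <= s <= 1 ->
  md (Y z' s%:C / Y z s%:C - 1) < dl.
Proof.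
move=> dl0.
have nc : near_covering (`[0, 1]%classic : set R).
  by apply/compact_near_coveringP; exact: segment_compact.
have := nc _ (nbhs z) (fun z' s => md (Y z' s%:C / Y z s%:C - 1) < dl).
move=> /(_ _ _)-H; have {H} : \forall z' \near z, `[0, 1]%classic `<=` (fun s : R => md (Y z' s%:C / Y z s%:C - 1) < dl).
  apply: H => s _; set c := Y z s%:C.
  have c0 : 0 < md c by rewrite md_gt0; exact: X0.
  pose eta := Num.min (md c / 2) (dl * md c / 4).
  have eta0 : 0 < eta by rewrite lt_min !divr_gt0// mulr_gt0.
  have cX : nbhs (s%:C *: z) [set y | md (X y - c) < eta].
    have /cvgrPdist_lt/(_ eta%:C) : X @ (s%:C *: z) --> X (s%:C *: z).
      exact: differentiable_continuous.
    rewrite ltcR => /(_ eta0); apply: filterS => y; rewrite normE ltcR mdBC.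
    by rewrite /c /Y add0r.
  have c1 : (fun q : R * 'rV[R[i]]_n => q.1%:C : R[i]) @ nbhs (s, z) --> s%:C.
    apply: (cvg_comp fst (real_complex R)); last exact: real_complex_continuous.
    exact: cvg_fst.
  have c2 : (fun q : R * 'rV[R[i]]_n => q.2) @ nbhs (s, z) --> z by exact: cvg_snd.
  have cS := cvgZ c1 c2.
  have cS' := cvgZ c1 (cvg_cst z).
  have FF : Filter (nbhs (s, z)) by exact: nbhs_filter.
  have A1 := cS FF _ cX; have A2 := cS' FF FF _ cX.
  have := @filterI _ _ FF _ _ A1 A2; apply: filterS => -[t z'] [] /=; rewrite /Y !add0r => h1 h2.
  have b0 : md c / 2 <= md (X (t%:C *: z)).
    have e1 : eta <= md c / 2 by rewrite ge_min lexx.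
    by have := mdBD c (X (t%:C *: z)); rewrite mdBC; lra.
  have bn : X (t%:C *: z) != 0 by exact: X0.
  have -> : X (t%:C *: z') / X (t%:C *: z) - 1 =
     ((X (t%:C *: z') - c) - (X (t%:C *: z) - c)) / X (t%:C *: z) by field.
  rewrite mdM mdV ltr_pdivrMr ?md_gt0//; apply: le_lt_trans (mdB _ _) _.
  have e2 : eta <= dl * md c / 4 by rewrite ge_min lexx orbT.
  have : dl * (md c / 2) <= dl * md (X (t%:C *: z)) by rewrite ler_pM2l.
  lra.
apply: filterS => z' H s s01; apply: H; by rewrite /= in_itv.
Qed.

(** The logarithm is obtained on each ray from 0 by integrating [Y' / Y] from a common initial
    value. These choices are made ray by ray; differentiability in [z] comes from comparing
    neighbouring rays. *)
Lemma entire_log : exists2 La, entire La & forall z, cexp (La z) = X z.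
Proof.
have [Lg [dl dl0 [Lg1 LgP]]] := local_log.
have [phi0 phi0E] := cexp_surj (X0 0).
have eY z : entire1 (Y z) by exact: entire_slice1.
have Y0 z s : Y z s != 0 by exact: X0.
have dY z (s : R) : rder (fun s : R => Y z s%:C) s (der (Y z) s%:C).
  by apply: slope_restrict; apply: derP; exact: eY.
have /choice[phi Hphi] : forall z, exists ph : R -> R[i], ph 0 = phi0 /\
    forall s, 0 <= s <= 1 -> rder ph s (der (Y z) s%:C / Y z s%:C).
  move=> z; have [|G HG] := @antider R (fun s : R => der (Y z) s%:C / Y z s%:C) 0 1 ler01.
    move=> s _; apply: contM.
      by apply: (cont_comp (f := real_complex R)); [exact: cont_i | exact: der_cont].
    by apply: contV; [exact: Y0 | exact: slope_cont (dY _ _)].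
  exists (fun s => G s + (phi0 - G 0)); split; first by ring.
  move=> s s01; have := slopeD (HG s s01) (slope_cst (real_complex R) (phi0 - G 0) s).
  by rewrite addr0.
have i0 : (0 : R) <= (0 : R) <= 1 by rewrite lexx ler01.
have i1 : (0 : R) <= (1 : R) <= 1 by rewrite lexx ler01.
have cst01 (G : R -> R[i]) : (forall s : R, 0 <= s <= 1 -> rder G s 0) -> G 1 = G 0.
  move=> dG; apply/eqP; rewrite -subr_eq0 -md_eq0 eq_le md_ge0 andbT.
  have := @rmvt R G (fun=> 0) 0 1 0 ler01; rewrite mul0r; apply => //.
  by move=> x _; rewrite md0.
exists (fun z => phi z 1); last first.
  move=> z; have [p0 dp] := Hphi z.
  have := @cst01 (fun s => cexp (- phi z s) * Y z s%:C).
  rewrite /= p0 /Y rmorph0 rmorph1 scale0r scale1r add0r addr0 => H.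
  have {}H : cexp (- phi z 1) * X z = cexp (- phi0) * X 0.
    apply: H => s s01.
    have := slopeM (slope_comp (slopeN (dp s s01)) (slope_cexp _)) (dY z s).
    congr (slope _ _ _ _); field; exact: Y0.
  rewrite !cexpN phi0E mulVf// in H.
  by apply: (mulfI (x := (cexp (phi z 1))^-1)); rewrite ?invr_eq0 ?cexp_neq0// H mulVf// cexp_neq0.
move=> z.
(* Both sides, followed along the rays, start from [phi0] and have the same derivative. The
   right-hand side is visibly differentiable in [z']. *)
have near_eq : \forall z' \near z, phi z' 1 = phi z 1 + Lg (X z' / X z).
  have := tube z dl0; apply: filterS => z' Hz'.
  have [p0 dp] := Hphi z; have [p0' dp'] := Hphi z'.
  have := @cst01 (fun s => (phi z s + Lg (Y z' s%:C / Y z s%:C)) - phi z' s).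
  rewrite /= p0 p0' /Y rmorph0 rmorph1 !scale0r !scale1r !add0r divff// Lg1 addr0 subrr => H.
  apply/eqP; rewrite eq_sym -subr_eq0; apply/eqP; apply: H => s s01.
  have [_ dLg] := LgP _ (Hz' s s01).
  have dq := slopeM (dY z' s) (slopeV (f := fun s : R => Y z s%:C) (Y0 z s%:C) (dY z s)).
  have := slopeB (slopeD (dp s s01) (slope_comp dq dLg)) (dp' s s01).
  by congr (slope _ _ _ _); rewrite /Y; field; rewrite !X0.
apply: differentiable_local near_eq _.
have d1 : differentiable Lg (X z / X z).
  apply: cder_differentiable; apply: (proj2 (LgP _ _)).
  by rewrite divff// subrr md0.
have d2 : differentiable (fun z' => X z' / X z) z.
  have -> : (fun z' => X z' / X z) = (fun z' => (X z)^-1 * X z') by apply/funext => ?; rewrite mulrC.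
  exact: entireZ.
have := differentiableD (differentiable_cst (phi z 1) z) (differentiable_comp d2 d1).
exact.
Qed.

End Log.

(** * The four cases *)

Section ZeroSet.
Variable R : realType.
Variable p : R[i] -> option R[i].
Hypothesis pm : meromorphic p.

Let zero_near a := exists2 r : R, 0 < r & forall w, md (w - a) < r -> p w = Some 0.

(** The radius depends on [a] alone, which is what passing to a supremum requires. Near a pole the
    modulus of [p] exceeds 1, so no zero neighbourhood exists there. *)
Let zero_spread a : exists2 rho : R, 0 < rho & forall b b',
  md (b - a) < rho -> md (b' - a) < rho -> zero_near b -> zero_near b'.
Proof.
case pa : (p a) => [v|]; last first.
  have [r r0 H] := mero_pole pm 1 pa; exists r => // b b' br _ [r1 r10 Z].
  exfalso; have s0 : 0 < Num.min r1 (r - md (b - a)) by rewrite lt_min r10 subr_gt0.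
  have [x] : exists2 x, x != a & md (x - b) < Num.min r1 (r - md (b - a)).
    have [ba|ba] := eqVneq b a; first by have [x xb xs] := ball_pt b s0; exists x => //; rewrite -ba.
    by exists b => //; rewrite subrr md0.
  move=> xa; rewrite lt_min => /andP[x1 x2].
  have xr : md (x - a) < r.
    have -> : x - a = (x - b) + (b - a) by ring.
    by apply: le_lt_trans (mdD _ _) _; lra.
  have [px] := H x xa xr; rewrite (Z _ x1) in px; case: px => <-.
  by rewrite md0 ltr10.
have [r r0 [hp hs]] := mero_finite pm pa.
exists (r / 16); first by rewrite divr_gt0.
move=> b b' bb bb' [r1 r10 Z].
have hb : holo_disc (finite_part p) b (r / 2).
  move=> w; rewrite /disc => wb; apply: hp; rewrite /disc.
  have -> : w - a = (w - b) + (b - a) by ring.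
  by apply: le_trans (mdD _ _) _; lra.
have r2 : 0 < r / 2 by rewrite divr_gt0.
have ff : flat (finite_part p) b.
  by apply: (zero_flat r10) => w /Z pw; rewrite /finite_part pw.
exists (r / 16); first by rewrite divr_gt0.
move=> w wb; rewrite hs.
  congr Some; apply: (flat_zero r2 hb ff).
  have -> : w - b = (w - b') + ((b' - a) - (b - a)) by ring.
  by apply: le_trans (mdD _ _) _; have := mdB (b' - a) (b - a); lra.
rewrite /disc; have -> : w - a = (w - b') + (b' - a) by ring.
by apply: le_trans (mdD _ _) _; lra.
Qed.

(** Continuation along the segment from [a] to [w]: the supremum of the parameters reached is itself
    reached, and it can be exceeded unless it is 1. *)
Lemma meromorphic_zero a (r : R) : 0 < r -> (forall w, md (w - a) < r -> p w = Some 0) ->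
  forall w, p w = Some 0.
Proof.
move=> r0 Z w; have za : zero_near a by exists r.
pose g (t : R) := a + t%:C * (w - a).
have gd s t : md (g s - g t) = `|s - t| * md (w - a).
  have -> : g s - g t = (s - t)%:C * (w - a) by rewrite /g rmorphB; ring.
  by rewrite mdM md_real.
pose T := [set t : R | 0 <= t <= 1 /\ zero_near (g t)].
have T0 : T 0.
  by split; [rewrite lexx ler01 | rewrite /g rmorph0 mul0r addr0].
have ub : has_sup T by split; [exists 0 | exists 1 => t [/andP[]]].
set s := sup T.
have s0 : 0 <= s by apply: ub_le_sup => //; case: ub.
have s1 : s <= 1 by apply: ge_sup; [exists 0 | move=> t [/andP[]]].
have [rho rho0 spread] := zero_spread (g s).
pose e := rho / (md (w - a) + 1).
have m0 := md_ge0 (w - a).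
have e0 : 0 < e by rewrite divr_gt0//; lra.
have near t : `|t - s| < e -> md (g t - g s) < rho.
  move=> ts; rewrite gd; apply: (@le_lt_trans _ _ (`|t - s| * (md (w - a) + 1))).
    by rewrite ler_wpM2l// lerDl.
  by move: ts; rewrite /e ltr_pdivlMr//; lra.
have [t [t01 zt] ts] := sup_adherent e0 ub; rewrite -/s in ts.
have tles : t <= s by apply: ub_le_sup; [case: ub | split].
have zs t' : `|t' - s| < e -> zero_near (g t').
  move=> h; apply: spread zt; last exact: near.
  by apply: near; rewrite ler0_norm; lra.
have s_1 : s = 1.
  apply/eqP; rewrite eq_le s1 leNgt; apply/negP => s_lt.
  pose t' := Num.min 1 (s + e / 2).
  have tt : s < t' by rewrite lt_min s_lt ltrDl divr_gt0.
  have : t' <= s.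
    apply: ub_le_sup; first by case: ub.
    have t'1 : t' <= 1 by rewrite ge_min lexx.
    have t'e : t' <= s + e / 2 by rewrite ge_min lexx orbT.
    split; first by rewrite t'1 andbT (le_trans s0)// ltW.
    by apply: zs; rewrite gtr0_norm ?subr_gt0//; lra.
  by rewrite leNgt tt.
have [r1 r10 Z1] : zero_near (g 1) by apply: zs; rewrite s_1 subrr normr0.
by apply: Z1; rewrite /g rmorph1 mul1r [a + _]addrC subrK subrr md0.
Qed.

End ZeroSet.

(** * Finite choices and interpolation in several variables *)

Section Families.
Variables (R : realType) (n : nat).
Implicit Types (z w : 'rV[R[i]]_n).

(** Restriction to the complex line through [z] and [w] reduces this to one variable. The factor may
    depend on the pair, yet it vanishes at both points, which suffices to carry information from one
    to the other. *)
Lemma entire_prod0 (T : eqType) (rs : seq T) (W : T -> 'rV[R[i]]_n -> R[i]) :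
  (forall k, entire (W k)) -> (forall z, \prod_(k <- rs) W k z = 0) ->
  forall z w, exists2 k, k \in rs & W k z = 0 /\ W k w = 0.
Proof.
move=> eW H z w.
have [|k krs Hk] := @entire1_prod0 R T rs (fun k s => W k (z + s *: (w - z))) _ (fun s => H _).
  by move=> k; exact: entire_slice1.
exists k => //; split; first by have := Hk 0; rewrite scale0r addr0.
by have := Hk 1; rewrite scale1r addrC subrK.
Qed.

Lemma entire_finite_values (rs : seq R[i]) (f : 'rV[R[i]]_n -> R[i]) : entire f ->
  (forall z, f z \in rs) -> forall z w, f z = f w.
Proof.
move=> ef H z w; have [|z'|k _ [h1 h2]] := @entire_prod0 _ rs (fun k z => f z + - k) _ _ z w.
- by move=> k; apply: entireD => //; exact: entire_cst.
- apply/eqP; rewrite prodf_seq_eq0; apply/hasP; exists (f z') => //=.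
  by rewrite subrr.
by move/eqP: h1; move/eqP: h2; rewrite !subr_eq0 => /eqP -> /eqP ->.
Qed.

(** Vandermonde inversion at the nodes [0, ..., N - 1]. The coefficients of a polynomial in [t]
    become fixed linear combinations of its values; for [t |-> u (z + t *: rho)] they are therefore
    entire in [z]. *)
Lemma interpolation N : exists La : 'I_N -> 'I_N -> R[i], forall (a : 'I_N -> R[i]) j,
  a j = \sum_k La j k * \sum_i a i * (k : nat)%:R ^+ i.
Proof.
pose V := Vandermonde N (\row_(k < N) (k : nat)%:R : 'rV[R[i]]_N).
have uV : V \in unitmx.
  rewrite unitmxE unitfE det_Vandermonde.
  rewrite prodf_seq_neq0; apply/allP => i _ /=; rewrite prodf_seq_neq0; apply/allP => j _ /=.
  apply/implyP => ij; rewrite !mxE subr_eq0 eqr_nat neq_ltn ij ?orbT //.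
exists (fun j k => invmx V k j) => a j.
have : (\row_i a i) *m V *m invmx V = \row_i a i by rewrite mulmxK.
move=> /(congr1 (fun M : 'rV_N => M 0 j)); rewrite !mxE => <-.
apply: eq_bigr => k _; rewrite mulrC mxE; congr (_ * _).
by apply: eq_bigr => i _; rewrite !mxE.
Qed.

End Families.

(** * From lines to the whole space *)

Section Cases.
Variables (R : realType) (n l : nat) (rho : 'rV[R[i]]_n).
Variables (p : R[i] -> option R[i]) (u : 'rV[R[i]]_n -> R[i]).
Hypothesis l0 : (0 < l)%N.
Hypothesis rho0 : rho != 0.
Hypothesis pm : meromorphic p.
Hypothesis eu : entire u.
Hypothesis unc : ~ exists b : R[i], forall z, u z = b.
Hypothesis usol : forall z, p (u z) = Some ((\sum_(j < n) rho 0 j * partial u j z) ^+ l).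

Definition normal_form (q : {poly R[i]}) : Prop :=
  let h := (size q).-1 in
  exists (a1 a2 c0 r : R[i]) (sigma : 'rV[R[i]]_n) (Phi : 'rV[R[i]]_n -> R[i]),
    let L := fun z : 'rV[R[i]]_n => \sum_(j < n) sigma 0 j * z 0 j in
    [/\ a1 != a2, r ^+ l = c0, \sum_(j < n) rho 0 j * sigma 0 j = 1, entire Phi &
        forall z, \sum_(j < n) rho 0 j * partial Phi j z = 0] /\
    [\/ (forall z, u z = r * L z + Phi z) /\ h = 0%N /\ q = c0%:P,
        (forall z, u z =
           ((l - h)%:R / l%:R * r * L z + Phi z) ^+ (l %/ (l - h)) + a1) /\
        (h < l)%N /\ (l - h %| l)%N /\ q = c0 *: ('X - a1%:P) ^+ h,
        (forall z, u z = Phi z * cexp (r * L z) + a1) /\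
        h = l /\ q = c0 *: ('X - a1%:P) ^+ l |
        (forall z, u z =
           (a1 - a2) / 2%:R * ccosh (r * L z + Phi z) + (a1 + a2) / 2%:R) /\
        h = l /\ ~~ odd l /\
        q = c0 *: (('X - a1%:P) ^+ (l %/ 2) * ('X - a2%:P) ^+ (l %/ 2))].

Let result := exists q : {poly R[i]}, (forall w, p w = Some q.[w]) /\ normal_form q.

Let line z (t : R[i]) := u (z + t *: rho).

Let line_sol z : solution p l (line z).
Proof.
split; first exact: entire_slice1.
move=> t; rewrite (der_eq (entire_slice z rho eu t)) -sum_partial//.
exact: usol.
Qed.

Let line0 z : line z 0 = u z.
Proof. by rewrite /line scale0r addr0. Qed.

Let entire_line t : entire (fun z => line z t).
Proof. exact: entire_shift. Qed.

Lemma dual_form : exists sigma : 'rV[R[i]]_n, \sum_(j < n) rho 0 j * sigma 0 j = 1 /\ lform sigma rho = 1.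
Proof.
have /rV0Pn[j rj] := rho0; pose sigma : 'rV[R[i]]_n := (rho 0 j)^-1 *: delta_mx 0 j.
have e : \sum_(k < n) rho 0 k * sigma 0 k = 1.
  rewrite (bigD1 j)//= !mxE !eqxx mulr1 divff// big1 ?addr0// => k /negbTE kj.
  by rewrite !mxE kj andbF mulr0 mulr0.
exists sigma; split => //; rewrite -[RHS]e; apply: eq_bigr => k _; exact: mulrC.
Qed.

Lemma proj_entire (Psi : 'rV[R[i]]_n -> R[i]) sigma : lform sigma rho = 1 -> entire Psi ->
  entire (fun z => Psi (proj rho sigma z)) /\
  forall z, \sum_(j < n) rho 0 j * partial (fun z => Psi (proj rho sigma z)) j z = 0.
Proof.
move=> s1 eP; have e := entire_proj rho sigma eP; split => //.
by apply: invariant_partial => // z t; rewrite proj_shift.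
Qed.

(** Here [p] is known to vanish on the range of [u] only. That range contains a disc, by
    [open_mapping] on a complex line where [u] is not constant, and [meromorphic_zero] does the
    rest; then [Phi] is [u] itself. *)
Lemma case_zero : (forall z t, line z t = u z) -> result.
Proof.
move=> H.
have pu z : p (u z) = Some 0.
  by apply: (value_const l0 (line_sol z)) => t; exact: H.
have [z1 [z2 z12]] : exists z1 z2, u z1 <> u z2.
  apply: contrapT => h; apply: unc; exists (u 0) => z; apply: contrapT => hz.
  by apply: h; exists z, 0.
pose k (s : R[i]) := u (z1 + s *: (z2 - z1)).
have ek : entire1 k by exact: entire_slice1.
have nk : ~ forall s, k s = k 0.
  by move=> /(_ 1); rewrite /k scale1r scale0r addr0 addrC subrK => /esym.
have [s _ ds] := nonconst_der ek nk (@ltr01 R).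
have [dl dl0 om] := open_mapping ek (derP (ek s)) ds ltr01.
have pz : forall w, p w = Some 0.
  by apply: (meromorphic_zero pm dl0) => y /om[x _ <-]; exact: pu.
exists 0; split; first by move=> w; rewrite horner0.
rewrite /normal_form size_poly0.
have [sigma [s1 _]] := dual_form.
exists 0, 1, 0, 0, sigma, u; split.
  split => //; first by rewrite eq_sym oner_eq0.
    by rewrite expr0n gtn_eqF.
  by apply: invariant_partial => // z t; exact: H.
by apply: Or41; split => [z|]; rewrite ?mul0r ?add0r.
Qed.

Lemma case_power z0 m c b A : (0 < m)%N -> c != 0 ->
  (forall t, line z0 t = A + c * (t - b) ^+ m) -> result.
Proof.
move=> m0 c0 H0; have [ml pE] := value_power (line_sol z0) m0 c0 H0.
set g := (l %/ m)%N in pE; have lE : l = (g * m)%N by rewrite divnK.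
have g0 : (0 < g)%N by move: l0; rewrite lE muln_gt0 => /andP[].
have gl : (g <= l)%N by rewrite lE leq_pmulr.
have mn0 k : (0 < k)%N -> k%:R != 0 :> R[i] by rewrite pnatr_eq0 -lt0n.
pose C0 := m%:R ^+ l * c ^+ g.
have C00 : C0 != 0 by rewrite mulf_neq0// expf_neq0// mn0.
(* A constant line sits at a zero of [p], hence at [A]. On the other lines [p] determines [m] and
   the [g]-th power of the leading coefficient. *)
have lines z : (forall t, line z t = A) \/
    exists c' b', c' ^+ g = c ^+ g /\ forall t, line z t = A + c' * (t - b') ^+ m.
  case: (solution_class pm l0 (line_sol z)) => [Hc|[m' [c' [b' [A' [m0' c0' H']]]]]|[A' [B' [k' [B0 k0 H']]]]|[A' [B' [k' [d' [B0 k0 H']]]]]].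
  - left=> t; rewrite Hc; have := value_const l0 (line_sol z) Hc; rewrite pE => -[/eqP].
    rewrite mulf_eq0 (negbTE C00) expf_eq0 subr_eq0 => /andP[_ /eqP ->]//.
  - right; have [ml' pE'] := value_power (line_sol z) m0' c0' H'.
    have C00' : m'%:R ^+ l * c' ^+ (l %/ m') != 0 :> R[i].
      by rewrite mulf_neq0// expf_neq0// mn0.
    have [|hh cc AA] := @powfun_eq R A A' C0 _ (l - g) (l - l %/ m') C00 C00'.
      by move=> w; have := pE w; rewrite pE' => -[].
    have gE : g = (l %/ m')%N.
      by have := leq_div l m'; lia.
    have mE : m = m'.
      by apply/eqP; rewrite -(eqn_pmul2l g0) -lE gE divnK.
    subst m'; move: cc; rewrite /C0 -gE => /(mulfI (expf_neq0 l (mn0 _ m0))) cg.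
    have [hz|hp] := posnP (l - g)%N; last first.
      by exists c', b'; split => // t; rewrite H' AA.
    (* When the exponent of [p] is 0, [p] is constant and does not determine [A']; but then [m = 1],
       and the difference [A' - A] is absorbed by the translation [b']. *)
    have m1 : m = 1%N.
      apply/eqP; rewrite -(eqn_pmul2l g0) muln1 -lE; lia.
    exists c', (b' - (A' - A) / c'); split => // t; rewrite H' m1 !expr1; field.
    exact: c0'.
  - have pE' := value_exp pm l0 (line_sol z) B0 k0 H'.
    have [||hh _ _] := @powfun_eq R A A' C0 (k' ^+ l) (l - g) l C00; first exact: expf_neq0.
      by move=> w; have := pE w; rewrite pE' => -[].
    by lia.
  - have [lo pE'] := value_cosh (line_sol z) B0 k0 H'; exfalso.
    apply: (@pow_neq_prodpow R A (A' + B') (A' - B') C0 (k' ^+ l) (l - g) (l %/ 2)) => //.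
    + by rewrite divn_gt0//; case: (l) l0 lo => [|[|]].
    + rewrite -subr_eq0; have -> : A' + B' - (A' - B') = 2%:R * B' by ring.
      by rewrite mulf_neq0// mn0.
    + by move=> w; have := pE w; rewrite pE' => -[].
have [La LaP] := interpolation R m.+1.
pose ex z j := \sum_(k < m.+1) La j k * (line z (k : nat)%:R + - A).
have eex j : entire (fun z => ex z j).
  apply: entire_sum => k; apply: entireZ; apply: entireD; last exact: entire_cst.
  exact: entire_line.
have exE z c' b' j : (forall t, line z t = A + c' * (t - b') ^+ m) ->
    ex z j = c' * ((- b') ^+ (m - j) *+ 'C(m, j)).
  move=> H; rewrite (LaP (fun j : 'I_m.+1 => c' * ((- b') ^+ (m - j) *+ 'C(m, j))) j).
  apply: eq_bigr => k _; congr (_ * _); rewrite H addrC addKr [_ - b']addrC exprDn big_distrr /=.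
  by apply: eq_bigr => i _; rewrite -mulrA mulrnAl.
have lead z c' b' : (forall t, line z t = A + c' * (t - b') ^+ m) -> ex z ord_max = c'.
  by move=> H; rewrite (exE _ _ _ _ H) subnn expr0 binn mulr1.
have lead0 := lead _ _ _ H0.
have [rs rsP] := rootsX_seq g0 (expf_neq0 g c0).
(* The value 0 is added to the list for the constant lines. Being entire with finitely many values,
   the coefficient is everywhere [c], and constant lines are excluded at the same time. *)
have leadc z : ex z ord_max = c.
  rewrite -lead0; apply: (entire_finite_values (rs := 0 :: rs) (eex ord_max)) => w.
  rewrite inE; have [Hw|[c' [b' [cg Hw]]]] := lines w.
    by apply/orP; left; rewrite /ex big1// => k _; rewrite Hw subrr mulr0.
  by apply/orP; right; rewrite (lead _ _ _ Hw) rsP cg.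
have lines' z : exists b', forall t, line z t = A + c * (t - b') ^+ m.
  have [Hw|[c' [b' [cg Hw]]]] := lines z.
    have := leadc z; rewrite /ex big1 => [c00|k _]; last by rewrite Hw subrr mulr0.
    by rewrite -c00 eqxx in c0.
  by exists b' => t; rewrite Hw -(lead _ _ _ Hw) leadc.
have [ga gaE] := closed_rootX c m0.
have pm1 : (m.-1 < m.+1)%N by rewrite prednK.
(* The coefficient of degree [m.-1] is [- m c b']; the scaling turns it into [- ga b'], so that
   [c (t - b')^m] becomes [(ga t + Psi z)^m]. *)
pose Psi z := ga / (c * m%:R) * ex z (Ordinal pm1).
have ePsi : entire Psi by apply: entireZ.
have PsiE z t : line z t = (ga * t + Psi z) ^+ m + A.
  have [b' Hb] := lines' z; rewrite Hb /Psi (exE _ _ _ _ Hb) /=.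
  have -> : (m - m.-1 = 1)%N by rewrite -subn1 subKn.
  have -> : 'C(m, m.-1) = m by rewrite -{1}(prednK m0) binSn prednK.
  rewrite expr1 -[(- b') *+ m]mulr_natr.
  have -> : ga * t + ga / (c * m%:R) * (c * (- b' * m%:R)) = ga * (t - b').
    by field; rewrite mn0// c0.
  by rewrite exprMn gaE addrC.
have [sigma [s1 s2]] := dual_form.
have [ePhi dPhi] := proj_entire s2 ePsi.
have lh : (l - (l - g) = g)%N by rewrite subKn.
have sq : (size (C0 *: ('X - A%:P) ^+ (l - g))).-1 = (l - g)%N.
  by rewrite size_scale// size_exp_XsubC.
exists (C0 *: ('X - A%:P) ^+ (l - g)); split.
  by move=> w; rewrite pE hornerZ horner_exp hornerXsubC.
(* With exponent [l - g] the prefactor in the formula is [g / l = 1 / m], hence the root [m ga]. The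
   value [A + 1] only has to differ from [A]. *)
rewrite /normal_form sq; exists A, (A + 1), C0, (m%:R * ga), sigma, (fun z => Psi (proj rho sigma z)).
split.
  split => //.
    by rewrite -subr_eq0 opprD addrA subrr sub0r oppr_eq0 oner_eq0.
  by rewrite exprMn {2}lE mulnC exprM gaE.
apply: Or42; rewrite lh; split.
  move=> z; rewrite -{1}(projK rho sigma z) -/(line _ _) PsiE.
  have -> : (l %/ g = m)%N by rewrite lE mulKn.
  have -> // : g%:R / l%:R * (m%:R * ga) = ga.
  by rewrite lE natrM; field; rewrite !mn0.
by split; [lia | split => //; rewrite lE dvdn_mulr].
Qed.

Lemma case_exp z0 A B k : B != 0 -> k != 0 ->
  (forall t, line z0 t = A + B * cexp (k * t)) -> result.
Proof.
move=> B0 k0 H0; have pE := value_exp pm l0 (line_sol z0) B0 k0 H0.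
pose C0 := k ^+ l; have C00 : C0 != 0 by rewrite expf_neq0.
have mn0 j : (0 < j)%N -> j%:R != 0 :> R[i] by rewrite pnatr_eq0 -lt0n.
(* On a constant line [u z = A], and both sides vanish whatever the root; [k] serves. *)
have lines z : exists2 k', k' ^+ l = C0 & forall t, line z t - A = (u z - A) * cexp (k' * t).
  case: (solution_class pm l0 (line_sol z)) => [Hc|[m' [c' [b' [A' [m0' c0' H']]]]]|[A' [B' [k' [B0' k0' H']]]]|[A' [B' [k' [d' [B0' k0' H']]]]]].
  - exists k => // t; have := value_const l0 (line_sol z) Hc; rewrite pE => -[/eqP].
    rewrite mulf_eq0 (negbTE C00) expf_eq0 subr_eq0 => /andP[_ /eqP h].
    by rewrite Hc -line0 h subrr mul0r.
  - have [ml' pE'] := value_power (line_sol z) m0' c0' H'.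
    have C00' : m'%:R ^+ l * c' ^+ (l %/ m') != 0 :> R[i].
      by rewrite mulf_neq0// expf_neq0// mn0.
    have [|hh _ _] := @powfun_eq R A A' C0 _ l (l - l %/ m') C00 C00'.
      by move=> w; have := pE w; rewrite pE' => -[].
    have : (0 < l %/ m')%N by rewrite divn_gt0// dvdn_leq.
    by lia.
  - have pE' := value_exp pm l0 (line_sol z) B0' k0' H'.
    have [||_ cc AA] := @powfun_eq R A A' C0 (k' ^+ l) l l C00; first exact: expf_neq0.
      by move=> w; have := pE w; rewrite pE' => -[].
    exists k' => // t; rewrite H' -line0 H' (AA l0) mulr0 cexp0; ring.
  - have [lo pE'] := value_cosh (line_sol z) B0' k0' H'; exfalso.
    apply: (@pow_neq_prodpow R A (A' + B') (A' - B') C0 (k' ^+ l) l (l %/ 2)) => //.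
    + by rewrite divn_gt0//; case: (l) l0 lo => [|[|]].
    + rewrite -subr_eq0; have -> : A' + B' - (A' - B') = 2%:R * B' by ring.
      by rewrite mulf_neq0// mn0.
    + by move=> w; have := pE w; rewrite pE' => -[].
pose v z := u z + - A.
have ev : entire v by apply: entireD => //; exact: entire_cst.
have v0 : v z0 != 0 by rewrite /v -line0 H0 mulr0 cexp0 mulr1 addrC addKr.
have v0t t : line z0 t - A = v z0 * cexp (k * t).
  by rewrite /v -line0 !H0 mulr0 cexp0; ring.
have [rs rsP] := rootsX_seq l0 C00.
(* For fixed [t] one root [k'] serves both [z0] and [z]. It may depend on [t] and [z], but since
   [v z0] is nonzero, [cexp (k' * t)] equals [cexp (k * t)]. *)
have vE z t : line z t - A = v z * cexp (k * t).
  have [|z'|k' _ [h1 h2]] := @entire_prod0 R n _ rs (fun k' z => line z t + - A + - cexp (k' * t) * v z) _ _ z0 z.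
  - move=> k'; apply: entireD; last exact: entireZ.
    by apply: entireD; [exact: entire_line | exact: entire_cst].
  - have [k' kE Hk] := lines z'; apply/eqP; rewrite prodf_seq_eq0; apply/hasP.
    exists k' => /=; first by rewrite rsP kE.
    by rewrite Hk /v; apply/eqP; ring.
  move/eqP: h1; rewrite mulNr subr_eq0 v0t mulrC => /eqP/(mulIf v0) ek.
  by move/eqP: h2; rewrite mulNr subr_eq0 -ek mulrC => /eqP.
have [sigma [s1 s2]] := dual_form.
have [ePhi dPhi] := proj_entire s2 ev.
have sq : (size (C0 *: ('X - A%:P) ^+ l)).-1 = l.
  by rewrite size_scale// size_exp_XsubC.
exists (C0 *: ('X - A%:P) ^+ l); split.
  by move=> w; rewrite pE hornerZ horner_exp hornerXsubC.
rewrite /normal_form sq; exists A, (A + 1), C0, k, sigma, (fun z => v (proj rho sigma z)).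
split.
  split => //.
  by rewrite -subr_eq0 opprD addrA subrr sub0r oppr_eq0 oner_eq0.
apply: Or43; split => // z.
by rewrite -vE /line projK subrK.
Qed.

Lemma ccosh_nonconst (k d c : R[i]) : k != 0 -> ~ forall t, ccosh (k * t + d) = c.
Proof.
move=> k0 H; have [y yE] := ccosh_surj (c + 1); have := H ((y - d) / k).
have -> : k * ((y - d) / k) + d = y by field.
rewrite yE => /eqP; rewrite -subr_eq0 [c + 1]addrC addrK oner_eq0 //.
Qed.

Lemma cexp_scale_inj (a b : R[i]) : (forall t, cexp (a * t) = cexp (b * t)) -> a = b.
Proof.
move=> H; have d (c : R[i]) : cder (fun t => cexp (c * t)) 0 c.
  have := slope_comp (slopeZ c (slope_i id 0)) (slope_cexp _).
  by rewrite /= mulr0 cexp0 mul1r mulr1.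
have da := d a; have e : (fun t => cexp (a * t)) = (fun t => cexp (b * t)) by exact/funext.
by rewrite e in da; exact: cder_uniq da (d b).
Qed.

Lemma entire1_ccosh (k d : R[i]) : entire1 (fun t => ccosh (k * t + d)).
Proof.
apply: (entire1_comp (f := @ccosh R)); first by move=> z; eexists; exact: slope_ccosh.
apply: entire1D; last exact: entire1_cst.
by apply: entire1M; [exact: entire1_cst | exact: entire1_id].
Qed.

Lemma entire1_cexpZ (k : R[i]) : entire1 (fun t => cexp (k * t)).
Proof.
apply: (entire1_comp (f := @cexp R)); first exact: entire1_cexp.
by apply: entire1M; [exact: entire1_cst | exact: entire1_id].
Qed.

Lemma ccosh_scale_inj (a b : R[i]) : (forall t, ccosh (a * t) = ccosh (b * t)) -> a = b \/ a = - b.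
Proof.
move=> H.
have H1 t : (cexp (a * t) - cexp (b * t)) * (cexp ((a + b) * t) - 1) = 0.
  by rewrite (mulrDl a b); have [->|->] := ccosh_eq (H t); rewrite subrr ?mul0r ?mulr0.
have e1 := entire1B (entire1_cexpZ a) (entire1_cexpZ b).
have e2 := entire1B (entire1_cexpZ (a + b)) (entire1_cst 1).
have [h|h] := entire1_mul0 e1 e2 H1; [left|right].
  by apply: cexp_scale_inj => t; apply/eqP; rewrite -subr_eq0 h.
apply/eqP; rewrite -subr_eq0 opprK; apply/eqP; apply: cexp_scale_inj => t.
by rewrite mul0r cexp0; apply/eqP; rewrite -subr_eq0 h.
Qed.

Lemma ccoshN (x : R[i]) : ccosh (- x) = ccosh x.
Proof. by rewrite /ccosh opprK addrC. Qed.

Lemma ccoshD_sum (x y : R[i]) : ccosh (x + y) + ccosh (y - x) = 2%:R * ccosh y * ccosh x.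
Proof.
rewrite /ccosh !opprD !opprK !cexpD !cexpN; field.
by rewrite !cexp_neq0.
Qed.

(** Half a period in the phase absorbs the sign ambiguity [B' = - B] left by [prodpow_eq]. *)
Lemma ccosh_halfturn (x : R[i]) : ccosh (x + tpi R / 2%:R) = - ccosh x.
Proof.
have h2 : cexp (tpi R / 2%:R) = -1.
  have : cexp (tpi R / 2%:R) ^+ 2 = 1.
    by rewrite -cexpMn mulrC divfK ?pnatr_eq0// cexp_tpi.
  move/eqP; rewrite sqrf_eq1 => /orP[/eqP|/eqP//] h.
  have [j hj] := cexp_eq1 h; exfalso.
  have : j%:~R * 2%:R = 1 :> R[i].
    by apply: (mulIf (tpi_neq0 R)); rewrite mulrAC -hj; field.
  have -> : j%:~R * 2%:R = (j * 2)%:~R :> R[i] by rewrite intrM.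
  rewrite -[1]/(1%:~R) => /intr_inj; lia.
by rewrite /ccosh opprD !cexpD !cexpN h2; field; exact: cexp_neq0.
Qed.

Lemma case_cosh z0 A B k d : B != 0 -> k != 0 ->
  (forall t, line z0 t = A + B * ccosh (k * t + d)) -> result.
Proof.
move=> B0 k0 H0; have [lo pE] := value_cosh (line_sol z0) B0 k0 H0.
pose C0 := k ^+ l; have C00 : C0 != 0 by rewrite expf_neq0.
have mn0 j : (0 < j)%N -> j%:R != 0 :> R[i] by rewrite pnatr_eq0 -lt0n.
have l2 : (0 < l %/ 2)%N by rewrite divn_gt0//; case: (l) l0 lo => [|[|]].
have ABn A' B' : B' != 0 -> A' + B' != A' - B' :> R[i].
  move=> Bn; rewrite -subr_eq0; have -> : A' + B' - (A' - B') = 2%:R * B' by ring.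
  by rewrite mulf_neq0// mn0.
pose v z := B^-1 * (u z + - A).
have ev : entire v by apply: entireZ; apply: entireD => //; exact: entire_cst.
pose V z t := v (z + t *: rho).
have eV t : entire (fun z => V z t) by exact: entire_shift.
have V0 z : V z 0 = v z by rewrite /V scale0r addr0.
have VD z s t : V (z + s *: rho) t = V z (s + t) by rewrite /V scalerDl addrA.
have lineV z t : line z t = A + B * V z t.
  by rewrite /V /v /line; field.
(* A constant line sits at one of the zeros [A + B] and [A - B] of [p], so the constant value of [V]
   is not 0. *)
have lines z : (exists2 c, c != 0 & forall t, V z t = c) \/
    exists k' d', k' ^+ l = C0 /\ forall t, V z t = ccosh (k' * t + d').
  case: (solution_class pm l0 (line_sol z)) => [Hc|[m' [c' [b' [A' [m0' c0' H']]]]]|[A' [B' [k' [B0' k0' H']]]]|[A' [B' [k' [d' [B0' k0' H']]]]]].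
  - left; exists (v z); last first.
      move=> t; rewrite -V0; apply: (mulfI B0); apply: (addrI A); rewrite -!lineV; exact: Hc.
    have := value_const l0 (line_sol z) Hc; rewrite pE => -[/eqP].
    rewrite lineV V0; apply: contraTneq => ->; rewrite mulr0 addr0.
    rewrite !mulf_neq0// expf_neq0//.
      by rewrite opprD addrA subrr sub0r oppr_eq0.
    by rewrite opprB addrC subrK.
  - have [ml' pE'] := value_power (line_sol z) m0' c0' H'; exfalso.
    apply: (@pow_neq_prodpow R A' (A + B) (A - B) (m'%:R ^+ l * c' ^+ (l %/ m')) C0 (l - l %/ m') (l %/ 2)) => //.
    + exact: ABn.
    + by rewrite mulf_neq0// expf_neq0// mn0.
    + by move=> w; have := pE' w; rewrite pE => -[].
  - have pE' := value_exp pm l0 (line_sol z) B0' k0' H'; exfalso.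
    apply: (@pow_neq_prodpow R A' (A + B) (A - B) (k' ^+ l) C0 l (l %/ 2)) => //.
    + exact: ABn.
    + exact: expf_neq0.
    + by move=> w; have := pE' w; rewrite pE => -[].
  - right; have [_ pE'] := value_cosh (line_sol z) B0' k0' H'.
    have [||cc AA BB] := @prodpow_eq R A B A' B' C0 (k' ^+ l) _ l2 C00 _ B0; first exact: expf_neq0.
      by move=> w; have := pE w; rewrite pE' => -[].
    have VB t : V z t = B^-1 * (B' * ccosh (k' * t + d')).
      have e : B * V z t = B' * ccosh (k' * t + d') by apply: (addrI A); rewrite -lineV H' AA.
      by rewrite -e mulKf.
    case: BB => BB.
      by exists k', d'; split => // t; rewrite VB BB mulKf.
    exists k', (d' + tpi R / 2%:R); split => // t.
    by rewrite VB BB addrA ccosh_halfturn mulNr mulrN mulKf.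
have [rs rsP] := rootsX_seq l0 C00.
(* The sum [V z t + V z (- t)] is free of the phase: only the finitely many roots [k'] remain, in a
   relation linear in entire functions of [z]. The extra index [None] stands for the constant
   lines. *)
have dalembert t z w : (V z t = v z /\ V w t = v w) \/
    exists k', V z t + V z (- t) = 2%:R * v z * ccosh (k' * t) /\
               V w t + V w (- t) = 2%:R * v w * ccosh (k' * t).
  pose W (o : option R[i]) z := if o is Some k' then V z t + V z (- t) + (- (2%:R * ccosh (k' * t))) * v z
    else V z t + -1 * v z.
  have [|z'|[k'|] _ [h1 h2]] := @entire_prod0 R n _ (None :: map Some rs) W _ _ z w.
  - case=> [k'|]; first exact: (entireD (entireD (eV t) (eV (- t))) (entireZ _ ev)).
    exact: (entireD (eV t) (entireZ _ ev)).
  - apply/eqP; rewrite prodf_seq_eq0; apply/hasP; have [[c _ Hc]|[k' [d' [kE Hk]]]] := lines z'.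
      by exists None; rewrite ?mem_head//= /W -V0 !Hc; apply/eqP; ring.
    exists (Some k'); first by rewrite inE /= mem_map ?rsP ?kE// => ? ? [].
    rewrite /= /W -V0 !Hk; apply/eqP.
    rewrite mulr0 add0r (mulrN k') [- _ + d']addrC ccoshD_sum; ring.
  - right; exists k'; move/eqP: h1; move/eqP: h2; rewrite /W /= !mulNr !subr_eq0.
    by move=> /eqP -> /eqP ->; split; ring.
  - left; move/eqP: h1; move/eqP: h2; rewrite /W /= !mulN1r !subr_eq0.
    by move=> /eqP -> /eqP ->.
have V0E t : V z0 t = ccosh (k * t + d).
  by apply: (mulfI B0); apply: (addrI A); rewrite -lineV H0.
(* [v] may vanish at [z0]; moving along the line to a point where it does not makes cancellation by
   [v z1] possible. *)
have [z1 [d1 [vz1 V1E]]] : exists z1 d1, v z1 != 0 /\ forall t, V z1 t = ccosh (k * t + d1).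
  have [s sE] : exists s, V z0 s != 0.
    apply: contrapT => h; apply: (@ccosh_nonconst k d 0 k0) => t; rewrite -V0E.
    by apply/eqP/negP => /negP hn; apply: h; exists t.
  exists (z0 + s *: rho), (k * s + d); split; first by rewrite -V0 VD addr0.
  by move=> t; rewrite VD V0E; congr ccosh; ring.
have two0 : 2%:R != 0 :> R[i] by rewrite mn0.
have sum1 k1 d2 z t : (forall t, V z t = ccosh (k1 * t + d2)) -> V z t + V z (- t) = 2%:R * v z * ccosh (k1 * t).
  move=> H; rewrite -V0 !H mulr0 add0r (mulrN k1) [- _ + d2]addrC; exact: ccoshD_sum.
have ediff : entire1 (fun t => ccosh (k * t + d1) - v z1).
  by apply: entire1B; [exact: entire1_ccosh | exact: entire1_cst].
have ecosh (a : R[i]) : entire1 (fun t => ccosh (a * t)).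
  by have := entire1_ccosh a 0; congr entire1; apply/funext => t; rewrite addr0.
have ndiff : ~ forall t, ccosh (k * t + d1) - v z1 = 0.
  by move=> h; apply: (@ccosh_nonconst k d1 (v z1) k0) => t; apply/eqP; rewrite -subr_eq0 h.
(* For each [t], the alternative [None] makes [ccosh (k * t + d1) - v z1] vanish, and the other one
   equates the cosines of the two lines. The product of both differences is zero for all [t] and its
   first factor is not identically zero, so the second is. A constant line would force
   [ccosh (k * t) = 1]; otherwise [k'] is [k] or [- k]. *)
have main z : v z != 0 -> exists d', forall t, V z t = ccosh (k * t + d').
  move=> vz; have [[c c0 Hc]|[k' [d' [kE Hk]]]] := lines z.
    exfalso; have P0 t : (ccosh (k * t + d1) - v z1) * (ccosh (k * t) - 1) = 0.
      have [[h _]|[k' [h1 h2]]] := dalembert t z1 z; first by rewrite -V1E h subrr mul0r.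
      rewrite (sum1 _ _ _ _ V1E) in h1.
      have -> : ccosh (k * t) = ccosh (k' * t).
        by apply: (mulfI (mulf_neq0 two0 vz1)); exact: h1.
      have -> : ccosh (k' * t) = 1.
        apply: (mulfI (mulf_neq0 two0 vz)); rewrite -h2 -V0 !Hc; ring.
      by rewrite subrr mulr0.
    have [//|h] := entire1_mul0 ediff (entire1B (ecosh k) (entire1_cst 1)) P0.
    by apply: (@ccosh_nonconst k 0 1 k0) => t; apply/eqP; rewrite addr0 -subr_eq0 h.
  have P0 t : (ccosh (k * t + d1) - v z1) * (ccosh (k * t) - ccosh (k' * t)) = 0.
    have [[h _]|[k2 [h1 h2]]] := dalembert t z1 z; first by rewrite -V1E h subrr mul0r.
    rewrite (sum1 _ _ _ _ V1E) in h1; rewrite (sum1 _ _ _ _ Hk) in h2.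
    have -> : ccosh (k * t) = ccosh (k2 * t).
      by apply: (mulfI (mulf_neq0 two0 vz1)); exact: h1.
    have -> : ccosh (k' * t) = ccosh (k2 * t).
      by apply: (mulfI (mulf_neq0 two0 vz)); exact: h2.
    by rewrite subrr mulr0.
  have [//|h] := entire1_mul0 ediff (entire1B (ecosh k) (ecosh k')) P0.
  have [kk|kk] : k = k' \/ k = - k'.
      by apply: ccosh_scale_inj => t; apply/eqP; rewrite -subr_eq0 h.
    by exists d'; rewrite kk.
  by exists (- d') => t; rewrite Hk kk mulNr -opprD ccoshN.
have mainE z : exists d', forall t, V z t = ccosh (k * t + d').
  have [s sE] : exists s, V z s != 0.
    have [[c c0 Hc]|[k' [d' [kE Hk]]]] := lines z; first by exists 0; rewrite Hc.
    have k'0 : k' != 0.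
      apply: contraNneq C00 => k'0; by rewrite -kE k'0 expr0n gtn_eqF.
    apply: contrapT => h; apply: (@ccosh_nonconst k' d' 0 k'0) => t; rewrite -Hk.
    by apply/eqP/negP => /negP hn; apply: h; exists t.
  have [|d' Hd] := main (z + s *: rho); first by rewrite -V0 VD addr0.
  exists (d' - k * s) => t; have := Hd (t - s); rewrite VD addrC subrK => ->.
  by congr ccosh; ring.
have [y yE] := ccosh_surj (2%:R : R[i]).
have sy : csinh y != 0.
  apply/negP => /eqP s0; have := csinh_sqr y; rewrite s0 yE expr0n /= => /eqP.
  by rewrite -natrX -(natrB _ (isT : (1 <= 4)%N)) eq_sym pnatr_eq0.
pose tau := y / k; have ktau : k * tau = y by rewrite /tau; field.
(* The phase [d'] is defined only modulo periods and sign conventions, but its exponential is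
   entire. The addition formula at [tau], where [k * tau = y] and [csinh y] is nonzero, extracts
   [csinh d'] from [V z tau]; adding [v z = ccosh d'] gives [cexp d']. *)
pose X z := v z + (csinh y)^-1 * (V z tau + (- ccosh y) * v z).
have eX : entire X.
  exact: (entireD ev (entireZ _ (entireD (eV tau) (entireZ _ ev)))).
have XE z d' : (forall t, V z t = ccosh (k * t + d')) -> X z = cexp d'.
  move=> H; rewrite /X -V0 !H mulr0 add0r ktau.
  have -> : ccosh (y + d') = ccosh y * ccosh d' + csinh y * csinh d'.
    by rewrite /ccosh /csinh !opprD !cexpD !cexpN; field; rewrite !cexp_neq0.
  have -> : ccosh y * ccosh d' + csinh y * csinh d' + - ccosh y * ccosh d' = csinh y * csinh d' by ring.
  by rewrite mulKf// /ccosh /csinh; field.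
have Xn z : X z != 0 by have [d' Hd] := mainE z; rewrite (XE _ _ Hd) cexp_neq0.
have [La eLa LaE] := entire_log eX Xn.
have VE z t : V z t = ccosh (k * t + La z).
  have [d' Hd] := mainE z; rewrite Hd /ccosh !cexpN !cexpD.
  by have -> : cexp d' = cexp (La z) by rewrite LaE (XE _ _ Hd).
have [sigma [s1 s2]] := dual_form.
have [ePhi dPhi] := proj_entire s2 eLa.
set q := C0 *: (('X - (A + B)%:P) ^+ (l %/ 2) * ('X - (A - B)%:P) ^+ (l %/ 2)).
have sq : (size q).-1 = l.
  rewrite size_scale// size_mul ?expf_neq0 ?polyXsubC_eq0// !size_exp_XsubC.
  by rewrite addSn addnS /= addnn -muln2 divnK// dvdn2.
exists q; split.
  by move=> w; rewrite pE hornerZ hornerM !horner_exp !hornerXsubC.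
rewrite /normal_form sq; exists (A + B), (A - B), C0, k, sigma, (fun z => La (proj rho sigma z)).
split; first by split => //; exact: ABn.
apply: Or44; split => // z.
rewrite -VE -{1}(projK rho sigma z) -/(line _ _) lineV.
have -> : (A + B - (A - B)) / 2%:R = B by field.
have -> : (A + B + (A - B)) / 2%:R = A by field.
by rewrite addrC.
Qed.

Lemma all_cases : result.
Proof.
case: (pselect (forall z t, line z t = u z)) => [|H]; first exact: case_zero.
have [z0 nz0] : exists z0, ~ forall t, line z0 t = line z0 0.
  apply: contrapT => h; apply: H => z; apply: contrapT => hz; apply: h; exists z => hz'.
  by apply: hz => t; rewrite hz' line0.
case: (solution_class pm l0 (line_sol z0)) => [//|[m [c [b [A [m0 c0 H']]]]]|[A [B [k [B0 k0 H']]]]|[A [B [k [d [B0 k0 H']]]]]].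
- exact: case_power m0 c0 H'.
- exact: case_exp B0 k0 H'.
- exact: case_cosh B0 k0 H'.
Qed.

End Cases.

Theorem theorem1p3 (R : realType) (n : nat) (l : nat) (rho : 'rV[R[i]]_n)
    (p : R[i] -> option R[i]) (u : 'rV[R[i]]_n -> R[i])
    (l_ge1 : (1 <= l)%N) (rho_neq0 : rho != 0)
    (p_mero : meromorphic p) (u_entire : entire u)
    (u_nonconst : ~ exists b : R[i], forall z, u z = b)
    (u_sol : forall z,
      p (u z) = Some ((\sum_(j < n) rho 0 j * partial u j z) ^+ l)) :
  exists q : {poly R[i]},
    (forall w, p w = Some q.[w]) /\
    let h := (size q).-1 in
    exists (a1 a2 c0 r : R[i]) (sigma : 'rV[R[i]]_n) (Phi : 'rV[R[i]]_n -> R[i]),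
      let L := fun z : 'rV[R[i]]_n => \sum_(j < n) sigma 0 j * z 0 j in
      [/\ a1 != a2,
          r ^+ l = c0,
          \sum_(j < n) rho 0 j * sigma 0 j = 1,
          entire Phi &
          forall z, \sum_(j < n) rho 0 j * partial Phi j z = 0] /\
      [\/ (forall z, u z = r * L z + Phi z) /\ h = 0%N /\ q = c0%:P,
          (forall z, u z =
             ((l - h)%:R / l%:R * r * L z + Phi z) ^+ (l %/ (l - h)) + a1) /\
          (h < l)%N /\ (l - h %| l)%N /\ q = c0 *: ('X - a1%:P) ^+ h,
          (forall z, u z = Phi z * cexp (r * L z) + a1) /\
          h = l /\ q = c0 *: ('X - a1%:P) ^+ l |
          (forall z, u z =
             (a1 - a2) / 2%:R * ccosh (r * L z + Phi z) + (a1 + a2) / 2%:R) /\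
          h = l /\ ~~ odd l /\
          q = c0 *: (('X - a1%:P) ^+ (l %/ 2) * ('X - a2%:P) ^+ (l %/ 2))].
Proof.
exact: (all_cases l_ge1 rho_neq0 p_mero u_entire u_nonconst u_sol).
Qed.
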